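(* Given $\epsilon_0>0$, there exist $q(\epsilon_0)\in\mathbb{N}$ and $\epsilon>0$ such that: if $q\ge q(\epsilon_0)$ is a prime power, $X$ is a $2$-dimensional non-partite Ramanujan complex that is a quotient of the Bruhat–Tits building of $PGL_3(\mathbb{F}_q((t)))$, and $\alpha\in C^1(X,\mathbb{F}_2)$ is a locally minimal $1$-cochain with $\|\alpha\|<\frac{1}{4(1+\epsilon_0)}$, then $\|\delta_1(\alpha)\|\ge\epsilon\|\alpha\|$.
   Context: Building and Ramanujan quotients: for $F=\mathbb{F}_q((t))$ with $\mathcal{O}=\mathbb{F}_q[[t]]$, $\pi=t$, $\tilde A_2(F)$ has vertices the homothety classes of $\mathcal{O}$-lattices in $F^3$, with $[L_0],\dots,[L_i]$ an $i$-cell iff representatives satisfy $\pi L_0'\subsetneq L_i'\subsetneq\cdots\subsetneq L_0'$. A quotient is $X=\Gamma\backslash\tilde A_2(F)$, $\Gamma\le G=PGL_3(F)$ cocompact discrete with $\mathrm{dist}(\gamma x,x)>2$ for all vertices $x$, $1\ne\gamma\in\Gamma$. Non-partite means $\Gamma G_0=G$, $G_0=PSL_3(F)\cdot PGL_3(\mathcal{O})$. With vertex colors $\tau([L])=\mathrm{val}\det(\text{basis})\bmod 3$, edge colors $\tau(x,y)=\tau(x)-\tau(y)$, Hecke operators $A_jf(x)=\sum_{\tau(x,y)=j}f(y)$ ($j=1,2$), a non-partite $X$ is Ramanujan if every joint eigenvalue of $(A_1,A_2)$ on functions on $X(0)$ orthogonal to constants lies in the joint spectrum of $(A_1,A_2)$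 on $L^2$ of the building's vertices. Cochains: for $\sigma\in X(i)$, $c(\sigma)$ is the number of $2$-cells containing $\sigma$, $w(\sigma)=c(\sigma)/(\binom{3}{i+1}|X(2)|)$; $C^i(X,\mathbb{F}_2)$ = functions $X(i)\to\mathbb{F}_2$ identified with subsets, $\|\alpha\|=\sum_{\sigma\in\alpha}w(\sigma)$; $\delta_i(\alpha)(\sigma)=\sum_{\tau\subset\sigma,\dim\tau=i}\alpha(\tau)$. For a vertex $v$, the link $X_v=\{\sigma\setminus\{v\}:v\in\sigma\in X\}$ is a graph, and $\alpha\in C^1(X)$ induces $\alpha_v\in C^0(X_v)$, $\alpha_v(u)=\alpha(\{u,v\})$. $\alpha\in C^1(X,\mathbb{F}_2)$ is locally minimal if for every vertex $v$, $\|\alpha_v\|\le\|\alpha_v+\mathbf{1}\|$ in $X_v$ (norm in $X_v$ defined by its own weights; $\mathbf{1}$ the constant function). *)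

(* Defs.v *)
From HB Require Import structures.
From mathcomp Require Import all_boot all_order all_algebra.
From mathcomp Require Import fraction complex.
From mathcomp Require Import all_classical reals ereal esum.

Set Implicit Arguments.
Unset Strict Implicit.
Unset Printing Implicit Defensive.

Import Order.TTheory GRing.Theory Num.Theory.
Local Open Scope ring_scope.

(* A complex on a finite vertex type [V] is a [{set {set V}}]; an i-cell is
   a member with i+1 elements. *)

Section Complexes.
Variable V : finType.
Implicit Types (X : {set {set V}}) (s t : {set V}) (v : V).

Definition cells X (i : nat) : {set {set V}} := [set s in X | #|s| == i.+1].

Definition coface_count (d : nat) X s : nat :=
  #|[set t in cells X d | s \subset t]|.

(* [d] is the dimension of the complex: 2 for a quotient of the building, 1
   for a vertex link; [#|s|] is i+1 for an i-cell [s]. *)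
Definition weight (R : realType) (d : nat) X s : R :=
  (coface_count d X s)%:R / ('C(d.+1, #|s|) * #|cells X d|)%:R.

(* An i-cochain is a function on [{set V}] of which only the values on
   [cells X i] are ever used. *)
Definition cochain : Type := {set V} -> 'F_2.

Definition cnorm (R : realType) (d : nat) X (i : nat) (a : cochain) : R :=
  \sum_(s in cells X i | a s != 0) weight R d X s.

Definition coboundary X (i : nat) (a : cochain) : cochain :=
  fun s => \sum_(t in cells X i | t \subset s) a t.

Definition link X v : {set {set V}} := [set s :\ v | s in [set s in X | v \in s]].

(* On the singleton [set u] this is a [set u; v]. *)
Definition link_cochain (a : cochain) v : cochain := fun s => a (v |: s).

Definition locally_minimal (R : realType) X (a : cochain) : Prop :=
  forall v, [set v] \in X ->
    cnorm R 1 (link X v) 0 (link_cochain a v)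
      <= cnorm R 1 (link X v) 0 (fun s => link_cochain a v s + 1).

End Complexes.

(* K[[t]], coefficient by coefficient. The alias is needed because [nat -> K]
   carries the pointwise product. *)

Definition fps (K : fieldType) : Type := nat -> K.

Section PowerSeries.
Variable K : fieldType.
Implicit Types a b c : fps K.

HB.instance Definition _ := Choice.copy (fps K) (nat -> K).

Definition fps_zero : fps K := fun _ => 0.
Definition fps_one : fps K := fun n => (n == 0%N)%:R.
Definition fps_opp a : fps K := fun n => - a n.
Definition fps_add a b : fps K := fun n => a n + b n.
Definition fps_mul a b : fps K := fun n => \sum_(i < n.+1) a i * b (n - i)%N.

Fact fps_addA : associative fps_add.
Proof. by move=> a b c; apply/funext => n; rewrite /fps_add addrA. Qed.
Fact fps_addC : commutative fps_add.
Proof. by move=> a b; apply/funext => n; rewrite /fps_add addrC. Qed.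
Fact fps_add0 : left_id fps_zero fps_add.
Proof. by move=> a; apply/funext => n; rewrite /fps_add add0r. Qed.
Fact fps_addN : left_inverse fps_zero fps_opp fps_add.
Proof. by move=> a; apply/funext => n; rewrite /fps_add addNr. Qed.

HB.instance Definition _ :=
  GRing.isZmodule.Build (fps K) fps_addA fps_addC fps_add0 fps_addN.

Let tr (n : nat) a : {poly K} := \poly_(i < n.+1) a i.

Let trE n a i : (i <= n)%N -> (tr n a)`_i = a i.
Proof. by move=> le_in; rewrite coef_poly ltnS le_in. Qed.

Let fps_mulE n a b i : (i <= n)%N -> fps_mul a b i = (tr n a * tr n b)`_i.
Proof.
move=> le_in; rewrite coefM; apply: eq_bigr => j _.
by rewrite !trE // (leq_trans _ le_in) ?leq_subr // -ltnS.
Qed.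

Fact fps_mulC : commutative fps_mul.
Proof. by move=> a b; apply/funext => n; rewrite !(@fps_mulE n) // mulrC. Qed.

Fact fps_mulA : associative fps_mul.
Proof.
move=> a b c; apply/funext => n.
transitivity ((tr n a * tr n b * tr n c)`_n).
  rewrite -mulrA coefM; apply: eq_bigr => i _.
  by rewrite (@fps_mulE n) ?leq_subr // trE // -ltnS.
rewrite coefM; apply: eq_bigr => i _.
by rewrite (@fps_mulE n) ?trE ?leq_subr // -ltnS.
Qed.

Fact fps_mul1 : left_id fps_one fps_mul.
Proof.
move=> a; apply/funext => n.
rewrite /fps_mul big_ord_recl /fps_one eqxx mul1r subn0 big1 ?addr0 // => i _.
by rewrite mul0r.
Qed.

Fact fps_mulDl : left_distributive fps_mul fps_add.
Proof.
move=> a b c; apply/funext => n.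
by rewrite /fps_add /fps_mul -big_split; apply: eq_bigr => i _; rewrite mulrDl.
Qed.

Fact fps_one_neq0 : fps_one != 0 :> fps K.
Proof. by apply/eqP => /(congr1 (fun a : fps K => a 0%N)) /eqP; rewrite oner_eq0. Qed.

HB.instance Definition _ :=
  GRing.Zmodule_isComNzRing.Build (fps K)
    fps_mulA fps_mulC fps_mul1 fps_mulDl fps_one_neq0.

Definition fps_unit : pred (fps K) := fun a => `[< exists b : fps K, b * a = 1 >].
Definition fps_inv a : fps K := xget a [set b : fps K | b * a = 1]%classic.

Fact fps_mulV : {in fps_unit, left_inverse 1 fps_inv *%R}.
Proof. by move=> a /asboolP; rewrite /fps_inv; apply: (@xgetPex _ a). Qed.

Fact fps_unitP a b : b * a = 1 -> fps_unit a.
Proof. by move=> ba1; apply/asboolP; exists b. Qed.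

Fact fps_inv_out : {in [predC fps_unit], fps_inv =1 id}.
Proof.
move=> a /asboolP na; rewrite /fps_inv; case: xgetP => // b _ ba1.
by case: na; exists b.
Qed.

HB.instance Definition _ :=
  GRing.ComNzRing_hasMulInverse.Build (fps K) fps_mulV fps_unitP fps_inv_out.

Fact fps_idomain : GRing.integral_domain_axiom (fps K).
Proof.
have lowest a : a != 0 -> {n | a n != 0 & forall i, (i < n)%N -> a i = 0}.
  move=> a0; have ex : exists n, a n != 0.
    apply: contrapT => /forallNP na; move/eqP: a0; apply; apply/funext => n.
    by apply/eqP; apply: contrapT => /negP/na.
  exists (ex_minn ex); case: ex_minnP => // m _ m_min i lt_im.
  by apply/eqP; apply/negPn/negP => /m_min; rewrite leqNgt lt_im.
move=> a b ab0; apply/norP => -[/lowest[m am0 ma] /lowest[n bn0 nb]].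
move/(congr1 (fun c : fps K => c (m + n)%N)): ab0; apply/eqP.
have lt_m : (m < (m + n).+1)%N by rewrite ltnS leq_addr.
change (fps_mul a b (m + n)%N != 0).
rewrite /fps_mul (bigD1 (Ordinal lt_m)) //= addKn big1 ?addr0 ?mulf_neq0 //.
move=> i; rewrite -val_eqE /= neq_ltn => /orP[lt_im | lt_mi].
  by rewrite ma ?mul0r.
rewrite [b _]nb ?mulr0 // ltn_subLR ?ltn_add2r //.
by rewrite -ltnS.
Qed.

HB.instance Definition _ :=
  GRing.ComUnitRing_isIntegral.Build (fps K) fps_idomain.

Definition fps_t : fps K := fun n => (n == 1%N)%:R.

End PowerSeries.

(* K((t)) as the fraction field of K[[t]]. *)
Notation laurent K := {fraction (fps K)}.

Local Open Scope classical_set_scope.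

Section Building.
Variable K : fieldType.
Local Notation O := (fps K).
Local Notation F := (laurent K).
Implicit Types (g h : 'M[F]_3) (L M : set 'cV[F]_3).

Definition unif : F := tofrac (fps_t K).

Definition is_integral : set F := range (@tofrac O).

(* For x = 0 the set is empty and the value is the default 0. *)
Definition laurent_val (x : F) : int :=
  xget 0 [set n : int |
    exists2 u : O, u \is a GRing.unit & x = unif ^ n * tofrac u].

Definition lattice_of g : set 'cV[F]_3 :=
  [set g *m v | v in [set v : 'cV[F]_3 | forall i, is_integral (v i ord0)]].

Definition is_lattice L : Prop := exists2 g, g \in unitmx & L = lattice_of g.

Definition scale_lattice (a : F) L : set 'cV[F]_3 := [set a *: v | v in L].

Definition homothety_class L : set (set 'cV[F]_3) :=
  [set scale_lattice a L | a in [set a | a != 0]].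

Definition is_vertex (c : set (set 'cV[F]_3)) : Prop :=
  exists2 L, is_lattice L & c = homothety_class L.

Definition vertex : Type := {c : set (set 'cV[F]_3) | `[< is_vertex c >]}.
HB.instance Definition _ := Choice.on vertex.

(* x 0, ..., x i are the vertices of an i-cell, in an order for which the
   representatives L 0, ..., L i form the required chain. *)
Definition building_cell (i : nat) (x : 'I_i.+1 -> vertex) : Prop :=
  exists L : 'I_i.+1 -> set 'cV[F]_3,
    [/\ forall k, \val (x k) (L k),
        forall j k : 'I_i.+1, (j < k)%N -> L k `<` L j
      & scale_lattice unif (L ord0) `<` L ord_max].

Definition adjacent : rel vertex := fun x y =>
  `[< exists2 e : 'I_2 -> vertex, building_cell e
        & [set x; y] = range e >].

Definition dist_le (n : nat) (x y : vertex) : Prop :=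
  exists2 p : seq vertex, path adjacent x p /\ last x p = y & (size p <= n)%N.

Definition color (x : vertex) : 'Z_3 :=
  xget 0 [set k : 'Z_3 |
    exists g, [/\ g \in unitmx, \val x (lattice_of g)
                & k = (laurent_val (\det g))%:~R]].

Definition colored_edge (j : 'Z_3) (x y : vertex) : Prop :=
  adjacent x y /\ color x - color y = j.

Definition act_lattice g L : set 'cV[F]_3 := [set g *m v | v in L].

Definition moves_to g (x y : vertex) : Prop :=
  \val y = [set act_lattice g L | L in \val x].

(* A subgroup of PGL_3(F) is represented by its full inverse image in GL_3(F),
   i.e. by a subgroup of GL_3(F) containing all nonzero scalar matrices. *)

Definition GL3 : set 'M[F]_3 := [set g | g \in unitmx].

Definition scalars : set 'M[F]_3 := [set a%:M | a in [set a : F | a != 0]].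

Definition pgl_subgroup (Gam : set 'M[F]_3) : Prop :=
  [/\ Gam `<=` GL3, scalars `<=` Gam,
      forall g h, Gam g -> Gam h -> Gam (g *m h)
    & forall g, Gam g -> Gam (invmx g)].

Definition gl_open (U : set 'M[F]_3) : Prop :=
  U `<=` GL3 /\
  forall g, U g -> exists n : nat, forall h, GL3 h ->
    (forall i j, is_integral ((h - g) i j / unif ^+ n)) -> U h.

(* The open subsets of PGL_3(F) are the open subsets of GL_3(F) that are
   invariant under the scalars; the identity is isolated in the subgroup. *)
Definition pgl_discrete (Gam : set 'M[F]_3) : Prop :=
  exists U : set 'M[F]_3,
    [/\ gl_open U, forall z g, scalars z -> U g -> U (z *m g),
        U 1%:M & U `&` Gam `<=` scalars].

(* Compactness of Gam \ PGL_3(F) in the quotient topology, whose open sets are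
   the Gam-invariant open subsets of GL_3(F). *)
Definition pgl_cocompact (Gam : set 'M[F]_3) : Prop :=
  forall C : set (set 'M[F]_3),
    (forall U, C U -> gl_open U /\ forall g h, Gam g -> U h -> U (g *m h)) ->
    GL3 `<=` \bigcup_(U in C) U ->
    exists2 D : set (set 'M[F]_3), finite_set D /\ D `<=` C
      & GL3 `<=` \bigcup_(U in D) U.

Definition large_displacement (Gam : set 'M[F]_3) : Prop :=
  forall g x y, Gam g -> ~ scalars g -> moves_to g x y -> ~ dist_le 2 y x.

(* The inverse image in GL_3(F) of PSL_3(F) . PGL_3(O). *)
Definition G0 : set 'M[F]_3 :=
  [set g | exists z s (k : 'M[O]_3),
     [/\ scalars z, \det s = 1, k \in unitmx
       & g = z *m s *m map_mx (@tofrac O) k]].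

Definition non_partite (Gam : set 'M[F]_3) : Prop :=
  forall g, GL3 g -> exists c h, [/\ Gam c, G0 h & g = c *m h].

(* [p] identifies the finite type [V] with the set of Gam-orbits of vertices;
   for cocompact Gam this orbit set is finite. *)

Definition is_quotient_map (V : finType) (Gam : set 'M[F]_3) (p : vertex -> V)
    : Prop :=
  (forall u, exists x, p x = u) /\
  (forall x y, p x = p y <-> exists2 g, Gam g & moves_to g x y).

Definition quotient_complex (V : finType) (p : vertex -> V) : {set {set V}} :=
  finset (fun s : {set V} =>
    `[< exists i (x : 'I_i.+1 -> vertex),
          building_cell x /\ s = [set p (x k) | k in 'I_i.+1]%SET >]).

Definition quotient_edge (V : finType) (p : vertex -> V) (j : 'Z_3) (u v : V)
    : Prop :=
  exists x y, [/\ p x = u, p y = v & colored_edge j x y].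

End Building.

Section Hecke.
Variable R : realType.
Local Notation C := (R[i]%type).

(* The operator A_j when [E] is the relation "(x, y) is an edge of color j". *)
Definition hecke (T : choiceType) (E : T -> T -> Prop) (f : T -> C) : T -> C :=
  fun x => \sum_(y \in [set y | E x y]) f y.

Definition l2sq (T : choiceType) (f : T -> C) : \bar R :=
  \esum_(x in [set: T]) (Normc.normc (f x) ^+ 2)%:E.

(* The A_j commute and are normal on L^2, so their joint spectrum consists of
   the joint approximate eigenvalues. *)
Definition joint_spectrum (T : choiceType) (E : 'Z_3 -> T -> T -> Prop)
    (l1 l2 : C) : Prop :=
  forall e : R, 0 < e -> exists f : T -> C,
    [/\ l2sq f = 1%E,
        (l2sq (fun x => (hecke (E 1%R) f x - l1 * f x)%R) < e%:E)%E
      & (l2sq (fun x => (hecke (E 2%:R%R) f x - l2 * f x)%R) < e%:E)%E].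

Definition nonconstant_joint_eigenvalue (T : finType)
    (E : 'Z_3 -> T -> T -> Prop) (l1 l2 : C) : Prop :=
  exists f : T -> C,
    [/\ exists x, f x != 0, \sum_x f x = 0,
        forall x, hecke (E 1) f x = l1 * f x
      & forall x, hecke (E 2%:R) f x = l2 * f x].

Definition is_ramanujan (K : fieldType) (V : finType) (p : vertex K -> V)
    : Prop :=
  forall l1 l2 : C,
    nonconstant_joint_eigenvalue (quotient_edge p) l1 l2 ->
    joint_spectrum (@colored_edge K) l1 l2.

End Hecke.

(* Main.v *)
Require Import Defs.
From HB Require Import structures.
From mathcomp Require Import all_boot all_order all_algebra.
From mathcomp Require Import fraction complex sesquilinear spectral.
From mathcomp Require Import ring lra zify.
From mathcomp Require Import all_classical reals ereal esum.
(* Gives the finite-set lemmas precedence over their namesakes on [set]. *)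
From mathcomp Require Import fintype finset.

(** Write [q] for the order of the residue field. A vertex of the building
    is adjacent to the [q^2+q+1] points and [q^2+q+1] lines of the projective
    plane of [L/tL], and its link is the incidence graph of that plane; large
    displacement makes the quotient map injective on stars, so the same holds
    in the quotient.

    For a 1-cochain [a], counting at each vertex [u] the triangles in which
    exactly one of the two edges at [u] lies in [a] gives
    [|delta a| >= sum_u cut(u) - (q+1)|a|], and the spectral gap of the
    incidence graph bounds [cut(u)] below by
    [(q+1)(x - x^2/(2(q^2+q+1))) - sqrt q x] where [x] is the degree of [a]
    at [u]. Local minimality is [x <= q^2+q+1], so thin vertices, for which
    [x] is smaller by a factor [1-mu], contribute a definite gain. If thin
    vertices carry a small part of [a], almost all of [a] lies inside the set
    of fat vertices, which has relative density less than [1/2] by the bound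
    on the norm of [a]; this contradicts the expander mixing lemma for large
    [q].

    The eigenvalue bound needed there is only [o(q^2)], and it is obtained from
    Schur's test on the building with the weight [sqrt q ^ (3 m - d)], where
    [d] is the valuation of the determinant and [m] the least valuation of a
    first coordinate on the lattice: both Hecke operators multiply this weight
    by [q + (q+1) sqrt q]. The operator [A_1] on the quotient is normal because
    two distinct vertices with a common out-neighbor of color 1 have only one,
    and then they also have a common in-neighbor. *)

Set Implicit Arguments.
Unset Strict Implicit.
Unset Printing Implicit Defensive.

Import Order.TTheory GRing.Theory Num.Theory.
Local Open Scope ring_scope.

(** * Projective planes *)

Lemma sum_nat_bool (T : finType) (A Q : pred T) :
  (\sum_(x | A x) Q x = #|[set x | A x && Q x]|)%N.
Proof.
rewrite -sum1dep_card [RHS]big_mkcondr.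
by apply: eq_bigr => x _; case: (Q x).
Qed.

Lemma sum_natr_bool (R : pzSemiRingType) (T : finType) (A Q : pred T) :
  \sum_(x | A x) (Q x)%:R = #|[set x | A x && Q x]|%:R :> R.
Proof. by rewrite -sum_nat_bool natr_sum. Qed.

Lemma sum_setI (R : pzSemiRingType) (T : finType) (A B : {set T}) (F : T -> R) :
  \sum_(x in A :&: B) F x = \sum_(x in A) (x \in B)%:R * F x.
Proof.
under eq_bigl => x do rewrite inE.
by rewrite big_mkcondr; apply: eq_bigr => x _; case: ifP; rewrite ?mul1r ?mul0r.
Qed.

(* Points and lines are elements of one type, the vertices of the incidence
   graph; the last axiom and the cardinalities make [I] a projective plane of
   order [q]. *)
Record projective_plane (T : finType) (P L : {set T}) (I : rel T) (q : nat) :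
    Prop := ProjectivePlane {
  plane_order_gt0 : (0 < q)%N;
  disjoint_points_lines : [disjoint P & L];
  card_points : #|P| = (q ^ 2 + q + 1)%N;
  card_lines : #|L| = (q ^ 2 + q + 1)%N;
  card_lines_through x : x \in P -> #|[set y in L | I x y]| = q.+1;
  card_points_on y : y \in L -> #|[set x in P | I x y]| = q.+1;
  card_common_lines x x' : x \in P -> x' \in P -> x != x' ->
    (#|[set y in L | I x y && I x' y]| <= 1)%N }.

Section Incidences.
Variables (R : rcfType) (T : finType) (P L : {set T}) (I : rel T) (q : nat).
Hypothesis plane : projective_plane P L I q.
Variable A : {set T}.
Local Notation n := ((q ^ 2 + q + 1)%N%:R : R).
Local Notation k := (q.+1%:R : R).
Local Notation s := (Num.sqrt (q%:R : R)).
Local Notation a := (#|P :&: A|%:R : R).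
Local Notation b := (#|L :&: A|%:R : R).

Lemma plane_order_natr : n = q%:R ^+ 2 + q%:R + 1.
Proof. by rewrite !natrD natrX. Qed.

Lemma plane_card_gt0 : 0 < n.
Proof. by rewrite ltr0n addn1. Qed.

Definition incidences y : R := \sum_(x in P :&: A) (I x y)%:R.

Definition mean_incidence : R := k * a / n.

Lemma sum_incidences : \sum_(y in L) incidences y = k * a.
Proof.
rewrite exchange_big (eq_bigr (fun=> k)) => [|x /setIP[xP _]].
  by rewrite sumr_const mulr_natr.
by rewrite sum_natr_bool (card_lines_through plane).
Qed.

Lemma sum_incidences_sq :
  \sum_(y in L) incidences y ^+ 2 <= a ^+ 2 + q%:R * a.
Proof.
have -> : \sum_(y in L) incidences y ^+ 2 = \sum_(x in P :&: A)
    \sum_(x' in P :&: A) #|[set y in L | I x y && I x' y]|%:R.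
  under eq_bigr => y _ do rewrite expr2 big_distrlr.
  rewrite exchange_big; apply: eq_bigr => x _.
  rewrite exchange_big; apply: eq_bigr => x' _; rewrite -sum_natr_bool.
  by apply: eq_bigr => y _ /=; rewrite -natrM mulnb.
have -> : a ^+ 2 + q%:R * a = \sum_(x in P :&: A)
    \sum_(x' in P :&: A) (1 + (x' == x)%:R * q%:R).
  rewrite (eq_bigr (fun=> a + q%:R)) => [|x xA].
    by rewrite sumr_const -mulr_natr; ring.
  rewrite big_split sumr_const -mulr_suml /= (bigD1 x) //= eqxx big1 => [|x'].
    by rewrite addr0 mul1r.
  by move=> /andP[_ /negPf->].
apply: ler_sum => x /setIP[xP _]; apply: ler_sum => x' /setIP[x'P _].
have [->|xx'] := eqVneq x' x.
  under eq_finset => y do rewrite andbb.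
  by rewrite (card_lines_through plane) // mul1r nat1r.
rewrite mul0r addr0 (ler_nat _ _ 1) (card_common_lines plane) //.
by rewrite eq_sym.
Qed.

Lemma incidences_variance :
  \sum_(y in L) (incidences y - mean_incidence) ^+ 2 <= q%:R * a.
Proof.
pose c := mean_incidence.
have cn : c * n = k * a by rewrite divfK // gt_eqF ?plane_card_gt0.
have -> : \sum_(y in L) (incidences y - c) ^+ 2 =
    \sum_(y in L) incidences y ^+ 2 - c ^+ 2 * n.
  under eq_bigr => y _ do rewrite sqrrB -mulr_natr -mulrA.
  rewrite big_split sumrB -mulr_suml sum_incidences sumr_const.
  by rewrite (card_lines plane) -cn -(mulr_natr (c ^+ 2)) /=; ring.
have : a ^+ 2 <= c ^+ 2 * n.
  rewrite -(ler_pM2r plane_card_gt0).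
  have -> : c ^+ 2 * n * n = a ^+ 2 * k ^+ 2.
    by rewrite -mulrA -expr2 -exprMn cn exprMn mulrC.
  rewrite ler_wpM2l ?sqr_ge0 // plane_order_natr -natr1 sqrrD1 mulr2n.
  by rewrite lerD2r lerD2l lerDl ler0n.
by have := sum_incidences_sq; lra.
Qed.

Lemma sum_incidences_in :
  2 * \sum_(y in L :&: A) incidences y
    <= 2 * mean_incidence * b + s * (a + b).
Proof.
pose c := mean_incidence.
have s_gt0 : 0 < s by rewrite sqrtr_gt0 ltr0n (plane_order_gt0 plane).
have am_gm d : 2 * d <= s + d ^+ 2 / s.
  rewrite -(ler_pM2r s_gt0) [leRHS]mulrDl divfK ?gt_eqF //.
  by have := sqr_ge0 (d - s); lra.
have -> : 2 * \sum_(y in L :&: A) incidences y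
    = 2 * c * b + \sum_(y in L :&: A) 2 * (incidences y - c).
  by rewrite -mulr_sumr sumrB sumr_const -(mulr_natr c) /=; ring.
rewrite lerD2l (le_trans (ler_sum _ (fun y _ => am_gm _))) //.
rewrite big_split sumr_const -mulr_suml -(mulr_natr s) /= mulrDr addrC lerD2r.
rewrite ler_pdivrMr // mulrAC -expr2 sqr_sqrtr ?ler0n //.
rewrite (le_trans _ incidences_variance) // [leRHS](big_setID A) /= lerDl.
by apply: sumr_ge0 => y _; apply: sqr_ge0.
Qed.

(* The spectral gap of the incidence graph, whose nontrivial eigenvalues are
   [sqrt q] and [- sqrt q], in the form of an edge expansion. *)
Lemma incidence_cut_bound (x := a + b) :
  k * x - k * x ^+ 2 / (2 * n) - s * x
    <= \sum_(u in P) \sum_(w in L) (I u w && ((u \in A) != (w \in A)))%:R.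
Proof.
pose deg u w : R := (I u w)%:R.
have cut_split u w : (I u w && ((u \in A) != (w \in A)))%:R
    = (u \in A)%:R * deg u w + (w \in A)%:R * deg u w
      - 2 * ((w \in A)%:R * ((u \in A)%:R * deg u w)).
  by rewrite /deg; do 3!case: (_ \in _) || case: (I _ _); rewrite /=; ring.
have sum_points : \sum_(u in P) \sum_(w in L) (u \in A)%:R * deg u w = k * a.
  rewrite -sum_incidences exchange_big; apply: eq_bigr => w _.
  by rewrite /incidences sum_setI.
have sum_lines : \sum_(u in P) \sum_(w in L) (w \in A)%:R * deg u w = k * b.
  rewrite exchange_big (eq_bigr (fun w => (w \in A)%:R * k)) => [|w wL].
    by rewrite -sum_setI sumr_const mulr_natr.
  by rewrite -mulr_sumr sum_natr_bool (card_points_on plane).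
have sum_both : \sum_(u in P) \sum_(w in L)
    (w \in A)%:R * ((u \in A)%:R * deg u w) = \sum_(y in L :&: A) incidences y.
  rewrite sum_setI exchange_big; apply: eq_bigr => w _.
  by rewrite -mulr_sumr /incidences sum_setI.
have -> : \sum_(u in P) \sum_(w in L) (I u w && ((u \in A) != (w \in A)))%:R
    = k * x - 2 * \sum_(y in L :&: A) incidences y.
  under eq_bigr => u _ do under eq_bigr => w _ do rewrite cut_split.
  under eq_bigr => u _ do rewrite sumrB big_split /= -[X in _ - X]mulr_sumr.
  rewrite sumrB big_split /= -[X in _ - X]mulr_sumr.
  by rewrite sum_points sum_lines sum_both /x mulrDr.
have mean_le : 2 * mean_incidence * b <= k * x ^+ 2 / (2 * n).
  rewrite ler_pdivlMr ?mulr_gt0 ?plane_card_gt0 //.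
  have -> : 2 * mean_incidence * b * (2 * n) = k * (4 * a * b).
    by rewrite /mean_incidence; field; rewrite gt_eqF ?plane_card_gt0.
  by rewrite ler_wpM2l ?ler0n // /x; have := sqr_ge0 (a - b); lra.
by have := sum_incidences_in; rewrite -/x; lra.
Qed.

End Incidences.

(** * Cochains *)

Lemma F2_addr_neq0 (x y : 'F_2) : (x + y != 0) = ((x != 0) != (y != 0)).
Proof. by case: x => -[|[|]] // ?; case: y => -[|[|]]. Qed.

Lemma setD1_inj (V : finType) (u : V) :
  {in [pred s : {set V} | u \in s] &, injective (fun s => s :\ u)}.
Proof. by move=> s t us ut st; rewrite -(setD1K us) st setD1K. Qed.

Section Cochains.
Variables (V : finType) (X : {set {set V}}).
Implicit Types (a : cochain V) (s t : {set V}) (u : V).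

Definition cochain_support i a : {set {set V}} :=
  [set s in cells X i | a s != 0].

Definition cells_at (S : {set {set V}}) u : {set {set V}} :=
  [set s in S | u \in s].

Lemma in_cells_at (S : {set {set V}}) u s :
  (s \in cells_at S u) = (s \in S) && (u \in s).
Proof. exact: in_set. Qed.

Lemma card_cell i s : s \in cells X i -> #|s| = i.+1.
Proof. by rewrite inE => /andP[_ /eqP]. Qed.

Lemma sum_cells_vertices (M : nmodType) i (F : {set V} -> M) :
  \sum_u \sum_(s in cells X i | u \in s) F s
    = \sum_(s in cells X i) F s *+ i.+1.
Proof.
under eq_bigr => u _ do rewrite big_mkcondr.
rewrite exchange_big; apply: eq_bigr => s /card_cell <-.
by rewrite -big_mkcond sumr_const.
Qed.

Lemma cnorm_const_coface (R : realType) d i c a :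
    {in cells X i, forall s, coface_count d X s = c} ->
  cnorm R d X i a = #|cochain_support i a|%:R
    * (c%:R / ('C(d.+1, i.+1) * #|cells X d|)%:R).
Proof.
move=> cofaces_c; rewrite mulr_natl -sumr_const.
apply: eq_big => [s|s /andP[sX _]]; first by rewrite [RHS]inE.
by rewrite /weight cofaces_c // (card_cell sX).
Qed.

Lemma card_support_add1 i a :
  (#|cochain_support i a| + #|cochain_support i (fun s => (a s + 1)%R)|
    = #|cells X i|)%N.
Proof.
rewrite -(cardsID [set s | a s != 0] (cells X i)).
congr (_ + _)%N; apply: eq_card => s; rewrite !inE //.
by rewrite F2_addr_neq0 oner_eq0 andbC; case: (a s == 0).
Qed.

Lemma sum_faces (M : nmodType) i s (F : {set V} -> M) : s \in cells X i.+1 ->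
    {in s, forall x, s :\ x \in cells X i} ->
  \sum_(t in cells X i | t \subset s) F t = \sum_(x in s) F (s :\ x).
Proof.
move=> sX facesX; rewrite -(big_imset F (h := fun x => s :\ x)) /=; last first.
  by move=> x y xs ys /setP/(_ x); rewrite !inE eqxx xs andbT; case: eqVneq.
apply: eq_bigl => t; apply/andP/imsetP => [[tX ts]|[x xs ->]]; last first.
  by rewrite facesX // subD1set.
have : #|s :\: t| == 1%N.
  by rewrite cardsD (setIidPr ts) (card_cell sX) (card_cell tX) subSnn.
case/cards1P=> x sDt; exists x.
  by have := set11 x; rewrite -sDt => /setDP[].
by rewrite -sDt setDDr setDv set0U (setIidPr ts).
Qed.

End Cochains.

Section Links.
Variables (V : finType) (X : {set {set V}}) (u : V).
Implicit Types (a : cochain V) (s t : {set V}).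

Lemma cells_link i :
  cells (link X u) i = [set s :\ u | s in cells_at (cells X i.+1) u].
Proof.
apply/setP => t; rewrite inE; apply/andP/imsetP => [[/imsetP[s] + ->]|[s]].
  rewrite inE => /andP[sX us] /eqP sDu; exists s => //.
  by rewrite !inE sX us (cardsD1 u) us sDu eqxx.
rewrite !inE => /andP[/andP[sX s_card] us] ->; split.
  by apply/imsetP; exists s; rewrite // inE sX us.
by move: s_card; rewrite (cardsD1 u) us.
Qed.

Lemma card_cells_link i :
  #|cells (link X u) i| = #|cells_at (cells X i.+1) u|.
Proof.
rewrite cells_link card_in_imset // => s t; rewrite !inE => /andP[_ us].
by move=> /andP[_ ut]; apply: setD1_inj.
Qed.

Lemma card_link_support a i :
  #|cells_at (cochain_support X i.+1 a) u|
    = #|cochain_support (link X u) i (link_cochain a u)|.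
Proof.
rewrite -(card_in_imset (f := fun s => s :\ u)) => [|s t]; last first.
  by rewrite !inE => /andP[_ us] /andP[_ ut]; apply: setD1_inj.
apply: eq_card => t; rewrite [RHS]inE cells_link.
apply/imsetP/andP => [[s]|[/imsetP[s] + ->]].
  rewrite 2!inE => /andP[/andP[sX as0] us] ->; split.
    by apply: imset_f; rewrite inE sX.
  by rewrite /link_cochain setD1K.
rewrite inE => /andP[sX us]; rewrite /link_cochain setD1K // => as0.
by exists s; rewrite // inE [s \in _]inE sX us as0.
Qed.

Lemma link_coface_count d s : u \in s ->
  coface_count d (link X u) (s :\ u) = coface_count d.+1 X s.
Proof.
move=> us; rewrite /coface_count [RHS](_ : _ =
    #|[set t :\ u | t in [set t in cells X d.+1 | s \subset t]]|); last first.
  rewrite card_in_imset // => t t'; rewrite !inE => /andP[_ /subsetP st].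
  by move=> /andP[_ /subsetP st']; exact: setD1_inj (st u us) (st' u us).
apply: eq_card => t; rewrite inE cells_link.
apply/andP/imsetP => [[/imsetP[r] + -> sr]|[r]].
  rewrite inE => /andP[rX ur]; exists r => //.
  by rewrite inE rX -(setD1K us) -(setD1K ur) setUS.
rewrite inE => /andP[rX sr] ->; split; last exact: setSD.
by apply: imset_f; rewrite inE rX (subsetP sr).
Qed.

Lemma locally_minimal_degree_le (R : realType) c a :
    {in cells X 1, forall s, coface_count 2 X s = c.+1} ->
    [set u] \in X -> (0 < #|cells_at (cells X 2) u|)%N ->
    locally_minimal R X a ->
  (2 * #|cells_at (cochain_support X 1 a) u| <= #|cells_at (cells X 1) u|)%N.
Proof.
move=> cofaces_c uX u_cofaces /(_ u uX).
have link_cofaces :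
    {in cells (link X u) 0, forall s, coface_count 1 (link X u) s = c.+1}.
  move=> t; rewrite cells_link => /imsetP[s]; rewrite inE => /andP[sX us] ->.
  by rewrite link_coface_count // cofaces_c.
rewrite !(cnorm_const_coface _ _ link_cofaces) ler_pM2r; last first.
  by rewrite divr_gt0 ?ltr0n // muln_gt0 card_cells_link.
rewrite ler_nat card_link_support -card_cells_link.
by rewrite -(card_support_add1 _ 0 (link_cochain a u)) mul2n -addnn leq_add2l.
Qed.

End Links.

Section ThreeSets.
Variables (V : finType) (M : nmodType).
Implicit Types (u v w : V) (F : V -> M).

Lemma sum_set2 F v w : v != w -> \sum_(x in [set v; w]) F x = F v + F w.
Proof. by move=> vw; rewrite big_setU1 ?big_set1 // inE. Qed.

Lemma sum_set3 F u v w : u != v -> u != w -> v != w ->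
  \sum_(x in [set u; v; w]) F x = F u + (F v + F w).
Proof.
by move=> uv uw vw; rewrite -setUA big_setU1 ?sum_set2 // !inE negb_or uv.
Qed.

Lemma set3D1 u v w : u != v -> u != w -> v != w ->
  [/\ [set u; v; w] :\ u = [set v; w], [set u; v; w] :\ v = [set u; w]
    & [set u; v; w] :\ w = [set u; v]].
Proof.
move=> uv uw vw; split; apply/setP => x; rewrite !inE.
- by have [->|] := eqVneq x u; rewrite ?(negPf uv) ?(negPf uw).
- by have [->|] := eqVneq x v; rewrite ?(negPf vw) 1?eq_sym ?(negPf uv) ?orbF.
- by have [->|] := eqVneq x w;
  rewrite ?orbF // ![w == _]eq_sym (negPf uw) (negPf vw).
Qed.

End ThreeSets.

Lemma triangle_cut_le (R : realDomainType) (V : finType) (s : {set V})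
    (b : V -> 'F_2) : #|s| = 3%N ->
  \sum_(u in s) (\sum_(v in s :\ u) b v != 0)%:R
    <= (\sum_(v in s) b v != 0)%:R + \sum_(v in s) (b v != 0)%:R :> R.
Proof.
move=> s3; have [u us] : exists u, u \in s by apply/card_gt0P; rewrite s3.
have /cards2P[v [w [vw sDu]]] : #|s :\ u| == 2%N.
  by rewrite -eqSS -s3 (cardsD1 u s) us.
have /negbT := setD11 u s; rewrite sDu !inE negb_or => /andP[uv uw].
have {us s3 sDu}-> : s = [set u; v; w] by rewrite -(setD1K us) sDu setUA.
have [Du Dv Dw] := set3D1 uv uw vw.
rewrite !sum_set3 // Du Dv Dw !sum_set2 // !F2_addr_neq0.
by case: (b u != 0); case: (b v != 0); case: (b w != 0) => /=; lra.
Qed.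

(** * Complexes whose links are projective planes *)

Definition star_chart (T V : finType) (P L : {set T}) (I : rel T)
    (X : {set {set V}}) (u : V) (f : T -> V) : Prop :=
  [/\ {in P :|: L &, injective f}, {in P :|: L, forall x, f x != u},
      forall s, s \in cells X 1 /\ u \in s <->
        exists2 x, x \in P :|: L & s = [set u; f x]
    & forall s, s \in cells X 2 /\ u \in s <-> exists x y,
        [/\ x \in P, y \in L, I x y & s = [set u; f x; f y]]].

Section PlanarLinks.
Variables (T V : finType) (P L : {set T}) (I : rel T) (q : nat).
Variables (X : {set {set V}}) (f : V -> T -> V).
Hypothesis plane : projective_plane P L I q.
Hypothesis chart : forall u, star_chart P L I X u (f u).
Implicit Types (u v : V) (s t : {set V}) (x y z : T).
Local Notation n := (q ^ 2 + q + 1)%N.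

Lemma point_in x : x \in P -> x \in P :|: L.
Proof. by rewrite inE => ->. Qed.

Lemma line_in y : y \in L -> y \in P :|: L.
Proof. by rewrite inE => ->; rewrite orbT. Qed.

Hint Resolve point_in line_in : core.

Lemma point_line_neq x y : x \in P -> y \in L -> (x == y) = false.
Proof.
move=> xP yL; apply: contraTF xP => /eqP->.
by rewrite (disjointFl (disjoint_points_lines plane)).
Qed.

Lemma chart_eq u x y : x \in P :|: L -> y \in P :|: L ->
  (f u x == f u y) = (x == y).
Proof. by case: (chart u) => f_inj _ _ _ xS yS; apply: (inj_in_eq f_inj). Qed.

Lemma chart_neq u x : x \in P :|: L -> (f u x == u) = false.
Proof. by case: (chart u) => _ f_neq _ _ xS; apply: negbTE (f_neq x xS). Qed.

Lemma chart_edgeP u s : s \in cells_at (cells X 1) u <->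
  exists2 x, x \in P :|: L & s = [set u; f u x].
Proof.
by case: (chart u) => _ _ <- _; rewrite in_cells_at; split=> /andP.
Qed.

Lemma chart_triangleP u s : s \in cells_at (cells X 2) u <->
  exists x y, [/\ x \in P, y \in L, I x y & s = [set u; f u x; f u y]].
Proof.
by case: (chart u) => _ _ _ <-; rewrite in_cells_at; split=> /andP.
Qed.

Lemma cells_at1E u :
  cells_at (cells X 1) u = [set [set u; f u x] | x in P :|: L].
Proof. by apply/setP=> s; apply/idP/imsetP => /chart_edgeP. Qed.

Lemma star_edge_inj u : {in P :|: L &, injective (fun x => [set u; f u x])}.
Proof.
move=> x y xS yS /setP/(_ (f u x)).
by rewrite !inE eqxx orbT chart_neq // chart_eq // => /esym/eqP.
Qed.

Lemma card_points_or_lines : #|P :|: L| = (2 * n)%N.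
Proof.
rewrite cardsU (disjoint_setI0 (disjoint_points_lines plane)) cards0 subn0.
by rewrite (card_points plane) (card_lines plane) mul2n addnn.
Qed.

Lemma card_edges_at u : #|cells_at (cells X 1) u| = (2 * n)%N.
Proof.
by rewrite cells_at1E card_in_imset ?card_points_or_lines //;
  apply: star_edge_inj.
Qed.

Lemma sum_edges_at (M : nmodType) u (F : {set V} -> M) :
  \sum_(s in cells X 1 | u \in s) F s = \sum_(x in P :|: L) F [set u; f u x].
Proof.
rewrite -(big_imset F (@star_edge_inj u)) -cells_at1E.
by apply: eq_bigl => s; rewrite in_cells_at.
Qed.

Lemma sum_triangles_at (M : nmodType) u (F : {set V} -> M) :
  \sum_(s in cells X 2 | u \in s) F s =
  \sum_(x in P) \sum_(y in L | I x y) F [set u; f u x; f u y].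
Proof.
pose flags := [set xy : T * T | [&& xy.1 \in P, xy.2 \in L & I xy.1 xy.2]].
rewrite pair_big_dep (eq_bigl (mem flags)) => [|xy]; last by rewrite !inE.
rewrite -(big_imset F (h := fun xy => [set u; f u xy.1; f u xy.2])) /=.
  apply: eq_bigl => s; rewrite -in_cells_at.
  apply/idP/imsetP => [/chart_triangleP[x [y [xP yL xy ->]]]|[[x y]]].
    by exists (x, y); rewrite // inE xP yL.
  by rewrite inE => /and3P[xP yL xy] ->; apply/chart_triangleP; exists x, y.
move=> [x y] [x' y']; rewrite !inE /= => /and3P[xP yL _] /and3P[x'P y'L _].
move=> /setP same; have := same (f u x); have := same (f u y).
rewrite !inE !eqxx !orbT !chart_neq ?chart_eq; auto.
rewrite (point_line_neq xP y'L) orbF [y == x']eq_sym (point_line_neq x'P yL).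
by move=> /esym/eqP-> /esym/eqP->.
Qed.

Lemma chart_triangle_neq u x y : x \in P -> y \in L ->
  [/\ u != f u x, u != f u y & f u x != f u y].
Proof.
by move=> xP yL; rewrite ![u == _]eq_sym !chart_neq ?chart_eq ?point_line_neq;
  auto.
Qed.

Lemma triangle_face s v : s \in cells X 2 -> v \in s -> s :\ v \in cells X 1.
Proof.
move=> sX vs; have [u] : exists u, u \in s :\ v.
  apply/card_gt0P; rewrite -(ltn_add2l (v \in s)) -cardsD1 vs.
  by rewrite (card_cell sX).
case/setD1P=> uv us.
have [|x [y [xP yL _ sE]]] := (chart_triangleP u s).1;
  first by rewrite in_cells_at sX.
have edge z : z \in P :|: L -> [set u; f u z] \in cells X 1.
  move=> zS; have : [set u; f u z] \in cells_at (cells X 1) u.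
    by apply/chart_edgeP; exists z.
  by rewrite in_cells_at => /andP[].
have [ux uy xy] := chart_triangle_neq u xP yL.
have [_ Dx Dy] := set3D1 ux uy xy.
have : v \in [set f u x; f u y] by move: vs; rewrite sE !inE eq_sym (negPf uv).
by case/set2P=> ->; rewrite sE ?Dx ?Dy; apply: edge; auto.
Qed.

Lemma sum_triangle_faces (M : nmodType) s (F : {set V} -> M) :
    s \in cells X 2 ->
  \sum_(t in cells X 1 | t \subset s) F t = \sum_(v in s) F (s :\ v).
Proof. by move=> sX; rewrite sum_faces // => v; apply: triangle_face. Qed.

Lemma chart_edge_coface u z : z \in P :|: L ->
  coface_count 2 X [set u; f u z] = q.+1.
Proof.
move=> zS; pose has_z x y := (z == x) || (z == y).
have -> : coface_count 2 X [set u; f u z]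
    = (\sum_(x in P) \sum_(y in L | I x y) has_z x y)%N.
  transitivity (\sum_(s in cells X 2 | u \in s) (f u z \in s))%N.
    rewrite sum_nat_bool; apply: eq_card => s.
    by rewrite !inE subUset !sub1set andbA.
  rewrite sum_triangles_at; apply: eq_bigr => x xP; apply: eq_bigr => y.
  by move=> /andP[yL _]; rewrite !inE chart_neq // !chart_eq; auto.
case/setUP: (zS) => z_in.
  rewrite (bigD1 z) //= [X in (_ + X)%N]big1 ?addn0.
    rewrite -(card_lines_through plane z_in) -sum1dep_card.
    by apply: eq_bigr => y _; rewrite /has_z eqxx.
  move=> x /andP[xP xz]; apply: big1 => y /andP[yL _].
  by rewrite /has_z eq_sym (negPf xz) point_line_neq.
rewrite -(card_points_on plane z_in) -sum1dep_card [RHS]big_mkcondr.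
apply: eq_bigr => x xP; rewrite big_mkcondr (bigD1 z) //= /has_z eqxx orbT.
rewrite big1 ?addn0 // => y /andP[yL yz].
by rewrite ![z == _]eq_sym point_line_neq // (negPf yz); case: ifP.
Qed.

Lemma edge_coface s : s \in cells X 1 -> coface_count 2 X s = q.+1.
Proof.
move=> sX; have [u us] : exists u, u \in s.
  by apply/card_gt0P; rewrite (card_cell sX).
have [|x xS ->] := (chart_edgeP u s).1; first by rewrite in_cells_at sX.
exact: chart_edge_coface.
Qed.

Lemma triangle_coface s : s \in cells X 2 -> coface_count 2 X s = 1%N.
Proof.
move=> sX; apply/eqP/cards1P; exists s; apply/setP => t; rewrite in_set1 inE.
apply/andP/eqP => [[tX st]|->]; last by rewrite sX subxx.
by apply/esym/eqP; rewrite eqEcard st (card_cell sX) (card_cell tX).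
Qed.

Lemma card_triangles_at u : #|cells_at (cells X 2) u| = (n * q.+1)%N.
Proof.
rewrite -sum1dep_card (sum_triangles_at u (fun=> 1%N)).
rewrite (eq_bigr (fun=> q.+1)) ?sum_nat_const ?(card_points plane) // => x xP.
by rewrite -(card_lines_through plane xP) -sum1dep_card.
Qed.

Lemma card_triangles : (3 * #|cells X 2| = #|V| * (n * q.+1))%N.
Proof.
have := sum_cells_vertices X 2 (fun=> 1%N); rewrite sumr_const -mulrnA natn.
move=> <-; rewrite -sum_nat_const; apply: eq_bigr => u _.
by rewrite -(card_triangles_at u) -sum1dep_card.
Qed.

Lemma cnorm_edges (R : realType) (a : cochain V) : cnorm R 2 X 1 a
  = #|cochain_support X 1 a|%:R / (#|V|%:R * n%:R).
Proof.
rewrite (cnorm_const_coface _ _ edge_coface) card_triangles !natrM.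
by congr (_ * _); rewrite mulrA invfM mulrCA divff ?mulr1.
Qed.

Lemma cnorm_triangles (R : realType) (a : cochain V) : cnorm R 2 X 2 a
  = 3 * #|cochain_support X 2 a|%:R / (#|V|%:R * n%:R * q.+1%:R).
Proof.
have <- : 3 * #|cells X 2|%:R = #|V|%:R * n%:R * q.+1%:R :> R.
  by rewrite -!natrM -mulnA card_triangles.
rewrite (cnorm_const_coface _ _ triangle_coface) binn mul1n div1r.
by rewrite -mulf_div divff ?mul1r // pnatr_eq0.
Qed.

Section Degrees.
Variables (R : realType) (a : cochain V).
Local Notation k := (q.+1%:R : R).

Definition support_degree u : nat := #|cells_at (cochain_support X 1 a) u|.

Definition star_support u : {set T} :=
  [set x in P :|: L | a [set u; f u x] != 0].

Lemma card_star_support u : #|star_support u| = support_degree u.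
Proof.
have := sum_edges_at u (fun s => nat_of_bool (a s != 0)).
rewrite !sum_nat_bool => <-; apply: eq_card => s.
by rewrite in_cells_at !in_set andbAC.
Qed.

Lemma sum_support_degree :
  (\sum_u support_degree u = 2 * #|cochain_support X 1 a|)%N.
Proof.
have := sum_cells_vertices X 1 (fun s => nat_of_bool (a s != 0)).
rewrite sumrMnl sum_nat_bool -mulr_natl natn.
move=> double_count; apply: etrans double_count.
apply: eq_bigr => u _; rewrite sum_nat_bool; apply: eq_card => s.
by rewrite in_cells_at !in_set andbAC.
Qed.

Lemma support_degree_le u : [set u] \in X -> locally_minimal R X a ->
  (support_degree u <= n)%N.
Proof.
move=> uX a_min; rewrite -(@leq_pmul2l 2) // -(card_edges_at u).
apply: (locally_minimal_degree_le edge_coface uX _ a_min).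
by rewrite card_triangles_at muln_gt0 addn1.
Qed.

Definition triangle_cut s u : bool := \sum_(v in s :\ u) a (s :\ v) != 0.

Definition link_cut u : R :=
  \sum_(s in cells X 2 | u \in s) (triangle_cut s u)%:R.

Lemma link_cut_lower_bound u (x := (support_degree u)%:R : R) :
  k * x - k * x ^+ 2 / (2 * n%:R) - Num.sqrt q%:R * x <= link_cut u.
Proof.
have -> : x = #|P :&: star_support u|%:R + #|L :&: star_support u|%:R.
  rewrite -natrD /x -card_star_support; congr _%:R.
  rewrite -(cardsID P (star_support u)) setIC; congr (_ + _)%N.
  apply: eq_card => y; rewrite !inE; have [yP|_] := boolP (y \in P).
    by rewrite (disjointFr (disjoint_points_lines plane) yP).
  by rewrite /= andbA andbb.
apply: (le_trans (incidence_cut_bound R plane (star_support u))).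
rewrite /link_cut sum_triangles_at; apply: ler_sum => p pP.
rewrite [leRHS]big_mkcondr; apply: ler_sum => l lL; case: (I p l) => //=.
have [up ul pl] := chart_triangle_neq u pP lL.
have [Du Dp Dl] := set3D1 up ul pl.
rewrite /triangle_cut Du sum_set2 // Dp Dl F2_addr_neq0 eq_sym.
by rewrite !inE pP lL orbT.
Qed.

Lemma sum_link_cut_le : \sum_u link_cut u
  <= #|cochain_support X 2 (coboundary X 1 a)|%:R
    + k * #|cochain_support X 1 a|%:R.
Proof.
rewrite /link_cut; under eq_bigr => u _ do rewrite big_mkcondr.
rewrite exchange_big; under eq_bigr => s _ do rewrite -big_mkcond.
have cut_le s : s \in cells X 2 -> \sum_(u in s) (triangle_cut s u)%:R
    <= (coboundary X 1 a s != 0)%:R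
       + \sum_(t in cells X 1 | t \subset s) (a t != 0)%:R :> R.
  move=> sX; rewrite /coboundary !sum_triangle_faces //.
  exact: triangle_cut_le (card_cell sX).
apply: (le_trans (ler_sum _ cut_le)); rewrite big_split sum_natr_bool lerD2l.
under eq_bigr => s _ do rewrite big_mkcondr.
rewrite exchange_big -sum_natr_bool mulr_sumr; apply: ler_sum => t tX.
by rewrite -big_mkcondr sumr_const -(edge_coface tX) mulr_natl -cardsE.
Qed.

Lemma edge_chart u v : [set u; v] \in cells X 1 ->
  exists2 x, x \in P :|: L & v = f u x.
Proof.
move=> uvX; have [|x xS uvE] := (chart_edgeP u [set u; v]).1.
  by rewrite in_cells_at uvX set21.
exists x => //; have : v \in [set u; f u x] by rewrite -uvE set22.
case/set2P=> // vu; move/card_cell: uvX.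
by rewrite vu setUid cards1.
Qed.

Lemma support_degreeE u :
  support_degree u = #|[set v | [set u; v] \in cochain_support X 1 a]|.
Proof.
rewrite -card_star_support -(card_in_imset (f := f u)) => [|x y]; last first.
  rewrite !in_set -!in_setU => /andP[xS _] /andP[yS _] /eqP.
  by rewrite chart_eq // => /eqP.
apply: eq_card => v; rewrite [RHS]in_set [RHS]in_set.
apply/imsetP/andP => [[x]|[uvX auv]].
  rewrite in_set => /andP[xS ax] ->; split=> //.
  have : [set u; f u x] \in cells_at (cells X 1) u.
    by apply/chart_edgeP; exists x.
  by rewrite in_cells_at => /andP[].
have [x xS vE] := edge_chart uvX; exists x => //.
by rewrite in_set xS -vE.
Qed.

End Degrees.

Section Orientation.
Variable e : rel V.
Hypothesis e_points : forall u v, e u v <-> exists2 x, x \in P & v = f u x.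
Hypothesis e_lines : forall u v, e v u <-> exists2 y, y \in L & v = f u y.

Lemma card_out_arcs u : #|[set v | e u v]| = n.
Proof.
rewrite -(card_points plane) -(card_in_imset (f := f u)) => [|x y xP yP /eqP].
  by apply: eq_card => v; rewrite inE; apply/idP/imsetP => /e_points.
by rewrite chart_eq ?point_in // => /eqP.
Qed.

Lemma card_in_arcs u : #|[set v | e v u]| = n.
Proof.
rewrite -(card_lines plane) -(card_in_imset (f := f u)) => [|x y xL yL /eqP].
  by apply: eq_card => v; rewrite inE; apply/idP/imsetP => /e_lines.
by rewrite chart_eq ?line_in // => /eqP.
Qed.

Lemma edge_oriented u v : [set u; v] \in cells X 1 -> e u v || e v u.
Proof.
case/edge_chart=> x /setUP[xP|xL] ->; apply/orP; [left|right].
  by apply/e_points; exists x.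
by apply/e_lines; exists x.
Qed.

Lemma sum_support_degree_in_le (a : cochain V) (S : {set V}) :
  (\sum_(u in S) support_degree a u
    <= 2 * \sum_(u in S) \sum_(v in S) e u v
       + \sum_(u in ~: S) support_degree a u)%N.
Proof.
pose supp u v := [set u; v] \in cochain_support X 1 a.
have degE u : support_degree a u = (\sum_v supp u v)%N.
  by rewrite sum_nat_bool support_degreeE.
under eq_bigr => u _ do rewrite degE (bigID (mem S)).
rewrite big_split leq_add //=.
  have -> : (2 * \sum_(u in S) \sum_(v in S) e u v
      = \sum_(u in S) \sum_(v in S) (e u v + e v u))%N.
    under [RHS]eq_bigr => u _ do rewrite big_split /=.
    by rewrite big_split /= [X in (_ + X)%N]exchange_big /= addnn mul2n.
  apply: leq_sum => u _; apply: leq_sum => v _; rewrite /supp inE.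
  have [/edge_oriented|//] := boolP (_ \in cells X 1).
  by case: (e u v) => [|/= ->]; case: (a _ != 0).
under [leqRHS]eq_bigl => v do rewrite in_setC.
rewrite exchange_big; apply: leq_sum => v _.
rewrite degE [leqRHS](bigID (mem S)).
by apply/(leq_trans _ (leq_addr _ _))/leq_sum => u _; rewrite /supp setUC.
Qed.

End Orientation.

End PlanarLinks.

(** * The isoperimetric inequality *)

Section FatAndThin.
Variables (R : realFieldType) (V : finType) (x : V -> R) (n mu : R).
Hypotheses (n_gt0 : 0 < n) (x_bounds : forall u, 0 <= x u <= n).

Definition fat : {set V} := [set u | (1 - mu) * n < x u].

Definition thin_mass : R := \sum_(u in ~: fat) x u.

Lemma thin_mass_ge0 : 0 <= thin_mass.
Proof. by apply: sumr_ge0 => u _; case/andP: (x_bounds u). Qed.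

Lemma fat_thin_mass : \sum_u x u = \sum_(u in fat) x u + thin_mass.
Proof.
rewrite (bigID (mem fat)) /=; congr (_ + _).
by apply: eq_bigl => u; rewrite in_setC.
Qed.

Lemma thin_gain k s : 0 <= k ->
  (k / 2 - s) * \sum_u x u + k * mu / 2 * thin_mass
    <= \sum_u (k * x u - k * x u ^+ 2 / (2 * n) - s * x u).
Proof.
move=> k_ge0.
rewrite /thin_mass [\sum_(u in _) _]big_mkcond !mulr_sumr -big_split /=.
apply: ler_sum => u _; have /andP[xu_ge0 xu_le] := x_bounds u.
have ratio_le c : x u <= c * n -> k * x u ^+ 2 / (2 * n) <= k * x u / 2 * c.
  move=> xu_c; have -> : k * x u ^+ 2 / (2 * n) = k * x u / 2 * (x u / n).
    by field; rewrite gt_eqF.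
  by rewrite ler_wpM2l ?divr_ge0 ?mulr_ge0 // ler_pdivrMr.
rewrite in_setC inE; case: ltP => [_|xu_thin] /=.
  have := ratio_le 1; rewrite mul1r => /(_ xu_le); lra.
have := ratio_le _ xu_thin; lra.
Qed.

Lemma fat_card_mass : (1 - mu) * n * #|fat|%:R <= \sum_(u in fat) x u.
Proof.
rewrite -sum1_card natr_sum mulr_sumr; apply: ler_sum => u.
by rewrite inE mulr1 => /ltW.
Qed.

End FatAndThin.

(* [r / N] is the density of the set of fat vertices, which the cochain norm
   bounds by about [1 / (2 * (1 + e0))]. *)
Lemma fat_density_gap (R : realFieldType) (n h e0 w : R) (mu := e0 / 16) :
  0 < e0 <= 1 -> 0 < n -> 8 * h <= e0 * n ->
  w * (2 * (1 + e0) * (1 - mu)) <= n ->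
  2 * (w + h) <= (1 - 2 * mu) * ((1 - mu) * n).
Proof.
move=> /andP[e0_gt0 e0_le1] n_gt0 h_le w_le.
pose c := (1 + e0) * (1 - mu).
have mu_gt0 : 0 < mu by rewrite divr_gt0.
have mu_le : mu <= 1 / 16 by rewrite /mu; lra.
have c_gt0 : 0 < c by rewrite mulr_gt0 //; lra.
have c_le2 : c <= 2 by rewrite /c; nra.
rewrite -(ler_pM2r c_gt0).
have wc : 2 * w * c <= n by move: w_le; rewrite /c; lra.
have hc : 2 * h * c <= e0 * n / 2.
  apply: (@le_trans _ _ (e0 * n / 4 * c)).
    by rewrite ler_wpM2r ?(ltW c_gt0) //; lra.
  by have := mulr_gt0 e0_gt0 n_gt0; nra.
have expansion : 1 + e0 / 2 <= (1 - 2 * mu) * (1 - mu) ^+ 2 * (1 + e0).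
  apply: (@le_trans _ _ ((1 - 4 * mu) * (1 + e0))); first by rewrite /mu; nra.
  by rewrite ler_wpM2r //; nra.
have -> : (1 - 2 * mu) * ((1 - mu) * n) * c
    = n * ((1 - 2 * mu) * (1 - mu) ^+ 2 * (1 + e0)) by rewrite /c; ring.
apply: le_trans (_ : n * (1 + e0 / 2) <= _); first by lra.
by rewrite ler_pM2l.
Qed.

Section ThinMass.
Variables (R : realFieldType) (V : finType) (x : V -> R) (n h e0 E : R).
Hypotheses (n_gt0 : 0 < n) (x_bounds : forall u, 0 <= x u <= n).
Local Notation mu := (e0 / 16).
Local Notation N := (#|V|%:R : R).
Local Notation r := (#|fat x n mu|%:R : R).

Lemma thin_mass_ge : 0 < e0 <= 1 -> 0 < N -> 8 * h <= e0 * n ->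
  \sum_(u in fat x n mu) x u <= 2 * E + thin_mass x n mu ->
  E <= n * r ^+ 2 / N + h * r ->
  (\sum_u x u) * (2 * (1 + e0)) < N * n ->
  mu * \sum_u x u <= thin_mass x n mu.
Proof.
move=> e0_bounds N_gt0 h_le fat_edges mixing total_lt; rewrite leNgt.
apply/negP => thin_lt; have /andP[e0_gt0 e0_le1] := e0_bounds.
have mass := fat_thin_mass x n mu; have thin_ge0 := thin_mass_ge0 mu x_bounds.
have fat_ge := fat_card_mass x n mu.
set S := \sum_u x u in total_lt thin_lt mass.
set F := \sum_(u in _) x u in fat_edges mass fat_ge.
pose w := n * r / N.
have wN : w * N = n * r by rewrite divfK ?gt_eqF.
have edgesE : n * r ^+ 2 / N + h * r = (w + h) * r by rewrite /w; ring.
have S_lt_fat : (1 - 2 * mu) * S < 2 * (w + h) * r.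
  by rewrite edgesE in mixing; lra.
have S_ge : (1 - mu) * n * r <= S by lra.
have coef_gt0 : 0 < 1 - 2 * mu by lra.
have S_gt0 : 0 < S.
  by rewrite -(@pmulr_rgt0 _ mu) ?divr_gt0 // (le_lt_trans thin_ge0).
have r_gt0 : 0 < r.
  rewrite lt0r ler0n andbT; apply: contraTneq S_lt_fat => ->.
  by rewrite mulr0 -leNgt ltW ?mulr_gt0.
have w_le : w * (2 * (1 + e0) * (1 - mu)) <= n.
  rewrite -(ler_pM2r N_gt0) mulrAC wN [n * N]mulrC.
  apply: le_trans (ltW total_lt).
  have -> : n * r * (2 * (1 + e0) * (1 - mu))
      = (1 - mu) * n * r * (2 * (1 + e0)).
    by ring.
  by rewrite ler_wpM2r //; lra.
have := fat_density_gap e0_bounds n_gt0 h_le w_le; rewrite leNgt => /negP[].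
rewrite -(ltr_pM2r r_gt0) -mulrA; apply: (le_lt_trans _ S_lt_fat).
by rewrite ler_pM2l.
Qed.

End ThinMass.

Section Isoperimetry.
Variables (R : realType) (T V : finType) (P L : {set T}) (I : rel T) (q : nat).
Variables (X : {set {set V}}) (f : V -> T -> V) (e : rel V) (h e0 : R).
Hypothesis plane : projective_plane P L I q.
Hypothesis chart : forall u, star_chart P L I X u (f u).
Hypothesis e_points : forall u v, e u v <-> exists2 x, x \in P & v = f u x.
Hypothesis e_lines : forall u v, e v u <-> exists2 y, y \in L & v = f u y.
Local Notation n := ((q ^ 2 + q + 1)%N%:R : R).
Local Notation k := (q.+1%:R : R).
Local Notation N := (#|V|%:R : R).
Local Notation mu := (e0 / 16).
Hypothesis mixing : forall S : {set V},
  (\sum_(u in S) \sum_(v in S) e u v)%:R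
    <= n * #|S|%:R ^+ 2 / N + h * #|S|%:R :> R.
Hypothesis e0_bounds : 0 < e0 <= 1.
Hypothesis mixing_error_le : 8 * h <= e0 * n.
Hypothesis sqrt_le : Num.sqrt q%:R <= k * mu ^+ 2 / 4.

Variable a : cochain V.
Hypothesis vertices_in : forall u, [set u] \in X.
Hypothesis a_min : locally_minimal R X a.
Hypothesis a_small : cnorm R 2 X 1 a < 1 / (4 * (1 + e0)).

Local Notation deg := (support_degree X a).
Local Notation support1 := (#|cochain_support X 1 a|%:R : R).
Local Notation support2 := (#|cochain_support X 2 (coboundary X 1 a)|%:R : R).

Lemma support_degree_bounds u : 0 <= ((deg u)%:R : R) <= n.
Proof. by rewrite ler0n ler_nat (support_degree_le plane chart (R := R)). Qed.

Lemma thin_support_mass_ge : 0 < N ->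
  mu * \sum_u (deg u)%:R <= thin_mass (fun u => (deg u)%:R) n mu :> R.
Proof.
move=> N_gt0; have n_gt0 := plane_card_gt0 R q.
have /andP[e0_gt0 _] := e0_bounds.
have deg_in_le (S : {set V}) : \sum_(u in S) (deg u)%:R
    <= 2 * (\sum_(u in S) \sum_(v in S) e u v)%:R
       + \sum_(u in ~: S) (deg u)%:R :> R.
  rewrite -!natr_sum -natrM -natrD ler_nat.
  exact: (sum_support_degree_in_le chart e_points e_lines).
apply: (thin_mass_ge n_gt0 _ e0_bounds N_gt0 mixing_error_le _ (mixing _)).
- exact: support_degree_bounds.
- exact: deg_in_le.
rewrite -natr_sum (sum_support_degree X a) natrM.
move: a_small; rewrite (cnorm_edges plane chart) ltr_pdivrMr ?mulr_gt0 //.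
rewrite div1r mulrC ltr_pdivlMr; first by lra.
by rewrite mulr_gt0 //; lra.
Qed.

Lemma coboundary_support_ge : 0 < N -> k * mu ^+ 2 / 2 * support1 <= support2.
Proof.
move=> N_gt0; have /andP[e0_gt0 _] := e0_bounds.
have deg_sum : \sum_u (deg u)%:R = 2 * support1.
  by rewrite -natr_sum (sum_support_degree X a) natrM.
have := thin_gain mu (plane_card_gt0 R q) support_degree_bounds
  (Num.sqrt q%:R) (ler0n _ q.+1).
have cut_ge u := link_cut_lower_bound plane chart R a u.
move/le_trans/(_ (ler_sum _ (fun u _ => cut_ge u))).
move/le_trans/(_ (sum_link_cut_le plane chart R a)).
have := thin_support_mass_ge N_gt0.
rewrite deg_sum => thin_ge.
have : k * mu / 2 * (mu * (2 * support1))
    <= k * mu / 2 * thin_mass (fun u => (deg u)%:R) n mu.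
  by rewrite ler_wpM2l // !divr_ge0 // mulr_ge0 // ltW ?divr_gt0.
have : Num.sqrt q%:R * (2 * support1) <= k * mu ^+ 2 / 4 * (2 * support1).
  by rewrite ler_wpM2r ?mulr_ge0.
lra.
Qed.

Theorem planar_isoperimetry :
  mu ^+ 2 * cnorm R 2 X 1 a <= cnorm R 2 X 2 (coboundary X 1 a).
Proof.
rewrite (cnorm_edges plane chart) (cnorm_triangles plane chart).
have [V0|V_gt0] := posnP #|V|; first by rewrite V0 !mul0r !invr0 !mulr0.
have N_gt0 : 0 < N by rewrite ltr0n.
have n_gt0 := plane_card_gt0 R q.
rewrite ler_pdivlMr ?mulr_gt0 //.
have -> : mu ^+ 2 * (support1 / (N * n)) * (N * n * k)
    = k * mu ^+ 2 * support1 by field; rewrite !gt_eqF.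
have := coboundary_support_ge N_gt0.
have : 0 <= support2 by [].
lra.
Qed.

End Isoperimetry.

(** * Normal matrices and expander mixing *)

Section NormalMatrices.
Local Open Scope sesquilinear_scope.
Variables (C : numClosedFieldType) (n : nat).
Implicit Types (B : 'M[C]_n) (r x : 'rV[C]_n).

Lemma normalmx_eigenvector_adjoint B r a :
  B \is normalmx -> r *m B = a *: r -> r *m B^t* = a^* *: r.
Proof.
move=> /normalmxP Bnormal rB; pose M := B - a%:M.
have MtE : M^t* = B^t* - a^*%:M.
  by apply/matrixP => i j; rewrite !mxE rmorphB rmorphMn eq_sym.
have Mnormal : M *m M^t* = M^t* *m M.
  rewrite MtE /M !mulmxBl !mulmxBr Bnormal !mul_mx_scalar !mul_scalar_mx.
  rewrite !scale_scalar_mx [a * _]mulrC !opprB ![_ - _ + _]addrACA.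
  by congr (_ + _); rewrite addrC.
have rM0 : r *m M = 0 by rewrite mulmxBr rB mul_mx_scalar subrr.
have : r *m M^t* == 0.
  rewrite -(dnorm_eq0 (@dotmx C n)) /= dotmxE trmx_mul map_mxM trmxCK.
  by rewrite mulmxA -(mulmxA r) -Mnormal mulmxA rM0 !mul0mx mxE.
by rewrite MtE mulmxBr mul_mx_scalar subr_eq0 => /eqP.
Qed.

Lemma normalmx_form_bound B (lam : C) x : B \is normalmx ->
    (forall a, eigenvalue B a -> `|a| <= lam) ->
  `|(x *m B *m x^t*) 0 0| <= lam * (x *m x^t*) 0 0.
Proof.
move=> Bnormal eig_le; pose P := spectralmx B; pose D := spectral_diag B.
have Punitary : P \is unitarymx := spectral_unitarymx B.
have PP : P *m P^t* = 1%:M by apply/unitarymxP.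
have BE : B = P^t* *m diag_mx D *m P.
  by move/orthomx_spectralP: Bnormal; rewrite invmx_unitary.
have eigD i : `|D 0 i| <= lam.
  apply/eig_le/eigenvalueP; exists (row i P).
    rewrite -row_mul BE !mulmxA PP mul1mx row_mul.
    by rewrite row_diag_mx -scalemxAl -rowE.
  apply/eqP => row0; have /row_unitarymxP/(_ i i)/eqP := Punitary.
  by rewrite row0 dotmxE mul0mx mxE eqxx eq_sym oner_eq0.
pose y := x *m P^t*.
have xBx : (x *m B *m x^t*) 0 0 = \sum_i D 0 i * (y 0 i * (y 0 i)^*).
  have -> : x *m B *m x^t* = y *m diag_mx D *m y^t*.
    by rewrite BE /y trmx_mul map_mxM trmxCK !mulmxA.
  by rewrite mul_mx_diag mxE; apply: eq_bigr => i _; rewrite !mxE -mulrA mulrCA.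
have xx : (x *m x^t*) 0 0 = \sum_i y 0 i * (y 0 i)^*.
  have -> : x *m x^t* = y *m y^t*.
    by rewrite /y trmx_mul map_mxM trmxCK mulmxA mulmxKtV.
  by rewrite mxE; apply: eq_bigr => i _; rewrite !mxE.
rewrite xBx xx mulr_sumr; apply: (le_trans (ler_norm_sum _ _ _)).
apply: ler_sum => i _; rewrite normrM [`|_ * _^*|]ger0_norm ?mul_conjC_ge0 //.
by rewrite ler_wpM2r ?mul_conjC_ge0.
Qed.

End NormalMatrices.

Section ExpanderMixing.
Local Open Scope sesquilinear_scope.
Variables (C : numClosedFieldType) (V : finType).
Variables (e : rel V) (d : nat) (lam : C).
Local Notation N := #|V|.
Local Notation ev := (@enum_val V predT).
Hypothesis outdegree : forall u, #|[set v | e u v]| = d.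
Hypothesis indegree : forall v, #|[set u | e u v]| = d.
Hypothesis codegree : forall u w,
  #|[set v | e u v && e w v]| = #|[set v | e v u && e v w]|.
Hypothesis lam_ge0 : 0 <= lam.
Hypothesis gap : forall (f : V -> C) (l1 l2 : C),
  (exists x, f x != 0) -> \sum_x f x = 0 ->
  (forall x, \sum_(y | e x y) f y = l1 * f x) ->
  (forall x, \sum_(y | e y x) f y = l2 * f x) -> `|l1| <= lam.

Definition adjmx : 'M[C]_N := \matrix_(i, j) (e (ev i) (ev j))%:R.

Definition indicator_row (S : {set V}) : 'rV[C]_N := \row_i (ev i \in S)%:R.

Definition discrepancy_mx : 'M[C]_N := adjmx - (d%:R / N%:R) *: const_mx 1.

Lemma mulmx_sum_enum m p (A : 'M[C]_(m, N)) (B : 'M[C]_(N, p)) i j :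
  (A *m B) i j = \sum_v A i (enum_rank v) * B (enum_rank v) j.
Proof.
rewrite mxE [RHS]big_enum_val; apply: eq_bigr => k _.
by rewrite enum_valK.
Qed.

Lemma adjmxE u v : adjmx (enum_rank u) (enum_rank v) = (e u v)%:R.
Proof. by rewrite mxE !enum_rankK. Qed.

Lemma adjmx_mul_const : adjmx *m const_mx 1 = const_mx d%:R :> 'M_N.
Proof.
apply/matrixP => i j; rewrite mulmx_sum_enum mxE -(outdegree (ev i)).
rewrite -[RHS](sum_natr_bool _ predT); apply: eq_bigr => v _.
by rewrite !mxE mulr1 enum_rankK.
Qed.

Lemma const_mul_adjmx : const_mx 1 *m adjmx = const_mx d%:R :> 'M_N.
Proof.
apply/matrixP => i j; rewrite mulmx_sum_enum mxE -(indegree (ev j)).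
rewrite -[RHS](sum_natr_bool _ predT); apply: eq_bigr => v _.
by rewrite !mxE mul1r enum_rankK.
Qed.

Lemma adjmx_normal : adjmx *m adjmx^T = adjmx^T *m adjmx.
Proof.
apply/matrixP => i j; rewrite -(enum_valK i) -(enum_valK j) !mulmx_sum_enum.
under eq_bigr => v _ do rewrite [adjmx^T _ _]mxE !adjmxE -natrM mulnb.
under [RHS]eq_bigr => v _ do rewrite [adjmx^T _ _]mxE !adjmxE -natrM mulnb.
by rewrite !(sum_natr_bool _ predT) codegree.
Qed.

Lemma discrepancy_mx_adjoint :
  discrepancy_mx^t* = adjmx^T - (d%:R / N%:R) *: const_mx 1.
Proof.
apply/matrixP => i j; rewrite !mxE rmorphB !rmorphM rmorph1 fmorphV.
by rewrite !rmorph_nat.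
Qed.

Lemma discrepancy_mx_normal : discrepancy_mx \is normalmx.
Proof.
have adjT_const : adjmx^T *m const_mx 1 = const_mx d%:R :> 'M_N.
  by rewrite -[const_mx 1]trmx_const -trmx_mul const_mul_adjmx trmx_const.
have const_adjT : const_mx 1 *m adjmx^T = const_mx d%:R :> 'M_N.
  by rewrite -[const_mx 1]trmx_const -trmx_mul adjmx_mul_const trmx_const.
apply/normalmxP; rewrite discrepancy_mx_adjoint !mulmxBr !mulmxBl.
rewrite -!scalemxAl -!scalemxAr adjmx_mul_const const_mul_adjmx.
by rewrite adjT_const const_adjT adjmx_normal.
Qed.

Lemma discrepancy_mul_const (i : 'I_N) :
  discrepancy_mx *m const_mx 1 = 0 :> 'M_N.
Proof.
have N_neq0 : N%:R != 0 :> C.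
  by rewrite pnatr_eq0 -lt0n (leq_ltn_trans _ (ltn_ord i)).
rewrite mulmxBl adjmx_mul_const -scalemxAl.
apply/matrixP => k j; rewrite !mxE.
under eq_bigr => l _ do rewrite !mxE mulr1.
by rewrite sumr_const card_ord divfK ?subrr.
Qed.

Lemma discrepancy_eigenvalue a : eigenvalue discrepancy_mx a -> `|a| <= lam.
Proof.
case/eigenvalueP=> r rB r_neq0; have [->|a_neq0] := eqVneq a 0.
  by rewrite normr0.
have /rV0Pn[k0 rk0] := r_neq0.
have rBt := normalmx_eigenvector_adjoint discrepancy_mx_normal rB.
have r_const : r *m const_mx 1 = 0 :> 'rV_N.
  apply: (scalerI a_neq0); rewrite scaler0 scalemxAl -rB -mulmxA.
  by rewrite (discrepancy_mul_const k0) mulmx0.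
have rA : r *m adjmx = a *: r.
  by rewrite -rB mulmxBr -scalemxAr r_const scaler0 subr0.
have rAt : r *m adjmx^T = a^* *: r.
  rewrite -rBt discrepancy_mx_adjoint mulmxBr -scalemxAr.
  by rewrite r_const scaler0 subr0.
rewrite -norm_conjC; apply: (@gap (fun v => r 0 (enum_rank v)) _ a).
- by exists (ev k0); rewrite enum_valK.
- have /matrixP/(_ 0 k0) := r_const; rewrite mulmx_sum_enum mxE => sum0.
  by rewrite -[RHS]sum0; apply: eq_bigr => v _; rewrite mxE mulr1.
- move=> u; have /matrixP/(_ 0 (enum_rank u)) := rAt.
  rewrite mulmx_sum_enum [in RHS]mxE => <-; rewrite big_mkcond.
  by apply: eq_bigr => v _; rewrite [adjmx^T _ _]mxE adjmxE; case: e;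
    rewrite ?mulr1 ?mulr0.
- move=> u; have /matrixP/(_ 0 (enum_rank u)) := rA.
  rewrite mulmx_sum_enum [in RHS]mxE => <-; rewrite big_mkcond.
  by apply: eq_bigr => v _; rewrite adjmxE; case: e; rewrite ?mulr1 ?mulr0.
Qed.

Lemma indicator_row_form (M : 'M[C]_N) S :
  (indicator_row S *m M *m (indicator_row S)^t*) 0 0
    = \sum_(u in S) \sum_(v in S) M (enum_rank u) (enum_rank v).
Proof.
have rowE v : indicator_row S 0 (enum_rank v) = (v \in S)%:R.
  by rewrite mxE enum_rankK.
have colE v : (indicator_row S)^t* (enum_rank v) 0 = (v \in S)%:R.
  by rewrite !mxE enum_rankK rmorph_nat.
rewrite mulmx_sum_enum exchange_big [RHS]big_mkcond; apply: eq_bigr => v _.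
rewrite colE; case: (v \in S); last by rewrite mulr0.
rewrite mulr1 mulmx_sum_enum [RHS]big_mkcond; apply: eq_bigr => u _.
by rewrite rowE; case: (u \in S); rewrite ?mul1r ?mul0r.
Qed.

Lemma expander_mixing (S : {set V}) :
  `|(\sum_(u in S) \sum_(v in S) e u v)%:R - d%:R * #|S|%:R ^+ 2 / N%:R|
    <= lam * #|S|%:R.
Proof.
have norm_S : (indicator_row S *m (indicator_row S)^t*) 0 0 = #|S|%:R.
  have := indicator_row_form 1%:M S; rewrite mulmx1 => ->.
  rewrite -sum1_card natr_sum; apply: eq_bigr => u uS.
  rewrite (bigD1 u) //= mxE eqxx big1 ?addr0 // => v.
  by case/andP=> _ /negPf vu; rewrite mxE (inj_eq enum_rank_inj) eq_sym vu.
have form_S : (indicator_row S *m discrepancy_mx *m (indicator_row S)^t*) 0 0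
    = (\sum_(u in S) \sum_(v in S) e u v)%:R - d%:R * #|S|%:R ^+ 2 / N%:R.
  rewrite indicator_row_form natr_sum (mulrAC d%:R) expr2 mulrA mulr_natr.
  rewrite -sumr_const -sumrB; apply: eq_bigr => u _.
  rewrite natr_sum mulr_natr -sumr_const -sumrB; apply: eq_bigr => v _.
  by rewrite /discrepancy_mx -adjmxE !mxE mulr1.
rewrite -form_S -norm_S; apply: normalmx_form_bound discrepancy_eigenvalue.
exact: discrepancy_mx_normal.
Qed.

End ExpanderMixing.

Lemma regular_codegree_eq (V : finType) (e : rel V) d :
    (forall u, #|[set v | e u v]| = d) -> (forall v, #|[set u | e u v]| = d) ->
    (forall u w, u != w -> (#|[set v | e u v && e w v]|
      <= #|[set v | e v u && e v w]|)%N) ->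
  forall u w, #|[set v | e u v && e w v]| = #|[set v | e v u && e v w]|.
Proof.
move=> outdeg indeg codeg_le.
pose out_codeg (x : V * V) := #|[set v | e x.1 v && e x.2 v]|.
pose in_codeg (x : V * V) := #|[set v | e v x.1 && e v x.2]|.
have le_codeg x : (out_codeg x <= in_codeg x)%N.
  case: x => u w; have [<-|] := eqVneq u w; last exact: codeg_le.
  rewrite /out_codeg /in_codeg /=.
  have dup (P : pred V) : [set v | P v && P v] = [set v | P v].
    by apply/setP => v; rewrite !inE andbb.
  by rewrite !dup outdeg indeg.
have sum_codeg (r : rel V) (k : nat) : (forall v, #|[set u | r u v]| = k) ->
    (\sum_(x : V * V) #|[set v | r x.1 v && r x.2 v]| = #|V| * k ^ 2)%N.
  move=> card_r; under eq_bigr => x _ do rewrite -(sum_nat_bool predT).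
  rewrite exchange_big -sum_nat_const; apply: eq_bigr => v _ /=.
  rewrite -(pair_big predT predT (fun u w => (r u v && r w v : nat))) /=.
  rewrite -(card_r v) -(sum_nat_bool predT) expnS expn1 big_distrlr /=.
  by apply: eq_bigr => u _; apply: eq_bigr => w _; rewrite mulnb.
have eq_sum : (\sum_x out_codeg x = \sum_x in_codeg x)%N.
  by rewrite (sum_codeg e d indeg) (sum_codeg (fun u v => e v u) d).
have := leqif_sum (fun x (_ : true) =>
  conj (le_codeg x) (erefl (out_codeg x == in_codeg x))).
by case=> _; rewrite eq_sum eqxx => /esym/forallP all_eq u w;
  apply/eqP/(all_eq (u, w)).
Qed.

(** * Schur's test *)

Local Open Scope classical_set_scope.

Lemma cauchy_schwarz_weighted (R : realFieldType) (T : Type) (r : seq T)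
    (a phi : T -> R) : (forall y, 0 < phi y) ->
  (\sum_(y <- r) a y) ^+ 2
    <= (\sum_(y <- r) phi y) * \sum_(y <- r) a y ^+ 2 / phi y.
Proof.
move=> phi_gt0; case: r => [|y0 r]; first by rewrite !big_nil expr0n mul0r.
set total := \sum_(y <- _) a y; set weight := \sum_(y <- _) phi y.
have weight_gt0 : 0 < weight.
  rewrite /weight big_cons ltr_pwDl // sumr_ge0 // => y _; exact: ltW.
have : 0 <= \sum_(y <- y0 :: r) phi y * (a y / phi y - total / weight) ^+ 2.
  by apply: sumr_ge0 => y _; rewrite mulr_ge0 ?sqr_ge0 // ltW.
have expand y : phi y * (a y / phi y - total / weight) ^+ 2
    = a y ^+ 2 / phi y - a y * (2 * (total / weight))
      + phi y * (total / weight) ^+ 2 by field; rewrite !gt_eqF.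
under eq_bigr => y _ do rewrite expand.
rewrite big_split sumrB /= -!mulr_suml -/total -/weight.
have -> : total * (2 * (total / weight)) = 2 * (total ^+ 2 / weight) by ring.
have -> : weight * (total / weight) ^+ 2 = total ^+ 2 / weight.
  by field; rewrite gt_eqF.
by move=> ?; rewrite mulrC -ler_pdivrMr //; lra.
Qed.

Lemma sqrD_le (R : realFieldType) (x y t : R) : 0 < t ->
  (x + y) ^+ 2 <= (1 + t) * x ^+ 2 + (1 + t^-1) * y ^+ 2.
Proof.
move=> t_gt0; rewrite -subr_ge0.
have -> : (1 + t) * x ^+ 2 + (1 + t^-1) * y ^+ 2 - (x + y) ^+ 2
    = (t * x - y) ^+ 2 / t by field; rewrite gt_eqF.
by rewrite divr_ge0 ?sqr_ge0 ?ltW.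
Qed.

Lemma normc_ge0 (R : rcfType) (x : R[i]) : 0 <= Normc.normc x.
Proof. by case: x => a b; rewrite /Normc.normc sqrtr_ge0. Qed.

Lemma normc_sum (R : rcfType) (T : Type) (r : seq T) (f : T -> R[i]) :
  Normc.normc (\sum_(y <- r) f y) <= \sum_(y <- r) Normc.normc (f y).
Proof.
elim: r => [|y r IH]; first by rewrite !big_nil Normc.normc0.
by rewrite !big_cons (le_trans (le_normcD _ _)) // lerD2l.
Qed.

Section ExtendedSums.
Local Open Scope ereal_scope.
Variables (R : realType) (T : choiceType).
Implicit Types (A : set T) (c : R) (a : T -> \bar R).

Lemma esumZl_le A c a : (0 <= c)%R -> (forall x, 0 <= a x) ->
  \esum_(x in A) (c%:E * a x) <= c%:E * \esum_(x in A) a x.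
Proof.
move=> c_ge0 a_ge0; apply: ge_ereal_sup => _ [F [Ffin FA] <-].
rewrite -ge0_mule_fsumr // lee_wpmul2l ?lee_fin //.
by apply: esum_ge; exists F.
Qed.

Lemma esumZl A c a : (0 <= c)%R -> (forall x, 0 <= a x) ->
  \esum_(x in A) (c%:E * a x) = c%:E * \esum_(x in A) a x.
Proof.
move=> c_ge0 a_ge0; apply/le_anti/andP; split; first exact: esumZl_le.
have [->|c_neq0] := eqVneq c 0%R.
  by rewrite mul0e esum_ge0 // => x _; rewrite mul0e.
have c_gt0 : (0 < c)%R by rewrite lt0r c_neq0.
have cV x : x = c^-1%:E * (c%:E * x) by rewrite muleA -EFinM mulVf // mul1e.
under [X in c%:E * X]eq_esum => x _ do rewrite [a x]cV.
rewrite -lee_pdivlMl // (le_trans (esumZl_le _ _ _)) ?invr_ge0 //.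
by move=> x; rewrite mule_ge0 ?lee_fin.
Qed.

Lemma esum_seq A (r : seq T) a : uniq r -> (forall y, A y <-> y \in r) ->
  (forall y, 0 <= a y) -> \esum_(y in A) a y = \sum_(y <- r) a y.
Proof.
move=> r_uniq Ar a_ge0; have -> : A = [set` r] by apply/seteqP; split=> y /Ar.
rewrite esum_fset; first by rewrite -fsbig_seq.
  exact: finite_seq.
by move=> y _; apply: a_ge0.
Qed.

End ExtendedSums.

Section SquareNorm.
Variables (R : realType) (T : choiceType).
Implicit Types (f g : T -> R[i]).

Lemma l2sqZ (l : R[i]) f :
  l2sq (fun x => l * f x) = ((Normc.normc l ^+ 2)%:E * l2sq f)%E.
Proof.
rewrite /l2sq -esumZl ?sqr_ge0 // => [|x]; last by rewrite lee_fin sqr_ge0.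
by apply: eq_esum => x _; rewrite Normc.normcM exprMn EFinM.
Qed.

Lemma l2sq_le_add t f g : 0 < t ->
  (l2sq f <= (1 + t)%:E * l2sq g
             + (1 + t^-1)%:E * l2sq (fun x => g x - f x)%R)%E.
Proof.
move=> t_gt0; have tV_gt0 : 0 < t^-1 by rewrite invr_gt0.
have sq_ge0 h x : (0 <= (Normc.normc (h x : R[i]) ^+ 2)%:E)%E.
  by rewrite lee_fin sqr_ge0.
have t_ge0 := ltW t_gt0; have tV_ge0 := ltW tV_gt0.
rewrite -!esumZl ?addr_ge0 // -esumD; first last.
- by move=> x _; rewrite -EFinM lee_fin mulr_ge0 ?sqr_ge0 ?addr_ge0.
- by move=> x _; rewrite -EFinM lee_fin mulr_ge0 ?sqr_ge0 ?addr_ge0.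
apply: le_esum => x _; rewrite -!EFinM -EFinD lee_fin.
have norm_le : Normc.normc (f x)
    <= Normc.normc (g x) + Normc.normc (g x - f x).
  by rewrite -{1}(subKr (g x) (f x)) -(normcN (_ - f x)) le_normcD.
apply: le_trans (sqrD_le _ _ t_gt0).
by rewrite lerXn2r ?nnegrE ?addr_ge0 ?normc_ge0.
Qed.

End SquareNorm.

Section SchurTest.
Variables (R : realType) (T : choiceType) (E : T -> T -> Prop).
Variables (out_nbrs in_nbrs : T -> seq T) (phi : T -> R) (lam : R).
Hypothesis out_uniq : forall x, uniq (out_nbrs x).
Hypothesis in_uniq : forall y, uniq (in_nbrs y).
Hypothesis out_nbrsP : forall x y, E x y <-> y \in out_nbrs x.
Hypothesis in_nbrsP : forall y x, E x y <-> x \in in_nbrs y.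
Hypothesis phi_gt0 : forall x, 0 < phi x.
Hypothesis lam_ge0 : 0 <= lam.
Hypothesis sum_out_le : forall x, \sum_(y <- out_nbrs x) phi y <= lam * phi x.
Hypothesis sum_in_le : forall y, \sum_(x <- in_nbrs y) phi x <= lam * phi y.

Lemma hecke_seq (f : T -> R[i]) x : hecke E f x = \sum_(y <- out_nbrs x) f y.
Proof.
rewrite /hecke; have -> : [set y | E x y] = [set` out_nbrs x].
  by apply/seteqP; split=> y /out_nbrsP.
by rewrite -fsbig_seq.
Qed.

Lemma normc_hecke_le (f : T -> R[i]) x : Normc.normc (hecke E f x) ^+ 2
  <= \sum_(y <- out_nbrs x) lam * phi x * (Normc.normc (f y) ^+ 2 / phi y).
Proof.
rewrite hecke_seq -mulr_sumr.
apply: (@le_trans _ _ ((\sum_(y <- out_nbrs x) Normc.normc (f y)) ^+ 2)).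
  rewrite lerXn2r ?nnegrE ?normc_ge0 ?normc_sum //.
  by apply: sumr_ge0 => y _; apply: normc_ge0.
apply: (le_trans (cauchy_schwarz_weighted _ _ phi_gt0)).
rewrite ler_wpM2r // sumr_ge0 // => y _.
by rewrite divr_ge0 ?sqr_ge0 // ltW.
Qed.

Lemma exchange_esum_rel (k : T -> T -> R) : (forall x y, 0 <= k x y) ->
  \esum_(x in [set: T]) \esum_(y in [set y | E x y]) (k x y)%:E
    = \esum_(y in [set: T]) \esum_(x in [set x | E x y]) (k x y)%:E.
Proof.
move=> k_ge0; rewrite !esum_esum; try by move=> *; rewrite lee_fin.
rewrite (@reindex_esum _ _ _ ([set: T] `*`` (fun y => [set x | E x y])) _
  (fun p => (p.2, p.1))) //; split.
- by move=> [y x] /= [].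
- by move=> [y x] [y' x'] _ _ [-> ->].
- by move=> [x y] /= [_ xy]; exists (y, x).
Qed.

Theorem schur_test (f : T -> R[i]) :
  (l2sq (hecke E f) <= (lam ^+ 2)%:E * l2sq f)%E.
Proof.
pose k x y := lam * phi x * (Normc.normc (f y) ^+ 2 / phi y).
have k_ge0 x y : 0 <= k x y.
  have phi_ge0 z : 0 <= phi z by rewrite ltW.
  by rewrite /k mulr_ge0 ?divr_ge0 ?sqr_ge0 // mulr_ge0.
have k_geE x y : (0 <= (k x y)%:E)%E by rewrite lee_fin.
apply: (@le_trans _ _
  (\esum_(x in [set: T]) \esum_(y in [set y | E x y]) (k x y)%:E)%E).
  apply: le_esum => x _; rewrite (esum_seq (out_uniq x) (out_nbrsP x)) //.
  by rewrite sumEFin lee_fin normc_hecke_le.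
rewrite exchange_esum_rel // -esumZl ?sqr_ge0 // => [|y]; last first.
  by rewrite lee_fin sqr_ge0.
apply: le_esum => y _; rewrite (esum_seq (in_uniq y) (in_nbrsP y)) //.
rewrite sumEFin -EFinM lee_fin -mulr_suml -mulr_sumr.
have -> : lam ^+ 2 * Normc.normc (f y) ^+ 2
    = lam * (lam * phi y) * (Normc.normc (f y) ^+ 2 / phi y).
  by field; rewrite gt_eqF.
by rewrite ler_wpM2r ?ler_wpM2l // divr_ge0 ?sqr_ge0 // ltW.
Qed.

Theorem schur_approx_eigenvalue (l : R[i]) :
    (forall eps : R, 0 < eps -> exists2 f : T -> R[i], l2sq f = 1%E &
      (l2sq (fun x => (hecke E f x - l * f x)%R) < eps%:E)%E) ->
  Normc.normc l <= lam.
Proof.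
move=> approx; rewrite -(@ler_pXn2r _ 2) ?nnegrE ?normc_ge0 //.
apply/ler_addgt0Pr => eta eta_gt0.
pose t := eta / 2 / (lam ^+ 2 + 1); pose eps := eta / 2 / (1 + t^-1).
have lam2_gt0 : 0 < lam ^+ 2 + 1 by rewrite ltr_wpDl ?sqr_ge0.
have t_gt0 : 0 < t by rewrite !divr_gt0.
have tV_gt0 : 0 < 1 + t^-1 by rewrite addr_gt0 ?invr_gt0.
have eps_gt0 : 0 < eps by rewrite !divr_gt0.
have [f f_norm f_approx] := approx eps eps_gt0.
have := l2sq_le_add (fun x => l * f x) (hecke E f) t_gt0.
rewrite l2sqZ f_norm mule1 => /le_trans l_le.
have : ((Normc.normc l ^+ 2)%:E
    <= (1 + t)%:E * (lam ^+ 2)%:E + (1 + t^-1)%:E * eps%:E)%E.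
  apply/l_le/leeD.
    rewrite lee_wpmul2l ?lee_fin ?addr_ge0 ?(ltW t_gt0) //.
    by have := schur_test f; rewrite f_norm mule1.
  by rewrite lee_wpmul2l ?lee_fin ?(ltW tV_gt0) // ltW.
rewrite -!EFinM -EFinD lee_fin => /le_trans; apply.
have -> : (1 + t^-1) * eps = eta / 2 by rewrite mulrC divfK ?gt_eqF.
have : t * lam ^+ 2 <= t * (lam ^+ 2 + 1).
  by rewrite ler_wpM2l ?(ltW t_gt0) // lerDl.
have -> : t * (lam ^+ 2 + 1) = eta / 2 by rewrite divfK ?gt_eqF.
lra.
Qed.

End SchurTest.

(** * Power series and valuations *)

Section PowerSeriesTheory.
Variable K : fieldType.
Local Notation O := (fps K).
Local Notation F := (laurent K).
Local Notation t := (fps_t K).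
Implicit Types (a b c : O).

Definition fps_red (a : O) : K := a 0%N.
Definition fps_const (c : K) : O := fun n => if n == 0%N then c else 0.

Fact fps_red_additive : zmod_morphism fps_red.
Proof. by []. Qed.
HB.instance Definition _ :=
  GRing.isZmodMorphism.Build O K fps_red fps_red_additive.

Fact fps_red_multiplicative : monoid_morphism fps_red.
Proof.
by split=> // a b; rewrite /fps_red {1}/GRing.mul /= /fps_mul big_ord1 subnn.
Qed.
HB.instance Definition _ :=
  GRing.isMonoidMorphism.Build O K fps_red fps_red_multiplicative.

Fact fps_const_additive : zmod_morphism fps_const.
Proof.
by move=> c d; apply/funext => -[|n] //; apply/esym/subr0.
Qed.
HB.instance Definition _ :=
  GRing.isZmodMorphism.Build K O fps_const fps_const_additive.

Fact fps_const_multiplicative : monoid_morphism fps_const.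
Proof.
split; first by apply/funext => n; rewrite /fps_const; case: n.
move=> c d; apply/funext => n; rewrite [RHS]/GRing.mul /= /fps_mul.
rewrite big_ord_recl subn0 big1 ?addr0 => [|i _]; last by rewrite mul0r.
by rewrite /fps_const; case: ifP; rewrite ?mulr0.
Qed.
HB.instance Definition _ :=
  GRing.isMonoidMorphism.Build K O fps_const fps_const_multiplicative.

Lemma fps_constK : cancel fps_const fps_red.
Proof. by []. Qed.

Lemma fps_red_t : fps_red t = 0.
Proof. by []. Qed.

Lemma fps_t_neq0 : t != 0.
Proof.
by apply/eqP => /(congr1 (fun a : O => a 1%N))/eqP; rewrite /fps_t oner_eq0.
Qed.

Lemma fps_mul_t0 b : (t * b) 0%N = 0.
Proof. by rewrite {1}/GRing.mul /= /fps_mul big_ord1 mul0r. Qed.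

Lemma fps_mul_tS b n : (t * b) n.+1 = b n.
Proof.
rewrite {1}/GRing.mul /= /fps_mul 2!big_ord_recl mul0r add0r mul1r subSS subn0.
by rewrite big1 ?addr0 // => i _; rewrite mul0r.
Qed.

Definition fps_shift a : O := fun n => a n.+1.

Lemma fps_shiftK a : fps_red a = 0 -> t * fps_shift a = a.
Proof.
by move=> a0; apply/funext => -[|n]; rewrite ?fps_mul_tS ?fps_mul_t0.
Qed.

Fixpoint fps_inv_seq a n : seq K :=
  if n is m.+1 then
    let s := fps_inv_seq a m in
    rcons s ((a 0%N)^-1 * ((m == 0%N)%:R - \sum_(i < m) s`_i * a (m - i)%N))
  else [::].

Lemma size_fps_inv_seq a n : size (fps_inv_seq a n) = n.
Proof. by elim: n => //= n IH; rewrite size_rcons IH. Qed.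

Lemma nth_fps_inv_seq a n i : (i < n)%N ->
  (fps_inv_seq a n)`_i = (fps_inv_seq a i.+1)`_i.
Proof.
elim: n => // n IH; rewrite ltnS leq_eqVlt => /orP[/eqP-> //|lt_in].
by rewrite [LHS]/= nth_rcons size_fps_inv_seq lt_in IH.
Qed.

Lemma fps_unitE a : (a \is a GRing.unit) = (fps_red a != 0).
Proof.
apply/idP/idP => [a_unit|a0]; first by rewrite -unitfE rmorph_unit.
pose b : O := fun n => (fps_inv_seq a n.+1)`_n.
suff ba1 : b * a = 1 by apply/unitrPr; exists b; rewrite mulrC.
apply/funext => n; rewrite [LHS]/GRing.mul /= /fps_mul big_ord_recr /= subnn.
pose term (i : 'I_n) := (fps_inv_seq a n)`_i * a (n - i)%N.
rewrite (eq_bigr term) => [|i _].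
  rewrite {1}/b /= nth_rcons size_fps_inv_seq ltnn eqxx mulrAC mulVf // mul1r.
  by rewrite addrC subrK.
by rewrite /term (@nth_fps_inv_seq a n).
Qed.

Lemma fps_t_factor a : a != 0 ->
  exists n, exists2 u, u \is a GRing.unit & a = t ^+ n * u.
Proof.
move=> a_neq0; have [n] : exists n, a n != 0.
  apply/not_existsP => a0; case/eqP: a_neq0; apply/funext => n.
  by apply/eqP/negPn/negP/a0.
elim: n a {a_neq0} => [|n IH] a an0.
  by exists 0%N, a; rewrite ?fps_unitE ?mul1r.
have [/fps_shiftK aE|a0] := eqVneq (fps_red a) 0; last first.
  by exists 0%N, a; rewrite ?fps_unitE ?mul1r.
have [//|m [u u_unit shiftE]] := IH (fps_shift a).
by exists m.+1, u; rewrite // -aE shiftE exprS mulrA.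
Qed.

Implicit Types (x y : F) (m n : int).
Local Notation iota := (@tofrac O).
Local Notation pi := (unif K).

Lemma integralP x : is_integral x <-> exists a, x = iota a.
Proof. by split=> [[a _ <-]|[a ->]]; exists a. Qed.

Lemma unif_neq0 : pi != 0.
Proof. by rewrite tofrac_eq0 fps_t_neq0. Qed.

Hint Resolve unif_neq0 : core.

Definition has_val x n :=
  exists2 u : O, u \is a GRing.unit & x = pi ^ n * iota u.

Lemma has_valM x y m n : has_val x m -> has_val y n -> has_val (x * y) (m + n).
Proof.
case=> u u_unit -> [v v_unit ->]; exists (u * v);
  first by rewrite unitrM u_unit.
by rewrite rmorphM expfzDr // mulrACA.
Qed.

Lemma has_val_tofrac a : has_val (iota a) 0 <-> a \is a GRing.unit.
Proof.
split=> [[u u_unit]|a_unit]; last by exists a; rewrite // mul1r.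
by rewrite mul1r => /eqP; rewrite tofrac_eq => /eqP->.
Qed.

Lemma has_val_unif n : has_val (pi ^ n) n.
Proof. by exists 1; rewrite ?unitr1 // rmorph1 mulr1. Qed.

Lemma has_valX x m k : has_val x m -> has_val (x ^+ k) (m *+ k).
Proof.
move=> xm; elim: k => [|k IH]; first exact: has_val_unif 0.
by rewrite exprS mulrS; apply: has_valM.
Qed.

Lemma has_val_uniq x m n : has_val x m -> has_val x n -> m = n.
Proof.
wlog le_mn : m n / m <= n => [wlog_le xm xn|].
  by case: (leP m n) => [|/ltW] le; [|symmetry]; apply: wlog_le.
case=> u u_unit -> [v v_unit].
have [k ->] : exists k : nat, n = m + k%:Z.
  by exists `|n - m|%N; rewrite gez0_abs ?subr_ge0 // subrKC.
rewrite expfzDr // -mulrA => /(mulfI (expfz_neq0 _ unif_neq0)).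
rewrite -exprnP -rmorphXn -rmorphM => /eqP; rewrite tofrac_eq => /eqP uE.
case: k uE => [|k] uE; first by rewrite addr0.
move: u_unit; rewrite fps_unitE uE exprS -mulrA rmorphM /=.
by rewrite fps_red_t mul0r eqxx.
Qed.

Lemma laurent_valE x n : has_val x n -> laurent_val x = n.
Proof.
move=> xn; apply: (@has_val_uniq x) => //; rewrite /laurent_val.
by case: xgetP => [m _ //|/(_ n)[]].
Qed.

Lemma laurent_fracP x : exists a, exists2 b, b != 0 & x = iota a / iota b.
Proof.
elim/quotW: x => r; have denom_neq0 : \d_r != 0 := denom_ratioP r.
exists \n_r, \d_r => //; apply: (canRL (mulfK _)); first by rewrite tofrac_eq0.
unlock FracField.tofrac; rewrite -[LHS]FracField.pi_mul /FracField.mulf /=.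
apply/eqmodP; rewrite /= FracField.equivfE !numden_Ratio ?oner_eq0 ?mulr1 //.
by rewrite mulrC.
Qed.

Lemma has_val_ex x : x != 0 -> exists n, has_val x n.
Proof.
have [a [b b_neq0 ->]] := laurent_fracP x.
rewrite mulf_eq0 invr_eq0 negb_or !tofrac_eq0.
case/andP=> /fps_t_factor[m [u u_unit ->]] _.
have [n [v v_unit ->]] := fps_t_factor b_neq0.
exists (m%:Z - n%:Z), (u * v^-1); first by rewrite unitrM unitrV u_unit.
rewrite !rmorphM rmorphV // !rmorphXn invfM expfzDr //.
by rewrite mulrACA exprnN -exprnP.
Qed.

Lemma has_valV x n : has_val x n -> has_val x^-1 (- n).
Proof.
case=> u u_unit ->; exists u^-1; first by rewrite unitrV.
by rewrite invfM rmorphV // invr_expz.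
Qed.

End PowerSeriesTheory.

(** * Lattices and flags *)

Section IntegralMatrices.
Variables (K : fieldType) (m n : nat).
Local Notation O := (fps K).
Local Notation red := (@fps_red K).
Local Notation const := (@fps_const K).

Lemma map_tofrac_mx_inj : injective (@map_mx O _ (@tofrac O) m n).
Proof.
move=> A B /matrixP AB; apply/matrixP => i j.
by have := AB i j; rewrite !mxE => /eqP; rewrite tofrac_eq => /eqP.
Qed.

Lemma map_mx_constK (A : 'M[K]_(m, n)) : map_mx red (map_mx const A) = A.
Proof. by apply/matrixP => i j; rewrite !mxE fps_constK. Qed.

Lemma map_mx_shiftK (A : 'M[O]_(m, n)) :
  map_mx red A = 0 -> fps_t K *: map_mx (@fps_shift K) A = A.
Proof.
move/matrixP => A0; apply/matrixP => i j; rewrite !mxE fps_shiftK //.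
by have := A0 i j; rewrite !mxE.
Qed.

End IntegralMatrices.

Section Flags.
Variables (K : finFieldType) (n : nat).
Local Notation O := (fps K).
Local Notation F := (laurent K).
Local Notation iota := (@tofrac O).
Local Notation red := (@fps_red K).
Local Notation const := (@fps_const K).
Local Notation t := (fps_t K).
Implicit Types (g : 'M[F]_n) (B U : 'M[K]_n).

(* The span of the first [d] columns of the invertible matrix [B]. *)
Definition flag_space B (d : nat) : {set 'cV[K]_n} :=
  [set w | [forall i : 'I_n, (d <= i)%N ==> ((invmx B *m w) i 0 == 0)]]%SET.

Definition flag_diag (d : nat) : 'M[O]_n :=
  diag_mx (\row_(i < n) if (i < d)%N then 1 else t).

Definition flag_mx g B d := g *m map_mx iota (map_mx const B *m flag_diag d).

Lemma flag_spaceP B d w : reflect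
  (forall i : 'I_n, (d <= i)%N -> (invmx B *m w) i 0 = 0)
  (w \in flag_space B d).
Proof.
rewrite inE; apply: (iffP forallP) => w0 i.
  by move/(implyP (w0 i))/eqP.
by apply/implyP => di; apply/eqP/w0.
Qed.

Lemma flag_space0 B : B \in unitmx -> flag_space B 0 = [set 0]%SET.
Proof.
move=> B_unit; apply/setP => w; rewrite in_set1.
apply/flag_spaceP/eqP => [wB|-> i _]; last by rewrite mulmx0 mxE.
rewrite -[w](mulKVmx B_unit); suff -> : invmx B *m w = 0 by rewrite mulmx0.
by apply/colP => i; rewrite wB // mxE.
Qed.

Lemma flag_spaceT B d : (n <= d)%N -> flag_space B d = [set: _]%SET.
Proof.
move=> nd; apply/setP => w; rewrite in_setT; apply/flag_spaceP => i di.
by have := leq_trans nd di; rewrite leqNgt ltn_ord.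
Qed.

Lemma mem_flag_space_ebase U w :
  w \in flag_space (col_ebase U) (\rank U) <-> exists y, w = U *m y.
Proof.
have UE := mulmx_ebase U; have B_unit := col_ebase_unit U.
split=> [/flag_spaceP wB|[y ->]]; last first.
  apply/flag_spaceP => i rank_le.
  rewrite -[U in U *m y]UE -!mulmxA mulKmx // mxE.
  by rewrite big1 // => j _; rewrite mxE ltnNge rank_le andbF mul0r.
exists (invmx (row_ebase U) *m (invmx (col_ebase U) *m w)).
rewrite -{1}UE -!mulmxA mulKVmx ?row_ebase_unit //.
rewrite -[LHS](mulKVmx B_unit); congr (_ *m _); apply/colP => i.
rewrite [RHS]mxE (bigD1 i) //= big1 => [|j /negPf ji]; last first.
  by rewrite mxE eq_sym (inj_eq val_inj) ji mul0r.
rewrite addr0 [pid_mx _ _ _]mxE eqxx /=; case: ltnP => [_|/wB->];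
  first by rewrite mul1r.
by rewrite mulr0.
Qed.

Lemma mem_red_flag_space B d (w : 'cV[O]_n) : B \in unitmx ->
  map_mx red w \in flag_space B d
    <-> exists w', w = map_mx const B *m flag_diag d *m w'.
Proof.
move=> B_unit; have constBV : map_mx const B *m map_mx const (invmx B) = 1%:M.
  by rewrite -map_mxM mulmxV // map_mx1.
split=> [/flag_spaceP wB|[w' ->]]; last first.
  apply/flag_spaceP => i di; rewrite -mulmxA map_mxM map_mx_constK mulKmx //.
  by rewrite mxE mul_diag_mx !mxE ltnNge di rmorphM /= fps_red_t mul0r.
pose z := map_mx const (invmx B) *m w.
exists (\col_i if (i < d)%N then z i 0 else fps_shift (z i 0)).
rewrite -[w in LHS]mul1mx -constBV -!mulmxA; congr (_ *m _).
apply/colP => i; rewrite mul_diag_mx !mxE -/z; case: ltnP => [_|di].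
  by rewrite mul1r.
rewrite fps_shiftK //; have := wB i di.
by rewrite -{1}[invmx B]map_mx_constK -map_mxM 2!mxE.
Qed.

Lemma det_flag_diag d : (d <= n)%N -> \det (flag_diag d) = t ^+ (n - d).
Proof.
move=> dn; rewrite det_diag; under eq_bigr => i _ do rewrite mxE.
rewrite -(big_mkord xpredT (fun i => if (i < d)%N then 1 else t)).
rewrite (big_cat_nat (n := d)) //= -prodr_const_nat.
rewrite big_nat_cond big1 ?mul1r => [|i /andP[/andP[_ ->]]] //.
by apply: eq_big_nat => i /andP[di _]; rewrite ltnNge di.
Qed.

Lemma flag_mx_unit g B d :
  g \in unitmx -> B \in unitmx -> flag_mx g B d \in unitmx.
Proof.
move=> g_unit B_unit; rewrite unitmx_mul g_unit unitmxE unitfE det_map_mx.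
rewrite tofrac_eq0 det_mulmx det_diag mulf_neq0 //.
  by rewrite det_map_mx fmorph_eq0 -unitfE -unitmxE.
apply/prodf_neq0 => i _; rewrite mxE; case: ifP => _; first exact: oner_neq0.
exact: fps_t_neq0.
Qed.

Lemma has_val_flag_mx g B d (v : int) : (d <= n)%N -> B \in unitmx ->
  has_val (\det g) v -> has_val (\det (flag_mx g B d)) (v + (n - d)%N%:Z).
Proof.
move=> dn B_unit gv; rewrite det_mulmx; apply: has_valM => //.
rewrite det_map_mx det_mulmx det_flag_diag // rmorphM mulrC rmorphXn.
exists (\det (map_mx const B)) => //.
by rewrite fps_unitE det_map_mx -unitfE -unitmxE.
Qed.

End Flags.

Section Lattices.
Variable K : fieldType.
Local Notation O := (fps K).
Local Notation F := (laurent K).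
Local Notation iota := (@tofrac O).
Implicit Types (g h : 'M[F]_3) (k : 'M[O]_3) (w : 'cV[O]_3).

Lemma lattice_ofP g (v : 'cV[F]_3) :
  lattice_of g v <-> exists w, v = g *m map_mx iota w.
Proof.
split=> [[u u_int <-]|[w ->]]; last first.
  by exists (map_mx iota w) => // i; rewrite mxE; exists (w i ord0).
have [f fP] : {f : 'I_3 -> O & forall i, u i ord0 = iota (f i)}.
  by apply: (@choice _ _ (fun i a => u i ord0 = iota a)) => i; apply/integralP.
by exists (\col_i f i); congr (_ *m _); apply/colP => i; rewrite fP !mxE.
Qed.

Lemma lattice_of_subset g h :
  lattice_of h `<=` lattice_of g <-> exists k, h = g *m map_mx iota k.
Proof.
split=> [hg|[k ->]]; last first.
  move=> v /lattice_ofP[w ->]; apply/lattice_ofP.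
  by exists (k *m w); rewrite map_mxM mulmxA.
have [f fP] : {f : 'I_3 -> 'cV[O]_3
    & forall j, col j h = g *m map_mx iota (f j)}.
  apply: (@choice _ _ (fun j w => col j h = g *m map_mx iota w)) => j.
  apply/lattice_ofP/hg/lattice_ofP; exists (delta_mx j ord0).
  by rewrite map_delta_mx colE.
exists (\matrix_(i, j) f j i ord0); apply/matrixP => i j.
have /colP/(_ i) := fP j; rewrite !mxE => ->.
by apply: eq_bigr => l _; rewrite !mxE.
Qed.

Lemma lattice_ofD g u v :
  lattice_of g u -> lattice_of g v -> lattice_of g (u + v).
Proof.
move=> /lattice_ofP[w ->] /lattice_ofP[w' ->].
by apply/lattice_ofP; exists (w + w'); rewrite map_mxD mulmxDr.
Qed.

Lemma scale_lattice_of (a : F) g :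
  scale_lattice a (lattice_of g) = lattice_of (a *: g).
Proof.
apply/seteqP; split=> v.
  case=> u /lattice_ofP[w ->] <-; apply/lattice_ofP; exists w.
  by rewrite scalemxAl.
case/lattice_ofP=> w ->; exists (g *m map_mx iota w); last by rewrite scalemxAl.
by apply/lattice_ofP; exists w.
Qed.

Lemma act_lattice_of h g : act_lattice h (lattice_of g) = lattice_of (h *m g).
Proof.
apply/seteqP; split=> v.
  by case=> u /lattice_ofP[w ->] <-; apply/lattice_ofP; exists w;
    rewrite mulmxA.
case/lattice_ofP=> w ->; exists (g *m map_mx iota w); last by rewrite mulmxA.
by apply/lattice_ofP; exists w.
Qed.

Lemma lattice_of_unit g k : k \in unitmx ->
  lattice_of (g *m map_mx iota k) = lattice_of g.
Proof.
move=> k_unit; apply/seteqP; split; apply/lattice_of_subset; first by exists k.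
by exists (invmx k); rewrite -mulmxA -map_mxM mulmxV // map_mx1 mulmx1.
Qed.

Lemma lattice_of_eqP g h : g \in unitmx ->
  lattice_of h = lattice_of g <->
    exists2 k, k \in unitmx & h = g *m map_mx iota k.
Proof.
move=> g_unit; split=> [hg|[k k_unit ->]]; last exact: lattice_of_unit.
have [k hk] : exists k, h = g *m map_mx iota k.
  by apply/lattice_of_subset; rewrite hg.
have [k' gk] : exists k, g = h *m map_mx iota k.
  by apply/lattice_of_subset; rewrite hg.
exists k => //; suff /mulmx1_unit[] : k *m k' = 1%:M by [].
apply: map_tofrac_mx_inj; rewrite map_mxM map_mx1.
by apply: (can_inj (mulKmx g_unit)); rewrite mulmxA -hk -gk mulmx1.
Qed.

Lemma lattice_of_subset_eq g h n : g \in unitmx ->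
  has_val (\det g) n -> has_val (\det h) n ->
  lattice_of h `<=` lattice_of g -> lattice_of h = lattice_of g.
Proof.
move=> g_unit gn hn /lattice_of_subset[k hk].
apply/(lattice_of_eqP _ g_unit); exists k => //.
rewrite unitmxE; apply/has_val_tofrac; rewrite -det_map_mx.
by have := has_valM (has_valV gn) hn; rewrite addNr hk det_mulmx mulKf.
Qed.

Lemma lattice_of_eq_val g h m n : g \in unitmx -> lattice_of h = lattice_of g ->
  has_val (\det g) m -> has_val (\det h) n -> m = n.
Proof.
move=> g_unit /(lattice_of_eqP _ g_unit)[k k_unit ->] gm.
have k0 : has_val (\det (map_mx iota k)) 0.
  by rewrite det_map_mx; apply/has_val_tofrac; rewrite -unitmxE.
by rewrite det_mulmx => /(has_val_uniq (has_valM gm k0)); rewrite addr0.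
Qed.

Lemma has_val_detZ (a : F) g m n : has_val a m -> has_val (\det g) n ->
  has_val (\det (a *: g)) (m *+ 3 + n).
Proof. by move=> am gn; rewrite detZ; apply/has_valM/gn/has_valX. Qed.

End Lattices.

Section SubLattices.
Variable K : finFieldType.
Local Notation O := (fps K).
Local Notation F := (laurent K).
Local Notation iota := (@tofrac O).
Local Notation pi := (unif K).
Local Notation red := (@fps_red K).
Local Notation const := (@fps_const K).
Implicit Types (g h : 'M[F]_3) (w : 'cV[O]_3) (W : {set 'cV[K]_3}).

(* The preimage in the lattice [g O^3] of a set of residues [W]. *)
Definition sub_lattice g W : set 'cV[F]_3 :=
  [set g *m map_mx iota w | w in [set w | map_mx red w \in W]].

Lemma sub_latticeP g W w : g \in unitmx ->
  sub_lattice g W (g *m map_mx iota w) <-> map_mx red w \in W.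
Proof.
move=> g_unit; split=> [[w' w'W]|wW]; last by exists w.
by move/(can_inj (mulKmx g_unit))/map_tofrac_mx_inj <-.
Qed.

Lemma sub_lattice_subset g W W' : g \in unitmx ->
  (sub_lattice g W `<=` sub_lattice g W') <-> (W \subset W').
Proof.
move=> g_unit; split=> [WW'|/subsetP WW' v [w wW <-]]; last first.
  by exists w => //=; apply: WW'.
apply/subsetP => v vW; rewrite -[v]map_mx_constK.
by apply/(sub_latticeP _ _ g_unit)/WW'/(sub_latticeP _ _ g_unit);
  rewrite map_mx_constK.
Qed.

Lemma sub_lattice_inj g : g \in unitmx -> injective (sub_lattice g).
Proof.
move=> g_unit W W' eqW; apply/eqP; rewrite eqEsubset.
by apply/andP; split; apply/(sub_lattice_subset _ _ g_unit); rewrite eqW.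
Qed.

Lemma sub_latticeT g : sub_lattice g [set: 'cV[K]_3]%SET = lattice_of g.
Proof.
apply/seteqP; split=> v; first by case=> w _ <-; apply/lattice_ofP; exists w.
by case/lattice_ofP=> w ->; exists w; rewrite //= in_setT.
Qed.

Lemma sub_lattice0 g :
  sub_lattice g [set 0 : 'cV[K]_3]%SET = scale_lattice pi (lattice_of g).
Proof.
have scaleE w : g *m map_mx iota (fps_t K *: w) = pi *: g *m map_mx iota w.
  by rewrite map_mxZ -scalemxAr scalemxAl.
rewrite scale_lattice_of; apply/seteqP; split=> v.
  case=> w /set1P/map_mx_shiftK <- <-; apply/lattice_ofP.
  by exists (map_mx (@fps_shift K) w); rewrite scaleE.
case/lattice_ofP=> w ->; exists (fps_t K *: w); last exact: scaleE.
by rewrite /= in_set1 map_mxZ /= fps_red_t scale0r.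
Qed.

Lemma sub_lattice_flag g (B : 'M[K]_3) d : B \in unitmx ->
  sub_lattice g (flag_space B d) = lattice_of (flag_mx g B d).
Proof.
move=> B_unit; apply/seteqP; split=> v.
  case=> w /(mem_red_flag_space _ _ B_unit)[w' ->] <-; apply/lattice_ofP.
  by exists w'; rewrite /flag_mx [in LHS]map_mxM mulmxA.
case/lattice_ofP=> w ->; exists (map_mx const B *m flag_diag K 3 d *m w).
  by apply/(mem_red_flag_space _ _ B_unit); exists w.
by rewrite [in LHS]map_mxM mulmxA.
Qed.

(* An intermediate lattice is the preimage of the column space of [red k],
   where [k] expresses its basis in that of the larger lattice. *)
Lemma sub_lattice_between g h : g \in unitmx ->
  scale_lattice pi (lattice_of g) `<` lattice_of h ->
  lattice_of h `<` lattice_of g ->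
  exists B d, [/\ B \in unitmx, (0 < d < 3)%N
    & lattice_of h = sub_lattice g (flag_space B d)].
Proof.
move=> g_unit [pgh hpg] [/lattice_of_subset[k hk] gh].
pose U := map_mx red k; pose B := col_ebase U; pose d := \rank U.
have hE : lattice_of h = sub_lattice g (flag_space B d).
  apply/seteqP; split=> v.
    case/lattice_ofP=> w ->; rewrite hk -mulmxA -map_mxM.
    apply/(sub_latticeP _ _ g_unit)/mem_flag_space_ebase.
    by exists (map_mx red w); rewrite map_mxM.
  case=> w /mem_flag_space_ebase[y wy] <-.
  rewrite -(subrK (k *m map_mx const y) w) map_mxD mulmxDr map_mxM mulmxA -hk.
  apply: lattice_ofD; last by apply/lattice_ofP; exists (map_mx const y).
  apply: pgh; rewrite -sub_lattice0; apply/(sub_latticeP _ _ g_unit).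
  by rewrite in_set1 map_mxB map_mxM map_mx_constK wy subrr.
have B_unit : B \in unitmx := col_ebase_unit U.
exists B, d; split=> //; apply/andP; split.
  rewrite lt0n; apply: contra_notN hpg => /eqP d0.
  by rewrite hE d0 flag_space0 // sub_lattice0.
rewrite ltnNge; apply: contra_notN gh => d3.
by rewrite hE flag_spaceT // sub_latticeT.
Qed.

End SubLattices.

(** * Subspaces of the residue space *)

Local Close Scope classical_set_scope.

Section CompleteBasis.
Variables (F : fieldType) (n : nat).

Lemma complete_col (v : 'cV[F]_n.+1) : v != 0 ->
  exists2 B : 'M_n.+1, B \in unitmx & col 0 B = v.
Proof.
move=> v_neq0; have rank_v : \rank v = 1%N.
  by apply/eqP; rewrite eqn_leq rank_leq_col lt0n mxrank_eq0.
pose r := row_ebase v 0 0; have r_neq0 : r != 0.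
  by have := row_ebase_unit v; rewrite unitmxE det_mx11 unitfE.
exists (r *: col_ebase v); first by rewrite unitmxZ ?unitfE ?col_ebase_unit.
rewrite -[RHS]mulmx_ebase rank_v; apply/colP => i.
rewrite !mxE big_ord1 mxE -/r mulrC (bigD1 0) //= big1 => [|j j_neq0].
  by rewrite addr0 mxE mulr1.
have j_gt0 : (0 < j)%N by rewrite lt0n.
by rewrite [pid_mx _ _ _]mxE gtn_eqF ?mulr0.
Qed.

Lemma complete_row (l : 'rV[F]_n.+1) i : l != 0 ->
  exists2 B : 'M_n.+1, B \in unitmx & row i B = l.
Proof.
move=> l_neq0; have [|B B_unit Bl] := @complete_col l^T;
  first by rewrite trmx_eq0.
exists (xrow 0 i B^T); first by rewrite xrowE unitmx_mul unitmx_perm unitmx_tr.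
apply/rowP => j; rewrite !mxE perm.tpermR.
by have /colP/(_ j) := Bl; rewrite !mxE.
Qed.

Lemma mulmx_eq1_ex (l : 'rV[F]_n) : l != 0 -> exists v : 'cV_n, l *m v = 1.
Proof.
case/rV0Pn=> i li; exists ((l 0 i)^-1 *: delta_mx i 0).
by rewrite -scalemxAr -colE; apply/matrixP => a b;
  rewrite !ord1 !mxE eqxx mulVf.
Qed.

End CompleteBasis.

Section Subspaces.
Variables (K : finFieldType) (n : nat).
Local Notation q := #|K|.
Implicit Types (v w : 'cV[K]_n.+1) (l : 'rV[K]_n.+1) (W U : {set 'cV[K]_n.+1}).

Definition subspaces (d : nat) : {set {set 'cV[K]_n.+1}} :=
  [set flag_space B d | B : 'M[K]_n.+1 in unitmx].

Definition vline v : {set 'cV[K]_n.+1} := [set c *: v | c : K].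
Definition hyperplane l : {set 'cV[K]_n.+1} := [set w | l *m w == 0].

Lemma vlineP v w : reflect (exists c, w = c *: v) (w \in vline v).
Proof. by apply: (iffP imsetP) => [[c _ ->]|[c ->]]; exists c. Qed.

Lemma vline_id v : v \in vline v.
Proof. by apply/vlineP; exists 1; rewrite scale1r. Qed.

Lemma vline_sub_hyperplane v l : (vline v \subset hyperplane l) = (l *m v == 0).
Proof.
apply/subsetP/eqP => [/(_ v (vline_id v))|lv w /vlineP[c ->]].
  by rewrite inE => /eqP.
by rewrite inE -scalemxAr lv scaler0.
Qed.

Lemma flag_space1 (B : 'M[K]_n.+1) : B \in unitmx ->
  flag_space B 1 = vline (col 0 B).
Proof.
move=> B_unit; apply/setP => w; apply/flag_spaceP/vlineP => [wB|[c ->] i i_gt0].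
  exists ((invmx B *m w) 0 0); rewrite -[LHS](mulKVmx B_unit) colE scalemxAr.
  congr (_ *m _); apply/colP => i.
  rewrite [in RHS]mxE [delta_mx _ _ _ _]mxE andbT.
  have [->|i_neq0] := eqVneq i 0; first by rewrite mulr1.
  by rewrite mulr0 wB // lt0n.
rewrite colE -scalemxAr mulKmx // !mxE andbT -val_eqE /= gtn_eqF //.
by rewrite mulr0.
Qed.

Lemma flag_space_hyperplane (B : 'M[K]_n.+1) : B \in unitmx ->
  flag_space B n = hyperplane (row ord_max (invmx B)).
Proof.
move=> B_unit; apply/setP => w; rewrite [RHS]inE -row_mul.
apply/flag_spaceP/eqP => [wB|/rowP wB i n_le_i].
  by apply/rowP => j; rewrite [j]ord1 [LHS]mxE wB // mxE.
have -> : i = ord_max by apply/val_inj/anti_leq; rewrite n_le_i -ltnS ltn_ord.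
by have := wB 0; rewrite mxE [X in _ = X]mxE.
Qed.

Lemma subspaces1P W :
  reflect (exists2 v, v != 0 & W = vline v) (W \in subspaces 1).
Proof.
apply: (iffP imsetP) => [[B B_unit ->]|[v /complete_col[B B_unit <-] ->]].
  exists (col 0 B); last exact: flag_space1.
  apply: contraTneq (oner_neq0 K) => B0.
  have := congr1 (mulmx (invmx B)) B0; rewrite colE mulKmx // mulmx0.
  by move/colP/(_ 0); rewrite !mxE eqxx => /eqP; rewrite oner_eq0.
by exists B; rewrite ?flag_space1.
Qed.

Lemma hyperplanesP W :
  reflect (exists2 l, l != 0 & W = hyperplane l) (W \in subspaces n).
Proof.
apply: (iffP imsetP) => [[B B_unit ->]|[l l_neq0 ->]].
  exists (row ord_max (invmx B)); last exact: flag_space_hyperplane.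
  apply: contraTneq (oner_neq0 K) => B0.
  have := congr1 (mulmx ^~ B) B0; rewrite -row_mul mulVmx // mul0mx.
  by move/rowP/(_ ord_max); rewrite !mxE eqxx => /eqP; rewrite oner_eq0.
have [B B_unit BE] := complete_row ord_max l_neq0.
exists (invmx B); first by rewrite unitmx_inv.
by rewrite flag_space_hyperplane ?unitmx_inv // invmxK BE.
Qed.

Lemma vline_eq v w : v != 0 -> w != 0 ->
  (vline v == vline w) = [exists c, w == c *: v].
Proof.
move=> v_neq0 w_neq0; apply/eqP/existsP => [vw|[c /eqP wE]].
  by have /vlineP[c ->] : w \in vline v by [rewrite vw vline_id]; exists c.
have c_neq0 : c != 0 by apply: contraNneq w_neq0 => c0; rewrite wE c0 scale0r.
apply/setP => u; apply/vlineP/vlineP => -[d ->].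
  by exists (d / c); rewrite wE scalerA divfK.
by exists (d * c); rewrite wE scalerA.
Qed.

Lemma hyperplane_eq l l' : l != 0 -> l' != 0 ->
  (hyperplane l == hyperplane l') = [exists c, l' == c *: l].
Proof.
move=> l_neq0 l'_neq0; apply/eqP/existsP => [ll'|[c /eqP l'E]]; last first.
  have c_neq0 : c != 0.
    by apply: contraNneq l'_neq0 => c0; rewrite l'E c0 scale0r.
  by apply/setP => w; rewrite !inE l'E -scalemxAl scalemx_eq0 (negPf c_neq0).
have [v lv] := mulmx_eq1_ex l_neq0.
exists ((l' *m v) 0 0); apply/eqP/rowP => j.
have : delta_mx j 0 - l 0 j *: v \in hyperplane l'.
  rewrite -ll' inE mulmxBr -colE -scalemxAr lv; apply/eqP/matrixP => a b.
  by rewrite !ord1 !mxE eqxx mulr1 subrr.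
rewrite inE mulmxBr -colE -scalemxAr subr_eq0 => /eqP/matrixP/(_ 0 0).
by rewrite !mxE mulrC.
Qed.

Lemma card_vline v : v != 0 -> #|vline v| = q.
Proof.
move=> v_neq0; rewrite card_imset // => c c' /eqP.
by rewrite -subr_eq0 -scalerBl scalemx_eq0 (negPf v_neq0) orbF subr_eq0 => /eqP.
Qed.

Lemma card_hyperplane l : l != 0 -> #|hyperplane l| = (q ^ n)%N.
Proof.
case/mulmx_eq1_ex=> v lv; have q_gt0 : (0 < q)%N by apply/card_gt0P; exists 0.
have card_cV : (q ^ n.+1)%N = #|{: 'cV[K]_n.+1}| by rewrite card_mx muln1.
apply/eqP; rewrite -(eqn_pmul2l q_gt0) -expnS card_cV; apply/eqP.
rewrite -[RHS]sum1_card (partition_big (fun w => (l *m w) 0 0) predT) //=.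
rewrite -sum_nat_const; apply: eq_bigr => c _; rewrite sum1dep_card.
rewrite -(card_imset _ (addrI (c *: v))); apply: eq_card => w; rewrite !inE.
apply/imsetP/eqP => [[u]|lw].
  by rewrite inE => /eqP lu ->;
    rewrite mulmxDr lu addr0 -scalemxAr lv !mxE mulr1.
exists (w - c *: v); last by rewrite addrC subrK.
rewrite inE mulmxBr -scalemxAr lv; apply/eqP/matrixP => i j.
by rewrite !ord1 !mxE eqxx mulr1 -lw mxE subrr.
Qed.

Lemma card_dual_hyperplane v : v != 0 ->
  #|[set l : 'rV[K]_n.+1 | l *m v == 0]| = (q ^ n)%N.
Proof.
move=> v_neq0; rewrite -(@card_hyperplane v^T) ?trmx_eq0 //.
rewrite -(card_imset _ (can_inj (@trmxK K 1 n.+1))).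
apply: eq_card => w; rewrite !inE; apply/imsetP/eqP => [[l]|vw].
  by rewrite inE => /eqP lv ->; rewrite -trmx_mul lv trmx0.
by exists w^T; rewrite ?trmxK // inE -[v]trmxK -trmx_mul vw trmx0.
Qed.

Lemma card_scaling_classes (E : finType) (a b k : nat) (f : 'M[K]_(a, b) -> E)
    (D : {set 'M[K]_(a, b)}) :
    0 \in D -> (forall (c : K) x, x \in D -> c *: x \in D) ->
    (forall x y : 'M_(a, b), x != 0 -> y != 0 ->
      (f x == f y) = [exists c, y == c *: x]) ->
    #|D| = (q ^ k)%N ->
  #|f @: (D :\ 0)| = (\sum_(i < k) q ^ i)%N.
Proof.
move=> D0 DZ fE cardD; have q1_gt0 : (0 < q.-1)%N.
  by rewrite -subn1 subn_gt0 card_finNzRing_gt1.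
apply/eqP; rewrite -(eqn_pmul2l q1_gt0) -predn_exp -cardD (cardsD1 0) D0 /=.
rewrite mulnC -[X in _ == X]sum1_card (partition_big_imset f) -sum_nat_const.
apply/eqP/eq_bigr => y /imsetP[x /setD1P[x_neq0 xD] ->]; rewrite sum1dep_card.
suff -> : [set z in D :\ 0 | f z == f x] = [set c *: x | c in predC1 (0 : K)].
  rewrite card_imset ?cardC1 // => c c' /eqP; rewrite -subr_eq0 -scalerBl.
  by rewrite scaler_eq0 (negPf x_neq0) orbF subr_eq0 => /eqP.
apply/setP => z; rewrite inE.
apply/andP/imsetP => [[/setD1P[z_neq0 _]]|[c c_neq0 ->]].
  rewrite eq_sym fE // => /existsP[c /eqP zE]; exists c => //.
  by rewrite inE; apply: contraNneq z_neq0 => c0; rewrite zE c0 scale0r.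
have cx_neq0 : c *: x != 0 by rewrite scaler_eq0 negb_or x_neq0 andbT.
rewrite !inE cx_neq0 DZ // eq_sym fE //; split=> //.
by apply/existsP; exists c.
Qed.

Lemma subspaces1_in W : (forall (c : K) v, v \in W -> c *: v \in W) ->
  [set U in subspaces 1 | U \subset W] = vline @: (W :\ 0).
Proof.
move=> WZ; apply/setP => U; rewrite inE.
apply/andP/imsetP => [[/subspaces1P[v v_neq0 ->] /subsetP vW]|[v]].
  by exists v; rewrite // !inE v_neq0 vW ?vline_id.
case/setD1P=> v_neq0 vW ->; split; first by apply/subspaces1P; exists v.
by apply/subsetP => _ /vlineP[c ->]; apply: WZ.
Qed.

Lemma hyperplanes_over v :
  [set U in subspaces n | vline v \subset U]
    = hyperplane @: ([set l | l *m v == 0] :\ 0).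
Proof.
apply/setP => U; rewrite inE.
apply/andP/imsetP => [[/hyperplanesP[l l_neq0 ->]]|[l]].
  by rewrite vline_sub_hyperplane => lv; exists l; rewrite // !inE l_neq0.
rewrite !inE => /andP[l_neq0 lv] ->; split;
  last by rewrite vline_sub_hyperplane.
by apply/hyperplanesP; exists l.
Qed.

Lemma card_subspaces1 : #|subspaces 1| = (\sum_(i < n.+1) q ^ i)%N.
Proof.
have TZ (c : K) v : v \in setT -> c *: v \in setT by rewrite !in_setT.
have cardT : #|[set: 'cV[K]_n.+1]| = (q ^ n.+1)%N.
  by rewrite cardsT card_mx muln1.
rewrite -(card_scaling_classes (in_setT _) TZ vline_eq cardT) -subspaces1_in //.
by apply: eq_card => U; rewrite inE subsetT andbT.
Qed.

Lemma card_hyperplanes : #|subspaces n| = (\sum_(i < n.+1) q ^ i)%N.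
Proof.
have TZ (c : K) l : l \in setT -> c *: l \in setT by rewrite !in_setT.
have cardT : #|[set: 'rV[K]_n.+1]| = (q ^ n.+1)%N.
  by rewrite cardsT card_mx mul1n.
rewrite -(card_scaling_classes (in_setT _) TZ hyperplane_eq cardT).
apply: eq_card => U; apply/hyperplanesP/imsetP => [[l l_neq0 ->]|[l]].
  by exists l; rewrite // !inE l_neq0.
by case/setD1P=> l_neq0 _ ->; exists l.
Qed.

Lemma card_subspaces1_in U : U \in subspaces n ->
  #|[set W in subspaces 1 | W \subset U]| = (\sum_(i < n) q ^ i)%N.
Proof.
case/hyperplanesP=> l l_neq0 ->; have lZ (c : K) v :
    v \in hyperplane l -> c *: v \in hyperplane l.
  by rewrite !inE -scalemxAr => /eqP->; rewrite scaler0.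
rewrite subspaces1_in //; apply: (card_scaling_classes _ lZ vline_eq).
  by rewrite inE mulmx0.
exact: card_hyperplane.
Qed.

Lemma card_hyperplanes_over W : W \in subspaces 1 ->
  #|[set U in subspaces n | W \subset U]| = (\sum_(i < n) q ^ i)%N.
Proof.
case/subspaces1P=> v v_neq0 ->; rewrite hyperplanes_over.
apply: (card_scaling_classes _ _ hyperplane_eq (card_dual_hyperplane v_neq0)).
  by rewrite inE mul0mx.
by move=> c l; rewrite !inE -scalemxAl => /eqP->; rewrite scaler0.
Qed.

Lemma subspaces1_eq W W' w : W \in subspaces 1 -> W' \in subspaces 1 ->
  w \in W -> w \in W' -> w != 0 -> W = W'.
Proof.
have vline_mem u : u != 0 -> w != 0 -> w \in vline u -> vline u = vline w.
  move=> u_neq0 w_neq0 /vlineP[c wE]; apply/eqP; rewrite vline_eq //.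
  by apply/existsP; exists c; rewrite wE.
case/subspaces1P=> v v_neq0 -> /subspaces1P[v' v'_neq0 ->] wv wv' w_neq0.
by rewrite (vline_mem v) // (vline_mem v').
Qed.

End Subspaces.

Section ResiduePlane.
Variable K : finFieldType.
Local Notation q := #|K|.
Implicit Types (W U : {set 'cV[K]_3}).

Lemma disjoint_subspaces12 : [disjoint subspaces K 2 1 & subspaces K 2 2].
Proof.
rewrite disjoint_subset; apply/subsetP => W /subspaces1P[v v_neq0 ->].
rewrite inE.
apply/negP => /hyperplanesP[l l_neq0 vl].
have := card_hyperplane l_neq0; rewrite -vl card_vline // => /eqP.
by rewrite -{1}[q]expn1 eqn_exp2l ?card_finNzRing_gt1.
Qed.

(* Both hyperplanes have as many elements as the span of the two lines. *)
Lemma subspaces2_join W W' U U' :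
    W \in subspaces K 2 1 -> W' \in subspaces K 2 1 -> W != W' ->
    U \in subspaces K 2 2 -> U' \in subspaces K 2 2 ->
    W \subset U -> W' \subset U -> W \subset U' -> W' \subset U' ->
  U = U'.
Proof.
case/subspaces1P=> v v_neq0 -> /subspaces1P[v' v'_neq0 ->] vv'.
pose span := [set x.1 *: v + x.2 *: v' | x : K * K].
have card_span : #|span| = (q ^ 2)%N.
  rewrite card_imset ?card_prod ?mulnn // => -[a b] [c d] /= /eqP.
  rewrite -subr_eq0 opprD addrACA -!scalerBl addrC addr_eq0 => /eqP bdE.
  have bd0 : b - d = 0.
    apply: contraNeq vv' => bd_neq0; rewrite vline_eq //; apply/existsP.
    exists (- ((b - d)^-1 * (a - c))); apply/eqP.
    by rewrite scaleNr -scalerA -scalerN -bdE scalerA mulVf // scale1r.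
  move/eqP: bdE; rewrite bd0 scale0r eq_sym oppr_eq0 scalemx_eq0 (negPf v_neq0).
  rewrite orbF subr_eq0 => /eqP->.
  by move/eqP: bd0; rewrite subr_eq0 => /eqP->.
suff spanE l : l != 0 -> vline v \subset hyperplane l ->
    vline v' \subset hyperplane l -> hyperplane l = span.
  move=> /hyperplanesP[l ? ->] /hyperplanesP[l' ? ->] *.
  by rewrite (spanE l) // (spanE l').
move=> l_neq0; rewrite !vline_sub_hyperplane => /eqP lv /eqP lv'.
apply/esym/eqP.
rewrite eqEcard card_span card_hyperplane // leqnn andbT.
apply/subsetP => _ /imsetP[x _ ->].
by rewrite inE mulmxDr -!scalemxAr lv lv' !scaler0 addr0.
Qed.

Lemma subspaces2_meet U U' : U \in subspaces K 2 2 -> U' \in subspaces K 2 2 ->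
  exists2 W, W \in subspaces K 2 1 & (W \subset U) && (W \subset U').
Proof.
case/hyperplanesP=> l l_neq0 -> /hyperplanesP[l' l'_neq0 ->].
have [v v_neq0 /eqP] : exists2 v : 'cV[K]_3, v != 0 & col_mx l l' *m v = 0.
  have : kermx (col_mx l l')^T != 0.
    by rewrite kermx_eq0 /row_free ltn_eqF // ltnS rank_leq_col.
  case/rowV0Pn=> u /sub_kermxP uA u_neq0; exists u^T; first by rewrite trmx_eq0.
  by apply: trmx_inj; rewrite trmx_mul trmxK uA trmx0.
rewrite mul_col_mx col_mx_eq0 => /andP[lv l'v].
exists (vline v); last by rewrite !vline_sub_hyperplane lv.
by apply/subspaces1P; exists v.
Qed.

Theorem residue_plane : projective_plane (subspaces K 2 1) (subspaces K 2 2)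
  (fun W U => W \subset U) q.
Proof.
split.
- by apply/card_gt0P; exists 0.
- exact: disjoint_subspaces12.
- by rewrite card_subspaces1 !big_ord_recr big_ord0 /= expn0 expn1; lia.
- by rewrite card_hyperplanes !big_ord_recr big_ord0 /= expn0 expn1; lia.
- by move=> W /card_hyperplanes_over->;
  rewrite !big_ord_recr big_ord0 /= expn0 expn1; lia.
- by move=> U /card_subspaces1_in->;
  rewrite !big_ord_recr big_ord0 /= expn0 expn1; lia.
move=> W W' WP W'P WW'; rewrite leqNgt; apply/negP => /card_gt1P[U [U' []]].
rewrite !inE => /and3P[UL WU W'U] /and3P[U'L WU' W'U'] /eqP[].
exact: (subspaces2_join WP W'P WW').
Qed.

End ResiduePlane.

(** * Stars of the building *)

Local Open Scope classical_set_scope.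

Section ProperSubsets.
Variable T : Type.
Implicit Types A B C : set T.

Lemma subset_setproper_trans A B C : A `<=` B -> B `<` C -> A `<` C.
Proof. by rewrite -subsetEset -!properEset; apply: le_lt_trans. Qed.

Lemma setproper_subset_trans A B C : A `<` B -> B `<=` C -> A `<` C.
Proof. by rewrite -subsetEset -!properEset; apply: lt_le_trans. Qed.

Lemma setproper_trans A B C : A `<` B -> B `<` C -> A `<` C.
Proof. by rewrite -!properEset; apply: lt_trans. Qed.

End ProperSubsets.

Lemma unitmx_scale (E : fieldType) n (a : E) (g : 'M[E]_n) :
  a != 0 -> g \in unitmx -> a *: g \in unitmx.
Proof. by move=> a_neq0 g_unit; rewrite unitmxZ // unitfE. Qed.

Lemma det_unitmx_neq0 (E : fieldType) n (g : 'M[E]_n) :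
  g \in unitmx -> \det g != 0.
Proof. by rewrite unitmxE unitfE. Qed.

Section LatticeActions.
Variable K : fieldType.
Local Notation F := (laurent K).
Implicit Types (a b : F) (g : 'M[F]_3) (L M : set 'cV[F]_3).

Lemma scale_latticeA a b L :
  scale_lattice a (scale_lattice b L) = scale_lattice (a * b) L.
Proof.
apply/seteqP; split=> v.
  by case=> u [w Lw <-] <-; exists w; rewrite ?scalerA.
by case=> w Lw <-; exists (b *: w); rewrite ?scalerA //; exists w.
Qed.

Lemma scale_latticeC a b L :
  scale_lattice a (scale_lattice b L) = scale_lattice b (scale_lattice a L).
Proof. by rewrite !scale_latticeA mulrC. Qed.

Lemma scale_lattice1 L : scale_lattice 1 L = L.
Proof.
apply/seteqP; split=> v; first by case=> u Lu <-; rewrite scale1r.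
by move=> Lv; exists v; rewrite ?scale1r.
Qed.

Lemma scale_lattice_subset a L M :
  L `<=` M -> scale_lattice a L `<=` scale_lattice a M.
Proof. exact: image_subset. Qed.

Lemma scale_lattice_proper a L M : a != 0 ->
  L `<` M -> scale_lattice a L `<` scale_lattice a M.
Proof.
move=> a_neq0 [LM ML]; split=> [|aML]; first exact: scale_lattice_subset.
apply: ML; have := scale_lattice_subset (a := a^-1) aML.
by rewrite !scale_latticeA mulVf // !scale_lattice1.
Qed.

Lemma act_lattice_scale g a L :
  act_lattice g (scale_lattice a L) = scale_lattice a (act_lattice g L).
Proof.
apply/seteqP; split=> v [_ [u Lu <-] <-].
  by exists (g *m u); rewrite ?scalemxAr //; exists u.
by exists (a *: u); rewrite ?scalemxAr //; exists u.
Qed.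

Lemma act_lattice_proper g L M : g \in unitmx ->
  L `<` M -> act_lattice g L `<` act_lattice g M.
Proof.
move=> g_unit [LM ML]; split=> [|gML]; first exact: image_subset.
apply: ML => v Mv; have [|u Lu guv] := gML (g *m v); first by exists v.
by rewrite -(can_inj (mulKmx g_unit) guv).
Qed.

End LatticeActions.

Section Vertices.
Variable K : fieldType.
Local Notation F := (laurent K).
Implicit Types (g h : 'M[F]_3) (L M : set 'cV[F]_3) (x y : vertex K).

Lemma homothety_scale (a : F) L : a != 0 ->
  homothety_class (scale_lattice a L) = homothety_class L.
Proof.
move=> a_neq0; apply/seteqP; split=> M [b b_neq0 <-].
  by exists (b * a); [exact: mulf_neq0 b_neq0 a_neq0|rewrite scale_latticeA].
exists (b / a); last by rewrite scale_latticeA divfK.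
by apply: mulf_neq0 b_neq0 _; rewrite invr_eq0.
Qed.

Lemma vertex_mem_class x L : \val x L -> \val x = homothety_class L.
Proof.
case: x => c /= /asboolP[M [g g_unit ->] ->] [a a_neq0 <-].
by rewrite homothety_scale.
Qed.

Lemma vertex_mem_inj x y L : \val x L -> \val y L -> x = y.
Proof.
by move=> /vertex_mem_class xL /vertex_mem_class yL; apply/val_inj;
  rewrite xL yL.
Qed.

Lemma vertex_mem_scale x L (a : F) :
  a != 0 -> \val x L -> \val x (scale_lattice a L).
Proof. by move=> a_neq0 /vertex_mem_class->; exists a. Qed.

Definition vertex_rep x g := g \in unitmx /\ \val x (lattice_of g).

Lemma vertex_memP x L :
  \val x L -> exists2 g, vertex_rep x g & L = lattice_of g.
Proof.
move=> xL; have /asboolP[M [g g_unit ->] xM] := valP x.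
have [a a_neq0 Lg] : homothety_class (lattice_of g) L by rewrite -xM.
exists (a *: g); last by rewrite -Lg scale_lattice_of.
split; first exact: unitmx_scale.
by rewrite -scale_lattice_of Lg.
Qed.

Lemma homothety_class_id L : homothety_class L L.
Proof. by exists 1; [exact: oner_neq0|rewrite scale_lattice1]. Qed.

Lemma vertex_rep_ex x : exists g, vertex_rep x g.
Proof.
have /asboolP[M [g g_unit ->] xM] := valP x.
by exists g; split; rewrite // xM; apply: homothety_class_id.
Qed.

Lemma lattice_vertex_ex g : g \in unitmx -> exists x, vertex_rep x g.
Proof.
move=> g_unit.
have is_cls : `[< is_vertex (homothety_class (lattice_of g)) >].
  by apply/asboolP; exists (lattice_of g) => //; exists g.
exists (exist (fun c => `[< is_vertex c >]) _ is_cls); split=> //.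
exact: homothety_class_id.
Qed.

Lemma vertex_rep_scale x g h : vertex_rep x g -> vertex_rep x h ->
  exists2 a, a != 0 & lattice_of h = lattice_of (a *: g).
Proof.
move=> [g_unit /vertex_mem_class xg] [h_unit]; rewrite xg => -[a a_neq0 <-].
by exists a; rewrite // scale_lattice_of.
Qed.

Lemma vertex_rep_val_mod3 x g h m n : vertex_rep x g -> vertex_rep x h ->
  has_val (\det g) m -> has_val (\det h) n -> exists l : int, n = l *+ 3 + m.
Proof.
move=> xg xh gm hn; have [a a_neq0 hE] := vertex_rep_scale xg xh.
have [l al] := has_val_ex a_neq0; exists l; apply/esym.
apply: lattice_of_eq_val hE (has_val_detZ al gm) hn.
by apply: unitmx_scale a_neq0 _; case: xg.
Qed.

Lemma vertex_rep_val_eq x g h n : vertex_rep x g -> vertex_rep x h ->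
  has_val (\det g) n -> has_val (\det h) n -> lattice_of h = lattice_of g.
Proof.
move=> xg xh gn hn; have [a a_neq0 hE] := vertex_rep_scale xg xh.
have [l al] := has_val_ex a_neq0; have [g_unit _] := xg.
have nE : l *+ 3 + n = n.
  apply: lattice_of_eq_val hE (has_val_detZ al gn) hn.
  exact: unitmx_scale.
have l0 : l = 0 by lia.
case: al hE; rewrite l0 => u u_unit ->; rewrite mul1r => ->.
rewrite -mul_mx_scalar -map_scalar_mx lattice_of_unit //.
by rewrite unitmxE det_scalar unitrX.
Qed.

Lemma color_rep x g n : vertex_rep x g -> has_val (\det g) n -> color x = n%:~R.
Proof.
move=> xg gn; rewrite /color; case: xgetP => [k _|/(_ n%:~R)[]]; last first.
  by exists g; case: xg => ? ?; rewrite (laurent_valE gn).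
case=> h [h_unit xh ->]; have [m hm] := has_val_ex (det_unitmx_neq0 h_unit).
have [l mE] := vertex_rep_val_mod3 xg (conj h_unit xh) gn hm.
have three0 : 3%:R = 0 :> 'Z_3 by apply/val_inj.
rewrite (laurent_valE hm) mE rmorphD rmorphMn /= -mulr_natr.
by rewrite three0 mulr0 add0r.
Qed.

End Vertices.

Section Stars.
Variable K : finFieldType.
Local Notation F := (laurent K).
Local Notation pi := (unif K).
Local Notation residue_subspaces := (subspaces K 2).
Implicit Types (g h : 'M[F]_3) (L M : set 'cV[F]_3) (x y z : vertex K).
Implicit Types (U W : {set 'cV[K]_3}) (d : nat).

Lemma Z3_natr_inj d d' : d%:R = d'%:R :> 'Z_3 ->
  (0 < d < 3)%N -> (0 < d' < 3)%N -> d = d'.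
Proof. by move/(congr1 val); case: d d' => [|[|[|d]]] [|[|[|d']]]. Qed.

Definition proper_subspaces : {set {set 'cV[K]_3}} :=
  (residue_subspaces 1 :|: residue_subspaces 2)%SET.

Lemma proper_subspacesP W : reflect
  (exists2 d, (0 < d < 3)%N & W \in residue_subspaces d)
  (W \in proper_subspaces).
Proof.
apply: (iffP setUP) => [[] Wd|[[|[|[|d]]]] // _ Wd]; [| |by left|by right].
  by exists 1%N.
by exists 2%N.
Qed.

Lemma card_residue_subspace d W : (0 < d < 3)%N ->
  W \in residue_subspaces d -> #|W| = (#|K| ^ d)%N.
Proof.
case: d => [|[|[|d]]] // _.
  by case/subspaces1P=> v v_neq0 ->; rewrite card_vline.
by case/hyperplanesP=> l l_neq0 ->; rewrite card_hyperplane.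
Qed.

Lemma sub_lattice_rep g d W y : g \in unitmx -> W \in residue_subspaces d ->
  \val y (sub_lattice g W) -> exists B, [/\ B \in unitmx, W = flag_space B d
    & vertex_rep y (flag_mx g B d)].
Proof.
move=> g_unit /imsetP[B B_unit ->]; rewrite sub_lattice_flag // => yB.
by exists B; split;
  [exact: B_unit|split|split; [exact: flag_mx_unit|exact: yB]].
Qed.

Lemma color_sub_lattice x y g d W :
    vertex_rep x g -> W \in residue_subspaces d -> (d <= 3)%N ->
    \val y (sub_lattice g W) ->
  color x - color y = d%:R.
Proof.
move=> xg Wd d3 yW; have [g_unit _] := xg.
have [n gn] := has_val_ex (det_unitmx_neq0 g_unit).
have [B [B_unit _ yB]] := sub_lattice_rep g_unit Wd yW.
rewrite (color_rep xg gn) (color_rep yB (has_val_flag_mx d3 B_unit gn)).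
rewrite rmorphD opprD addrA subrr add0r; apply/val_inj.
by case: d d3 {Wd yW B_unit yB} => [|[|[|[|]]]].
Qed.

Lemma sub_lattice_vertex_inj x y g W W' : vertex_rep x g ->
  W \in proper_subspaces -> W' \in proper_subspaces ->
  \val y (sub_lattice g W) -> \val y (sub_lattice g W') -> W = W'.
Proof.
move=> xg /proper_subspacesP[d d3 Wd] /proper_subspacesP[d' d'3 W'd'] yW yW'.
have d_le3 : (d <= 3)%N by case/andP: d3 => _ /ltnW.
have d'_le3 : (d' <= 3)%N by case/andP: d'3 => _ /ltnW.
have /Z3_natr_inj dd' : d%:R = d'%:R :> 'Z_3.
  rewrite -(color_sub_lattice xg Wd d_le3 yW).
  exact: color_sub_lattice xg W'd' d'_le3 yW'.
have {}dd' := dd' d3 d'3; rewrite -{}dd' in W'd'; have [g_unit _] := xg.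
have [n gn] := has_val_ex (det_unitmx_neq0 g_unit).
have [B [B_unit WE yB]] := sub_lattice_rep g_unit Wd yW.
have [B' [B'_unit W'E yB']] := sub_lattice_rep g_unit W'd' yW'.
apply: (sub_lattice_inj g_unit).
rewrite WE W'E (sub_lattice_flag g d B_unit) (sub_lattice_flag g d B'_unit).
apply: (vertex_rep_val_eq yB' yB); exact: has_val_flag_mx d_le3 _ gn.
Qed.

Lemma sub_lattice_proper g W : g \in unitmx -> W \in proper_subspaces ->
  scale_lattice pi (lattice_of g) `<` sub_lattice g W
    /\ sub_lattice g W `<` lattice_of g.
Proof.
move=> g_unit /proper_subspacesP[d d3 Wd].
have q_gt1 := card_finNzRing_gt1 K; have card_W := card_residue_subspace d3 Wd.
have W0 : 0 \in W.
  by case/imsetP: Wd => B _ ->; apply/flag_spaceP => i _; rewrite mulmx0 mxE.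
rewrite -sub_lattice0 -sub_latticeT; split; split.
- by apply/(sub_lattice_subset _ _ g_unit); rewrite sub1set.
- move/(sub_lattice_subset _ _ g_unit)/subset_leq_card.
  by rewrite cards1 card_W leqNgt -(expn0 #|K|) ltn_exp2l //;
    case/andP: d3 => ->.
- exact/(sub_lattice_subset _ _ g_unit)/subsetT.
- move/(sub_lattice_subset _ _ g_unit)/subset_leq_card.
  by rewrite cardsT card_mx card_W leqNgt ltn_exp2l //; case/andP: d3 => _ ->.
Qed.

Lemma lattice_of_proper_unif g : g \in unitmx ->
  scale_lattice pi (lattice_of g) `<` lattice_of g.
Proof.
move=> g_unit; have /card_gt0P[W WP] : (0 < #|residue_subspaces 1|)%N.
  by rewrite (card_points (residue_plane K)) addn1.
have [|pW Wg] := sub_lattice_proper (W := W) g_unit; first by rewrite inE WP.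
exact: setproper_trans pW Wg.
Qed.

Definition vertex_basis x : 'M[F]_3 := xget 1%:M [set g | vertex_rep x g].

Lemma vertex_basisP x : vertex_rep x (vertex_basis x).
Proof.
by have [g xg] := vertex_rep_ex x; apply: (xgetPex _ (ex_intro _ g xg)).
Qed.

Lemma vertex_basis_unit x : vertex_basis x \in unitmx.
Proof. by case: (vertex_basisP x). Qed.

Hint Resolve vertex_basis_unit : core.

Definition star_vertex x W : vertex K :=
  xget x [set y | \val y (sub_lattice (vertex_basis x) W)].

Lemma star_vertexP x W : W \in proper_subspaces ->
  \val (star_vertex x W) (sub_lattice (vertex_basis x) W).
Proof.
case/proper_subspacesP=> d _ /imsetP[B B_unit ->].
have flag_unit := flag_mx_unit d (vertex_basis_unit x) B_unit.
have [y [_ yB]] := lattice_vertex_ex flag_unit.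
rewrite /star_vertex; case: xgetP => [z _ //|/(_ y)[]].
by rewrite /= sub_lattice_flag.
Qed.

Lemma star_vertexE x W y : W \in proper_subspaces ->
  \val y (sub_lattice (vertex_basis x) W) <-> y = star_vertex x W.
Proof.
move=> WS; split=> [yW|->]; last exact: star_vertexP.
exact: vertex_mem_inj yW (star_vertexP x WS).
Qed.

Lemma star_vertex_inj x : {in proper_subspaces &, injective (star_vertex x)}.
Proof.
move=> W W' WS W'S WW'.
apply: (sub_lattice_vertex_inj (vertex_basisP x) WS W'S).
  exact: star_vertexP.
by rewrite WW'; apply: star_vertexP.
Qed.

Lemma sub_lattice_ex g M y : g \in unitmx -> \val y M ->
    scale_lattice pi (lattice_of g) `<` M -> M `<` lattice_of g ->
  exists2 W, W \in proper_subspaces & M = sub_lattice g W.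
Proof.
move=> g_unit /vertex_memP[h _ ->] pgh hg.
have [B [d [B_unit d3 ->]]] := sub_lattice_between g_unit pgh hg.
exists (flag_space B d); last by [].
by apply/proper_subspacesP; exists d; rewrite // imset_f.
Qed.

Lemma proper_subspaces_proper U W :
    U \in proper_subspaces -> W \in proper_subspaces -> U \proper W ->
  U \in residue_subspaces 1 /\ W \in residue_subspaces 2.
Proof.
move=> /proper_subspacesP[d d3 Ud] /proper_subspacesP[d' d'3 Wd'] /proper_card.
rewrite (card_residue_subspace d3 Ud) (card_residue_subspace d'3 Wd').
rewrite ltn_exp2l ?card_finNzRing_gt1 //.
by case: d d' d3 d'3 Ud Wd' => [|[|[|d]]] [|[|[|d']]].
Qed.

Definition linked x y := exists M0 M1,
  [/\ \val x M0, \val y M1, M1 `<` M0 & scale_lattice pi M0 `<` M1].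

Definition triangle x y z := exists M0 M1 M2,
  [/\ \val x M0, \val y M1 & \val z M2] /\
  [/\ M1 `<` M0, M2 `<` M1 & scale_lattice pi M0 `<` M2].

Lemma linked_sym x y : linked x y -> linked y x.
Proof.
move=> [M0 [M1 [xM0 yM1 M10 pM]]]; exists M1, (scale_lattice pi M0); split=> //.
  exact: vertex_mem_scale (unif_neq0 K) xM0.
exact: scale_lattice_proper (unif_neq0 K) M10.
Qed.

Lemma triangle_rot x y z : triangle x y z -> triangle y z x.
Proof.
move=> [M0 [M1 [M2 [[xM0 yM1 zM2] [M10 M21 pM]]]]].
exists M1, M2, (scale_lattice pi M0); split; split=> //.
  exact: vertex_mem_scale (unif_neq0 K) xM0.
exact: scale_lattice_proper (unif_neq0 K) M10.
Qed.

Lemma triangle_linked x y z : triangle x y z -> linked x y.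
Proof.
move=> [M0 [M1 [M2 [[xM0 yM1 zM2] [M10 M21 pM]]]]]; exists M0, M1; split=> //.
exact: setproper_trans pM M21.
Qed.

Lemma vertex_basis_normalize x M : \val x M ->
  exists2 a : F, a != 0 & scale_lattice a M = lattice_of (vertex_basis x).
Proof.
move=> /vertex_memP[h xh ->].
have [a a_neq0 hE] := vertex_rep_scale xh (vertex_basisP x).
by exists a; rewrite // scale_lattice_of hE.
Qed.

Lemma linkedP x y :
  linked x y <-> exists2 W, W \in proper_subspaces & y = star_vertex x W.
Proof.
split=> [[M0 [M1 [xM0 yM1 M10 pM]]]|[W WS ->]]; last first.
  have [pW Wg] := sub_lattice_proper (vertex_basis_unit x) WS.
  exists (lattice_of (vertex_basis x)), (sub_lattice (vertex_basis x) W).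
  by split=> //; [case: (vertex_basisP x)|apply: star_vertexP].
have [a a_neq0 aM] := vertex_basis_normalize xM0.
have yaM1 := vertex_mem_scale a_neq0 yM1.
have [||W WS WE] := sub_lattice_ex (vertex_basis_unit x) yaM1.
- by rewrite -aM scale_latticeC; apply: scale_lattice_proper.
- by rewrite -aM; apply: scale_lattice_proper.
by exists W => //; apply/(star_vertexE _ _ WS); rewrite -WE.
Qed.

Lemma star_triangle x U W : U \in residue_subspaces 1 ->
  W \in residue_subspaces 2 -> U \subset W ->
  triangle x (star_vertex x W) (star_vertex x U).
Proof.
move=> U1 W2 UW; have g_unit := vertex_basis_unit x.
have [US WS] : U \in proper_subspaces /\ W \in proper_subspaces.
  by rewrite !inE U1 W2 orbT.
have [pU _] := sub_lattice_proper g_unit US.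
have [_ Wg] := sub_lattice_proper g_unit WS.
exists (lattice_of (vertex_basis x)), (sub_lattice (vertex_basis x) W).
exists (sub_lattice (vertex_basis x) U); split; split=> //.
- by case: (vertex_basisP x).
- exact: star_vertexP.
- exact: star_vertexP.
split; first exact/(sub_lattice_subset _ _ g_unit).
move/(sub_lattice_subset _ _ g_unit) => WU.
have UEW : U = W by apply/eqP; rewrite eqEsubset UW.
by have := disjointFr (disjoint_subspaces12 K) U1; rewrite UEW W2.
Qed.

Lemma triangleP x y z : triangle x z y <->
  exists U W, [/\ U \in residue_subspaces 1, W \in residue_subspaces 2,
    U \subset W, y = star_vertex x U & z = star_vertex x W].
Proof.
split=> [[M0 [M1 [M2 [[xM0 zM1 yM2] [M10 M21 pM]]]]]|]; last first.
  by move=> [U [W [U1 W2 UW -> ->]]]; apply: star_triangle.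
have g_unit := vertex_basis_unit x.
have [a a_neq0 aM] := vertex_basis_normalize xM0.
have aM21 := scale_lattice_proper a_neq0 M21.
have aM1g : scale_lattice a M1 `<` lattice_of (vertex_basis x).
  by rewrite -aM; apply: scale_lattice_proper.
have paM2 :
    scale_lattice pi (lattice_of (vertex_basis x)) `<` scale_lattice a M2.
  by rewrite -aM scale_latticeC; apply: scale_lattice_proper.
have zaM1 := vertex_mem_scale a_neq0 zM1.
have yaM2 := vertex_mem_scale a_neq0 yM2.
have [U US UE] := sub_lattice_ex g_unit yaM2 paM2 (setproper_trans aM21 aM1g).
have [W WS WE] := sub_lattice_ex g_unit zaM1 (setproper_trans paM2 aM21) aM1g.
have properUW : U \proper W.
  have [subUW not_subWU] := aM21; rewrite UE WE in subUW not_subWU.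
  apply/andP; split; first exact/(sub_lattice_subset _ _ g_unit).
  by apply/negP => /(sub_lattice_subset _ _ g_unit).
have [U1 W2] := proper_subspaces_proper US WS properUW.
exists U, W; split=> //; first exact: proper_sub properUW.
  by apply/(star_vertexE _ _ US); rewrite -UE.
by apply/(star_vertexE _ _ WS); rewrite -WE.
Qed.

Lemma color_star_vertex x d W : (0 < d < 3)%N -> W \in residue_subspaces d ->
  color x - color (star_vertex x W) = d%:R.
Proof.
move=> d3 Wd; have WS : W \in proper_subspaces.
  by apply/proper_subspacesP; exists d.
apply: color_sub_lattice (vertex_basisP x) Wd _ (star_vertexP x WS).
by case/andP: d3 => _ /ltnW.
Qed.

Lemma linked_neq x y : linked x y -> x <> y.
Proof.
case/linkedP=> W /proper_subspacesP[d d3 Wd] -> xE.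
have := color_star_vertex x d3 Wd; rewrite -xE subrr => /(congr1 val) /=.
by case: d d3 {Wd} => [|[|[|d]]].
Qed.

Section Cells.
Variables (i : nat) (e : 'I_i.+1 -> vertex K).

Lemma cell_linked (j k : 'I_i.+1) :
  building_cell e -> (j < k)%N -> linked (e j) (e k).
Proof.
move=> [L [eL L_decr pL]] jk; exists (L j), (L k); split=> //;
  first exact: L_decr.
have Lj0 : L j `<=` L ord0.
  have [j0|j0] := posnP j; last exact: properW (L_decr ord0 j j0).
  by have -> : j = ord0 by apply/val_inj.
have Lmaxk : L ord_max `<=` L k.
  have := ltn_ord k; rewrite ltnS leq_eqVlt => /orP[/eqP ki|ki].
    by rewrite (_ : k = ord_max) //; apply/val_inj.
  exact: properW (L_decr k ord_max ki).
apply: subset_setproper_trans (scale_lattice_subset Lj0) _.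
exact: setproper_subset_trans pL Lmaxk.
Qed.

Lemma moves_cell g (e' : 'I_i.+1 -> vertex K) : g \in unitmx ->
  (forall k, moves_to g (e k) (e' k)) -> building_cell e -> building_cell e'.
Proof.
move=> g_unit ee' [L [eL L_decr pL]]; exists (fun k => act_lattice g (L k)).
split=> [k|j k jk|]; first by rewrite ee'; exists (L k).
  by apply: act_lattice_proper => //; apply: L_decr.
by rewrite -act_lattice_scale; apply: act_lattice_proper.
Qed.

End Cells.

Lemma cell_triangle (e : 'I_3 -> vertex K) : building_cell e ->
  triangle (e ord0) (e (inord 1)) (e ord_max).
Proof.
move=> [L [eL L_decr pL]]; exists (L ord0), (L (inord 1)), (L ord_max).
by split; split=> //; apply: L_decr; rewrite inordK.
Qed.

Lemma vertex_cell x : building_cell (fun _ : 'I_1 => x).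
Proof.
exists (fun=> lattice_of (vertex_basis x)); split=> [_|j k|].
- by case: (vertex_basisP x).
- by rewrite !ord1.
- exact: lattice_of_proper_unif.
Qed.

Lemma linked_cell x y : linked x y ->
  building_cell (fun i : 'I_2 => if i == ord0 then x else y).
Proof.
move=> [M0 [M1 [xM0 yM1 M10 pM]]].
exists (fun i => if i == ord0 then M0 else M1); split=> [k|j k|//].
  by case: ifP.
by case: j k => -[|[|]] // ? [[|[|]]].
Qed.

Lemma triangle_cell x y z : triangle x y z -> building_cell
  (fun i : 'I_3 => if i == ord0 then x else if i == ord_max then z else y).
Proof.
move=> [M0 [M1 [M2 [[xM0 yM1 zM2] [M10 M21 pM]]]]].
exists (fun i => if i == ord0 then M0 else if i == ord_max then M2 else M1).
split=> [k|j k|//]; first by case: ifP => // _; case: ifP.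
have M20 := setproper_trans M21 M10.
by case: j k => -[|[|[|]]] // ? [[|[|[|]]]].
Qed.

Lemma adjacentP x y : adjacent x y <-> linked x y.
Proof.
split=> [/asboolP[e e_cell xye]|xy]; last first.
  apply/asboolP; exists (fun i : 'I_2 => if i == ord0 then x else y).
    exact: linked_cell.
  apply/seteqP; split=> [z [->|->]|z [i _ <-]]; first by exists ord0.
    by exists ord_max.
  by case: ifP => _; [left|right].
have e01 : linked (e ord0) (e ord_max) by apply: cell_linked.
have xy_e0 : [set x; y] (e ord0) by rewrite xye; exists ord0.
have xy_e1 : [set x; y] (e ord_max) by rewrite xye; exists ord_max.
have := linked_neq e01.
case: xy_e0 => e0E; case: xy_e1 => e1E; rewrite e0E e1E in e01 * => // _.
exact: linked_sym.
Qed.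

Lemma colored_edgeP x y d : (0 < d < 3)%N -> colored_edge d%:R x y <->
  exists2 W, W \in residue_subspaces d & y = star_vertex x W.
Proof.
move=> d3; split=> [[/adjacentP/linkedP[W WS ->] cxy]|[W Wd ->]].
  exists W => //; have /proper_subspacesP[d' d'3 Wd'] := WS.
  have dd' : d%:R = d'%:R :> 'Z_3.
    by rewrite -cxy -(color_star_vertex x d'3 Wd').
  by rewrite (Z3_natr_inj dd').
split; last exact: color_star_vertex.
by apply/adjacentP/linkedP; exists W => //; apply/proper_subspacesP; exists d.
Qed.

Lemma colored_edge_sym x y : colored_edge 1 x y <-> colored_edge 2%:R y x.
Proof.
have oneN : 2%:R = - 1 :> 'Z_3 by apply/val_inj.
by split=> -[/adjacentP/linked_sym/adjacentP yx cE]; split;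
  rewrite // -opprB cE oneN ?opprK.
Qed.

Lemma star_colored_edge y W U : W \in residue_subspaces 1 ->
  U \in residue_subspaces 2 -> W \subset U ->
  colored_edge 2%:R (star_vertex y U) (star_vertex y W).
Proof.
move=> W1 U2 WU; split.
  by apply/adjacentP;
    have /triangle_rot/triangle_linked := star_triangle y W1 U2 WU.
have -> : color (star_vertex y U) - color (star_vertex y W) =
    (color y - color (star_vertex y W)) - (color y - color (star_vertex y U)).
  by rewrite opprB [RHS]addrC addrA subrK.
by rewrite (color_star_vertex y _ W1) // (color_star_vertex y _ U2) //;
  apply/val_inj.
Qed.

Lemma colored_diamond_ex x y z :
    colored_edge 1 x y -> colored_edge 2%:R y z ->
  exists2 y', colored_edge 2%:R x y' & colored_edge 1 y' z.
Proof.
move=> /colored_edge_sym/(colored_edgeP _ _ (d := 2) isT)[U U2 ->].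
move=> /(colored_edgeP _ _ (d := 2) isT)[U' U'2 ->].
have [W W1 /andP[WU WU']] := subspaces2_meet U2 U'2.
exists (star_vertex y W); first exact: star_colored_edge.
exact/colored_edge_sym/star_colored_edge.
Qed.

Lemma sub_lattice_subspaces1_meet g W W' v : g \in unitmx ->
    W \in residue_subspaces 1 -> W' \in residue_subspaces 1 -> W != W' ->
    sub_lattice g W v -> sub_lattice g W' v ->
  scale_lattice pi (lattice_of g) v.
Proof.
move=> g_unit W1 W'1 WW' [w wW <-] /(sub_latticeP _ _ g_unit) wW'.
rewrite -sub_lattice0; apply/(sub_latticeP _ _ g_unit); rewrite inE.
by apply: contraNT WW' => w_neq0; apply/eqP; apply: subspaces1_eq wW wW' w_neq0.
Qed.

Lemma colored_edge_rep x y g n d : (0 < d < 3)%N -> vertex_rep x g ->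
    has_val (\det g) n -> colored_edge d%:R x y ->
  exists h, [/\ vertex_rep y h, has_val (\det h) (n + (3 - d)%N%:Z)
    & lattice_of h `<=` lattice_of g].
Proof.
move=> d3 xg gn /(colored_edgeP _ _ d3)[W Wd ->].
have WS : W \in proper_subspaces by apply/proper_subspacesP; exists d.
have b_unit := vertex_basis_unit x; have yW := star_vertexP x WS.
have [B [B_unit WE [h_unit yh]]] := sub_lattice_rep b_unit Wd yW.
have [a a_neq0 gE] := vertex_rep_scale (vertex_basisP x) xg.
have [l al] := has_val_ex a_neq0.
have [k bk] := has_val_ex (det_unitmx_neq0 b_unit).
have -> : n = l *+ 3 + k.
  apply/esym; apply: lattice_of_eq_val gE (has_val_detZ al bk) gn.
  exact: unitmx_scale a_neq0 b_unit.
exists (a *: flag_mx (vertex_basis x) B d); split.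
- split; first exact: unitmx_scale a_neq0 h_unit.
  by rewrite -scale_lattice_of; apply: vertex_mem_scale a_neq0 yh.
- rewrite -addrA; apply: has_val_detZ al _.
  by apply: has_val_flag_mx B_unit bk; case/andP: d3 => _ /ltnW.
rewrite gE -!scale_lattice_of; apply: scale_lattice_subset.
rewrite -(sub_lattice_flag _ _ B_unit) -WE.
by have [_ []] := sub_lattice_proper b_unit WS.
Qed.

Lemma colored_path_rep x y z n (g := vertex_basis x) :
    has_val (\det g) n -> colored_edge 1 x y -> colored_edge 2%:R y z ->
  exists W h, [/\ W \in residue_subspaces 1, y = star_vertex x W,
    vertex_rep z h, has_val (\det h) (n + 3%:Z)
    & lattice_of h `<=` sub_lattice g W].
Proof.
move=> gn /(colored_edgeP _ _ (d := 1) isT)[W W1 yE] yz.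
have yW : \val y (sub_lattice g W).
  by rewrite yE; apply: star_vertexP; rewrite inE W1.
have [B [B_unit WE yB]] := sub_lattice_rep (vertex_basis_unit x) W1 yW.
have Bn := has_val_flag_mx (isT : (1 <= 3)%N) B_unit gn.
have [h [zh hn hB]] := colored_edge_rep (d := 2) isT yB Bn yz.
exists W, h; split=> //; first by rewrite -addrA in hn.
by rewrite WE (sub_lattice_flag _ _ B_unit).
Qed.

Lemma colored_diamond_uniq x y y' z :
    colored_edge 1 x y -> colored_edge 1 x y' ->
    colored_edge 2%:R y z -> colored_edge 2%:R y' z -> y <> y' ->
  x = z.
Proof.
move=> xy xy' yz y'z yy'; have [g_unit xg] := vertex_basisP x.
have [n gn] := has_val_ex (det_unitmx_neq0 g_unit).
have [W [h [W1 yW zh hn hW]]] := colored_path_rep gn xy yz.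
have [W' [h' [W'1 yW' zh' h'n hW']]] := colored_path_rep gn xy' y'z.
rewrite (vertex_rep_val_eq zh zh' hn h'n) in hW'.
have WW' : W != W' by apply: contra_not_neq yy' => WW'; rewrite yW yW' WW'.
have hpig : lattice_of h `<=` lattice_of (pi *: vertex_basis x).
  move=> v hv; rewrite -scale_lattice_of.
  exact: sub_lattice_subspaces1_meet W1 W'1 WW' (hW v hv) (hW' v hv).
have pig_val : has_val (\det (pi *: vertex_basis x)) (n + 3%:Z).
  rewrite (_ : n + 3%:Z = 1 *+ 3 + n); last by lia.
  by apply: has_val_detZ gn; rewrite -[pi]expr1z; apply: has_val_unif.
have pig_unit := unitmx_scale (unif_neq0 K) g_unit.
have [_ zhL] := zh; apply: vertex_mem_inj _ zhL.
rewrite (lattice_of_subset_eq pig_unit pig_val hn hpig) -scale_lattice_of.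
exact: vertex_mem_scale (unif_neq0 K) xg.
Qed.

Lemma moves_ex g x : g \in unitmx -> exists y, moves_to g x y.
Proof.
move=> g_unit; have [h [h_unit xh]] := vertex_rep_ex x.
have gh_unit : g *m h \in unitmx by rewrite unitmx_mul g_unit h_unit.
have [y [_ yg]] := lattice_vertex_ex gh_unit.
exists y; rewrite /moves_to (vertex_mem_class yg) (vertex_mem_class xh).
rewrite -act_lattice_of; apply/seteqP; split=> M.
  case=> a a_neq0 <-; rewrite -act_lattice_scale.
  by exists (scale_lattice a (lattice_of h)); first by exists a.
by case=> _ [a a_neq0 <-] <-; exists a; rewrite // act_lattice_scale.
Qed.

Lemma moves_rep g x y h : g \in unitmx -> moves_to g x y ->
  vertex_rep x h -> vertex_rep y (g *m h).
Proof.
move=> g_unit gxy [h_unit xh]; split; first by rewrite unitmx_mul g_unit h_unit.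
by rewrite -act_lattice_of gxy; exists (lattice_of h).
Qed.

Lemma scalars_moves g x y : scalars g -> moves_to g x y -> y = x.
Proof.
move=> [a a_neq0 <-] gxy; have [h [_ xh]] := vertex_rep_ex x.
apply: vertex_mem_inj (vertex_mem_scale a_neq0 xh).
rewrite scale_lattice_of -mul_scalar_mx -act_lattice_of gxy.
by exists (lattice_of h).
Qed.

Lemma moves_linked g x x' y y' : g \in unitmx ->
  moves_to g x x' -> moves_to g y y' -> linked x y -> linked x' y'.
Proof.
move=> g_unit gx gy /linked_cell/(moves_cell g_unit) moved.
pose e' (k : 'I_2) := if k == ord0 then x' else y'.
have e'_cell : building_cell e' by apply: moved => k; rewrite /e'; case: ifP.
exact: (cell_linked (j := ord0) (k := ord_max) e'_cell isT).
Qed.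

Lemma moves_color g x y m : g \in unitmx -> has_val (\det g) m ->
  moves_to g x y -> color y = m%:~R + color x.
Proof.
move=> g_unit gm gxy; have [h xh] := vertex_rep_ex x; have [h_unit _] := xh.
have [n hn] := has_val_ex (det_unitmx_neq0 h_unit).
have ghn : has_val (\det (g *m h)) (m + n).
  by rewrite det_mulmx; apply: has_valM.
by rewrite (color_rep xh hn) (color_rep (moves_rep g_unit gxy xh) ghn) rmorphD.
Qed.

Lemma moves_colored_edge g x x' y y' c : g \in unitmx ->
  moves_to g x x' -> moves_to g y y' ->
  colored_edge c x y -> colored_edge c x' y'.
Proof.
move=> g_unit gx gy [/adjacentP xy <-]; split.
  exact/adjacentP/(moves_linked g_unit gx gy).
have [m gm] := has_val_ex (det_unitmx_neq0 g_unit).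
rewrite (moves_color g_unit gm gx) (moves_color g_unit gm gy).
by rewrite opprD addrACA subrr add0r.
Qed.

End Stars.

(** * Horofunctions and the spectrum of the building *)

Section RowValuation.
Variables (K : fieldType) (n : nat).
Local Notation O := (fps K).
Local Notation F := (laurent K).
Local Notation iota := (@tofrac O).
Local Notation pi := (unif K).
Local Notation red := (@fps_red K).
Implicit Types (v : 'rV[F]_n.+1) (r : 'rV[O]_n.+1) (l : 'rV[K]_n.+1).

(* [m] is the least valuation of a coordinate of [v], and [l] is the reduction
   of [pi ^ - m *: v]. *)
Definition row_val v (m : int) l := exists r,
  [/\ v = pi ^ m *: map_mx iota r, l = map_mx red r & l != 0].

Lemma row_primitive r : r != 0 ->
  exists j, exists2 r', r = fps_t K ^+ j *: r' & map_mx red r' != 0.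
Proof.
case/rV0Pn=> i /fps_t_factor[j [u u_unit]].
elim: j r => [|j IH] r ri.
  exists 0%N, r; first by rewrite expr0 scale1r.
  by apply/rV0Pn; exists i; rewrite mxE ri expr0 mul1r -fps_unitE.
have [r0|r_neq0] := eqVneq (map_mx red r) 0; last first.
  by exists 0%N, r; rewrite ?expr0 ?scale1r.
have rE := map_mx_shiftK r0.
have /IH[k [r' r'E r'_neq0]] : map_mx (@fps_shift K) r 0 i = fps_t K ^+ j * u.
  by apply: (mulfI (fps_t_neq0 K));
    rewrite mulrA -exprS -ri -[in RHS]rE [RHS]mxE.
by exists k.+1, r'; rewrite // exprS -scalerA -r'E.
Qed.

Lemma row_common_denominator v :
  exists2 b : O, b != 0 & exists r, iota b *: v = map_mx iota r.
Proof.
pose fraction i (p : O * O) := p.2 != 0 /\ v 0 i = iota p.1 / iota p.2.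
have [f fP] : {f & forall i, fraction i (f i)}.
  apply: (@choice _ _ fraction) => i.
  by have [a [b b_neq0 vE]] := laurent_fracP (v 0 i); exists (a, b).
exists (\prod_i (f i).2); first by apply/prodf_neq0 => i _; case: (fP i).
exists (\row_i ((f i).1 * \prod_(j | j != i) (f j).2)); apply/rowP => i.
have [fi_neq0 vE] := fP i; rewrite !mxE vE (bigD1 i) //= !rmorphM /=.
rewrite mulrC -mulrA [X in _ * X]mulrA mulVf ?tofrac_eq0 // mul1r.
by [].
Qed.

Lemma row_val_scale v (a : F) k m l : has_val a k -> row_val v m l ->
  exists l', row_val (a *: v) (k + m) l'.
Proof.
move=> [u u_unit ->] [r [-> -> r_neq0]].
exists (red u *: map_mx red r), (u *: r); split; last 2 first.
- by rewrite map_mxZ.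
- by rewrite scalemx_eq0 (negPf r_neq0) orbF -fps_unitE.
by rewrite map_mxZ !scalerA expfzDr ?unif_neq0 // mulrAC.
Qed.

Lemma row_val_ex v : v != 0 -> exists m l, row_val v m l.
Proof.
move=> v_neq0; have [b b_neq0 [r bvE]] := row_common_denominator v.
have b_unit : iota b != 0 by rewrite tofrac_eq0.
have r_neq0 : r != 0.
  apply: contraNneq v_neq0 => r0; move/eqP: bvE.
  by rewrite r0 map_mx0 scalemx_eq0 (negPf b_unit).
have [j [r' rE r'_neq0]] := row_primitive r_neq0.
have bv_val : row_val (iota b *: v) j%:Z (map_mx red r').
  by exists r'; split; rewrite // bvE rE map_mxZ rmorphXn.
have [k bk] := has_val_ex b_unit.
have [l] := row_val_scale (has_valV bk) bv_val.
by rewrite scalerA mulVf // scale1r; exists (- k + j%:Z), l.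
Qed.

Lemma row_val_uniq v m m' l l' : row_val v m l -> row_val v m' l' -> m = m'.
Proof.
wlog le_mm' : m m' l l' / m <= m'.
  move=> wlog_le vm vm'; case: (leP m m') => [le_mm'|/ltW le_m'm].
    exact: wlog_le le_mm' vm vm'.
  by apply/esym; apply: wlog_le le_m'm vm' vm.
move=> [r [vE lr l_neq0]] [r' [vE' _ _]].
have [[|k] m'E] : exists k : nat, m' = m + k%:Z.
- by exists `|m' - m|%N; rewrite gez0_abs ?subr_ge0 // subrKC.
- by rewrite m'E addr0.
suff rE : r = fps_t K ^+ k.+1 *: r'.
  by case/eqP: l_neq0;
    rewrite lr rE map_mxZ exprS rmorphM /= fps_red_t mul0r scale0r.
apply: map_tofrac_mx_inj.
have pim_neq0 : pi ^ m != 0 by apply: expfz_neq0; apply: unif_neq0.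
apply: (scalerI pim_neq0).
by rewrite -vE vE' m'E expfzDr ?unif_neq0 // -scalerA map_mxZ rmorphXn.
Qed.

Lemma row_val_unit v k m l : k \in unitmx -> row_val v m l ->
  row_val (v *m map_mx iota k) m (l *m map_mx red k).
Proof.
move=> k_unit [r [-> lr l_neq0]]; exists (r *m k); split.
- by rewrite -scalemxAl map_mxM.
- by rewrite lr map_mxM.
have redk_unit : map_mx red k \in unitmx.
  by rewrite unitmxE det_map_mx; apply: rmorph_unit; rewrite -unitmxE.
by apply: contraNneq l_neq0 => lk0; rewrite -[l](mulmxK redk_unit) lk0 mul0mx.
Qed.

End RowValuation.

Section RowValuationFlags.
Variables (K : finFieldType) (n : nat).
Local Notation O := (fps K).
Local Notation F := (laurent K).
Local Notation iota := (@tofrac O).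
Local Notation pi := (unif K).
Local Notation red := (@fps_red K).
Implicit Types (l : 'rV[K]_n.+1).

Lemma flag_space_sub_hyperplane (B : 'M[K]_n.+1) d l : B \in unitmx ->
  (flag_space B d \subset hyperplane l)
    = [forall i : 'I_n.+1, (i < d)%N ==> ((l *m B) 0 i == 0)].
Proof.
move=> B_unit; apply/subsetP/forallP => [lB i|lB w].
  apply/implyP => lt_id; have : col i B \in flag_space B d.
    apply/flag_spaceP => j le_dj; rewrite colE mulKmx // mxE andbT.
    by have [ji|//] := eqVneq j i; rewrite -ji ltnNge le_dj in lt_id.
  by move/lB; rewrite inE colE mulmxA -colE => /eqP/colP/(_ 0);
    rewrite !mxE => ->.
move/flag_spaceP=> wB; rewrite inE -[w](mulKVmx B_unit) (mulmxA l B).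
apply/eqP/matrixP => a b; rewrite !ord1 [LHS]mxE [RHS]mxE big1 // => i _.
have [lt_id|le_di] := ltnP i d; last by rewrite wB ?mulr0.
by rewrite (eqP (implyP (lB i) lt_id)) mul0r.
Qed.

Lemma row_val_flag (g : 'M[F]_n.+1) B d i0 m l :
    B \in unitmx -> row_val (row i0 g) m l ->
  exists l', row_val (row i0 (flag_mx g B d))
    (m + (flag_space B d \subset hyperplane l)%:Z) l'.
Proof.
move=> B_unit [r [gE lr l_neq0]].
pose rB := r *m map_mx (@fps_const K) B.
have redB : map_mx red rB = l *m B by rewrite map_mxM -lr map_mx_constK.
pose s := rB *m flag_diag K n.+1 d.
have rowE : row i0 (flag_mx g B d) = pi ^ m *: map_mx iota s.
  by rewrite row_mul gE -scalemxAl -map_mxM mulmxA.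
have sE i : s 0 i = rB 0 i * (if (i < d)%N then 1 else fps_t K).
  by rewrite /s mul_mx_diag !mxE.
have lBE i : (l *m B) 0 i = red (rB 0 i) by rewrite -redB [LHS]mxE.
have /rV0Pn[j lBj] : l *m B != 0.
  by apply: contraNneq l_neq0 => lB0; rewrite -[l](mulmxK B_unit) lB0 mul0mx.
rewrite flag_space_sub_hyperplane //.
have [/forallP lB|/forallPn[k]] :=
    boolP [forall i : 'I_n.+1, (i < d)%N ==> ((l *m B) 0 i == 0)]; last first.
  rewrite negb_imply => /andP[lt_kd lBk].
  exists (map_mx red s), s; split; rewrite // ?addr0 //.
  by apply/rV0Pn; exists k; rewrite mxE sE lt_kd mulr1 -lBE.
have lB0 (i : 'I_n.+1) : (i < d)%N -> red (rB 0 i) = 0.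
  by move=> lt_id; rewrite -lBE (eqP (implyP (lB i) lt_id)).
have s0 : map_mx red s = 0.
  apply/rowP => i; rewrite [LHS]mxE [RHS]mxE sE rmorphM /=.
  by case: ifP => [/lB0->|_]; rewrite ?mul0r // fps_red_t mulr0.
exists (map_mx red (map_mx (@fps_shift K) s)), (map_mx (@fps_shift K) s).
split=> //.
  rewrite rowE -[in LHS](map_mx_shiftK s0) map_mxZ scalerA.
  by rewrite expfzDr ?unif_neq0.
have not_lt_jd : (j < d)%N = false.
  by apply: contraNF lBj => /lB0 rBj; rewrite lBE rBj.
apply/rV0Pn; exists j.
rewrite 2!mxE sE not_lt_jd mulrC /fps_red /fps_shift fps_mul_tS.
by rewrite -[rB 0 j 0%N]/(red (rB 0 j)) -lBE.
Qed.

End RowValuationFlags.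

Section Horofunction.
Variable K : finFieldType.
Local Notation F := (laurent K).
Local Notation red := (@fps_red K).
Local Notation residue_subspaces := (subspaces K 2).
Implicit Types (g h : 'M[F]_3) (x y : vertex K) (l : 'rV[K]_3).

(* A Busemann function of the point at infinity defined by the first
   coordinate: the index of a lattice, corrected by three times the least
   valuation of that coordinate so as to depend only on the homothety class. *)
Definition busemann x (n : int) := exists g d m l,
  [/\ vertex_rep x g, has_val (\det g) d, row_val (row 0 g) m l
    & n = d - m *+ 3].

Lemma busemann_uniq x n n' : busemann x n -> busemann x n' -> n = n'.
Proof.
move=> [g [d [m [l [xg gd gm ->]]]]] [h [d' [m' [l' [xh hd' hm' ->]]]]].
have [a a_neq0 hE] := vertex_rep_scale xg xh; have [g_unit _] := xg.
have ag_unit := unitmx_scale a_neq0 g_unit.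
have [k k_unit hk] := (lattice_of_eqP h ag_unit).1 hE.
have [j aj] := has_val_ex a_neq0.
have dE := lattice_of_eq_val ag_unit hE (has_val_detZ aj gd) hd'.
have [l'' agm] := row_val_scale aj gm.
have hm : row_val (row 0 h) (j + m) (l'' *m map_mx red k).
  by rewrite hk row_mul linearZ; apply: row_val_unit.
by have mE := row_val_uniq hm hm'; lia.
Qed.

Lemma busemann_star x : exists n, exists2 l, busemann x n & l != 0 /\
  forall d W, (0 < d < 3)%N -> W \in residue_subspaces d ->
    busemann (star_vertex x W)
      (n + (3 - d)%N%:Z - (W \subset hyperplane l)%:Z *+ 3).
Proof.
have g_unit := vertex_basis_unit x; set g := vertex_basis x in g_unit *.
have [e ge] := has_val_ex (det_unitmx_neq0 g_unit).
have g0_neq0 : row 0 g != 0.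
  apply: contraTneq g_unit => g0.
  rewrite unitmxE (expand_det_row g 0) big1 ?unitr0 // => j _.
  by have /rowP/(_ j) := g0; rewrite !mxE => ->; rewrite mul0r.
have [m [l gm]] := row_val_ex g0_neq0; exists (e - m *+ 3), l.
  by exists g, e, m, l; split=> //; apply: vertex_basisP.
split=> [|d W d3 Wd]; first by case: gm => r [].
have d_le3 : (d <= 3)%N by case/andP: d3 => _ /ltnW.
have WS : W \in proper_subspaces K by apply/proper_subspacesP; exists d.
have [B [B_unit -> yB]] := sub_lattice_rep g_unit Wd (star_vertexP x WS).
have [l' hm] := row_val_flag d B_unit gm.
exists (flag_mx g B d), (e + (3 - d)%N%:Z).
exists (m + (flag_space B d \subset hyperplane l)%:Z), l'.
by split; [|exact: has_val_flag_mx|exact: hm|lia].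
Qed.

Variable R : realType.
Local Notation s := (Num.sqrt (#|K|%:R : R)).

Definition busemann_weight x : R := s ^ (- xget 0 [set n | busemann x n]).

Let q_gt1 : 1 < (#|K|%:R : R).
Proof. by rewrite ltr1n card_finNzRing_gt1. Qed.

Let s_gt0 : 0 < s.
Proof. by rewrite sqrtr_gt0 (lt_trans ltr01). Qed.

Let s_neq0 : s != 0.
Proof. by rewrite gt_eqF. Qed.

Let sqr_s : s ^+ 2 = #|K|%:R.
Proof. by rewrite sqr_sqrtr // ler0n. Qed.

Lemma busemann_weight_gt0 x : 0 < busemann_weight x.
Proof. exact: exprz_gt0. Qed.

Lemma busemann_weightE x n : busemann x n -> busemann_weight x = s ^ (- n).
Proof.
move=> xn; rewrite /busemann_weight; congr (s ^ (- _)).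
by case: xgetP => [m -> xm|/(_ n)[]]; [exact: busemann_uniq xm xn|].
Qed.

Lemma busemann_weight_star x : exists2 l, l != 0 &
  forall d W, (0 < d < 3)%N -> W \in residue_subspaces d ->
    busemann_weight (star_vertex x W) = busemann_weight x
      * (s ^- (3 - d) * (if W \subset hyperplane l then s ^+ 3 else 1)).
Proof.
have [n [l xn [l_neq0 star_n]]] := busemann_star x.
exists l => // d W d3 Wd.
rewrite (busemann_weightE xn) (busemann_weightE (star_n d W d3 Wd)).
rewrite opprB opprD [_ *+ 3 + _]addrC -addrA !expfzDr // -exprnN.
by case: ifP => _; rewrite ?expr1z ?expr0z ?mulr1 ?expr2 -?exprS.
Qed.

Lemma sum_if_subset (T : finType) (S : {set {set T}}) (U : {set T}) (a : R) :
  \sum_(W in S) (if W \subset U then a else 1)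
    = #|S|%:R + #|[set W in S | W \subset U]%SET|%:R * (a - 1).
Proof.
rewrite -sum_natr_bool -sum1_card natr_sum mulr_suml -big_split /=.
by apply: eq_bigr => W _; case: ifP => _; rewrite ?mul1r ?mul0r ?subrKC ?addr0.
Qed.

(* The factor by which both A_1 and A_2 multiply [busemann_weight]. *)
Definition hecke_bound : R := #|K|%:R + (#|K|%:R + 1) * s.

Lemma hecke_bound_ge0 : 0 <= hecke_bound.
Proof. by rewrite addr_ge0 ?mulr_ge0 ?addr_ge0 ?ler01 ?sqrtr_ge0 ?ler0n. Qed.

Lemma sum_in_hyperplane d l : (0 < d < 3)%N -> l != 0 ->
  s ^- (3 - d) * (\sum_(W in residue_subspaces d)
    (if W \subset hyperplane l then s ^+ 3 else 1)) = hecke_bound.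
Proof.
move=> d3 l_neq0; have plane := residue_plane K.
have l_line : hyperplane l \in residue_subspaces 2.
  by apply/hyperplanesP; exists l.
rewrite sum_if_subset /hecke_bound; case: d d3 => [|[|[|d]]] // _.
  rewrite (card_points plane) (card_points_on plane l_line).
  rewrite -natr1 !natrD natrX -[(3 - 1)%N]/2%N.
  by move: s s_neq0 sqr_s => t t_neq0 <-; field.
rewrite (card_lines plane) (_ : [set W in _ | _]%SET = [set hyperplane l]%SET).
  rewrite cards1 !natrD natrX -[(3 - 2)%N]/1%N.
  by move: s s_neq0 sqr_s => t t_neq0 <-; field.
apply/setP => W; rewrite !inE; apply/andP/eqP => [[W2 Wl]|->]; last by [].
by apply/eqP; rewrite eqEcard Wl !(card_residue_subspace (d := 2) isT) // leqnn.
Qed.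

Definition colored_neighbors d x : seq (vertex K) :=
  [seq star_vertex x W | W <- enum (residue_subspaces d)].

Lemma colored_neighbors_uniq d x :
  (0 < d < 3)%N -> uniq (colored_neighbors d x).
Proof.
move=> d3; rewrite map_inj_in_uniq ?enum_uniq // => W W'; rewrite !mem_enum.
move=> Wd W'd; apply: star_vertex_inj; apply/proper_subspacesP;
  first by exists d.
by exists d.
Qed.

Lemma colored_neighborsP d x y : (0 < d < 3)%N ->
  colored_edge d%:R x y <-> y \in colored_neighbors d x.
Proof.
move=> d3; split=> [/(colored_edgeP _ _ d3)[W Wd ->]|/mapP[W]].
  by apply/mapP; exists W; rewrite ?mem_enum.
by rewrite mem_enum => Wd ->; apply/(colored_edgeP _ _ d3); exists W.
Qed.

Lemma sum_busemann_weight d x : (0 < d < 3)%N ->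
  \sum_(y <- colored_neighbors d x) busemann_weight y
    = hecke_bound * busemann_weight x.
Proof.
move=> d3; have [l l_neq0 weightE] := busemann_weight_star x.
rewrite big_map big_enum /= (eq_bigr _ (fun W => weightE d W d3)).
by rewrite -mulr_sumr -mulr_sumr sum_in_hyperplane // mulrC.
Qed.

Theorem joint_spectrum_bound (l1 l2 : R[i]) :
  joint_spectrum (@colored_edge K) l1 l2 -> Normc.normc l1 <= hecke_bound.
Proof.
move=> spec; apply: (schur_approx_eigenvalue
  (E := colored_edge 1) (out_nbrs := colored_neighbors 1)
  (in_nbrs := colored_neighbors 2) (phi := busemann_weight)).
- by move=> x; apply: colored_neighbors_uniq.
- by move=> x; apply: colored_neighbors_uniq.
- by move=> x y; apply: (colored_neighborsP (d := 1)).
- move=> y x; apply: iff_trans (colored_edge_sym x y) _.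
  exact: (colored_neighborsP (d := 2)).
- exact: busemann_weight_gt0.
- exact: hecke_bound_ge0.
- by move=> x; rewrite sum_busemann_weight.
- by move=> x; rewrite sum_busemann_weight.
by move=> e /spec[f [f_norm f_lt _]]; exists f.
Qed.

End Horofunction.

(** * Quotients of the building *)

Local Close Scope classical_set_scope.

Lemma leq_card_rel (T : finType) (A B : {set T}) (r : T -> T -> Prop) :
    (forall v, v \in A -> exists2 w, w \in B & r v w) ->
    (forall v v' w, r v w -> r v' w -> v = v') ->
  (#|A| <= #|B|)%N.
Proof.
move=> r_ex r_inj.
have [h hP] : {h : T -> T & forall v, v \in A -> h v \in B /\ r v (h v)}.
  apply: (@choice _ _ (fun v w => v \in A -> w \in B /\ r v w)) => v.
  have [/r_ex[w wB vw]|_] := boolP (v \in A); last by exists v.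
  by exists w.
rewrite -(card_in_imset (f := h)) => [|v v' /hP[_ vw] /hP[_ v'w] hvv'].
  by apply/subset_leq_card/subsetP => _ /imsetP[v /hP[hvB _] ->].
by apply: r_inj vw _; rewrite hvv'.
Qed.

Section ImagesOfOrdinals.
Variable T : finType.

Lemma imset_ord2 (F : 'I_2 -> T) :
  [set F k | k in 'I_2] = [set F ord0; F ord_max].
Proof.
apply/setP => t; apply/imsetP/set2P => [[k _ ->]|[->|->]];
  last by exists ord_max.
  by case: k => -[|[|]] // lt_k2; [left|right]; congr F; apply/val_inj.
by exists ord0.
Qed.

Lemma imset_ord3 (F : 'I_3 -> T) :
  [set F k | k in 'I_3] = [set F ord0; F (inord 1); F ord_max].
Proof.
apply/setP => t; rewrite !inE -orbA.
apply/imsetP/or3P => [[k _ ->]|[] /eqP->]; last 3 first.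
- by exists ord0.
- by exists (inord 1).
- by exists ord_max.
case: k => -[|[|[|]]] // lt_k3; [constructor 1|constructor 2|constructor 3];
  by apply/eqP; congr F; apply/val_inj; rewrite //= inordK.
Qed.

Lemma set3_rot (a b c : T) : [set a; b; c] = [set b; c; a].
Proof. by rewrite -setUA setUC. Qed.

End ImagesOfOrdinals.

Section Quotient.
Variables (K : finFieldType) (Gam : set 'M[laurent K]_3).
Variables (V : finType) (p : vertex K -> V).
Hypothesis Gam_subgroup : pgl_subgroup Gam.
Hypothesis Gam_displacement : large_displacement Gam.
Hypothesis p_quotient : is_quotient_map Gam p.
Local Notation X := (quotient_complex p).
Local Notation residue_subspaces := (subspaces K 2).
Local Notation n := (#|K| ^ 2 + #|K| + 1)%N.
Implicit Types (x y z : vertex K) (u v w : V) (s : {set V}) (i d : nat).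

Let Gam_unit g : Gam g -> g \in unitmx.
Proof. by case: Gam_subgroup => GamGL _ _ _ /GamGL. Qed.

Let p_orbit x y : p x = p y <-> exists2 g, Gam g & moves_to g x y.
Proof. by case: p_quotient => _; apply. Qed.

Lemma quotient_map_surj u : exists x, p x = u.
Proof. by case: p_quotient => + _; apply. Qed.

Lemma quotient_map_star_inj x y z :
  linked x y -> linked x z -> p y = p z -> y = z.
Proof.
move=> xy xz /p_orbit[g Gam_g gyz].
have [g_scalar|g_nonscalar] := pselect (scalars g).
  by rewrite (scalars_moves g_scalar gyz).
case: (Gam_displacement Gam_g g_nonscalar gyz); exists [:: x; y] => //.
split=> //=; rewrite andbT; apply/andP; split; apply/adjacentP => //.
exact: linked_sym.
Qed.

Lemma quotient_map_linked_neq x y : linked x y -> p x <> p y.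
Proof.
move=> xy /p_orbit[g Gam_g gxy].
have [g_scalar|g_nonscalar] := pselect (scalars g).
  by apply: (linked_neq xy); rewrite (scalars_moves g_scalar gxy).
case: (Gam_displacement Gam_g g_nonscalar gxy); exists [:: x] => //.
by split; rewrite //= andbT; apply/adjacentP/linked_sym.
Qed.

Lemma lift_colored_edge x x' y (c : 'Z_3) : p x = p x' -> colored_edge c x y ->
  exists2 y', colored_edge c x' y' & p y' = p y.
Proof.
move=> /p_orbit[g Gam_g gx] xy; have g_unit := Gam_unit Gam_g.
have [y' gy] := moves_ex y g_unit; exists y'.
  exact: moves_colored_edge g_unit gx gy xy.
by apply/esym/p_orbit; exists g.
Qed.

Lemma lift_cell i (e : 'I_i.+1 -> vertex K) k x :
    building_cell e -> p (e k) = p x ->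
  exists e', [/\ building_cell e', e' k = x & forall j, p (e' j) = p (e j)].
Proof.
move=> e_cell /p_orbit[g Gam_g gx]; have g_unit := Gam_unit Gam_g.
have [e' ee'] : {e' & forall j, moves_to g (e j) (e' j)}.
  by apply: (@choice _ _ (fun j y => moves_to g (e j) y)) => j; apply: moves_ex.
exists e'; split=> [||j]; first exact: moves_cell g_unit ee' e_cell.
  by apply/val_inj; rewrite (ee' k) gx.
by apply/esym/p_orbit; exists g.
Qed.

Lemma quotient_map_cell_inj i (e : 'I_i.+1 -> vertex K) :
  building_cell e -> injective (p \o e).
Proof.
move=> e_cell j k /= ejk; apply/val_inj.
case: (ltngtP j k) => [/(cell_linked e_cell)|/(cell_linked e_cell)|//].
  by move/quotient_map_linked_neq; rewrite ejk.
by move/quotient_map_linked_neq; rewrite ejk.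
Qed.

Lemma quotient_cellsP i s : s \in cells X i <->
  exists2 e : 'I_i.+1 -> vertex K,
    building_cell e & s = [set p (e k) | k in 'I_i.+1].
Proof.
split=> [|[e e_cell ->]]; rewrite !inE; last first.
  rewrite (card_imset _ (quotient_map_cell_inj e_cell)) card_ord eqxx andbT.
  by apply/asboolP; exists i, e.
case/andP=> /asboolP[j [e [e_cell sE]]].
rewrite sE (card_imset _ (quotient_map_cell_inj e_cell)) card_ord => /eqP[ji].
by case: i / ji; exists e.
Qed.

Lemma quotient_cells_at i s x : s \in cells X i -> p x \in s ->
  exists2 e : 'I_i.+1 -> vertex K, building_cell e &
    s = [set p (e k) | k in 'I_i.+1] /\ exists k, e k = x.
Proof.
case/quotient_cellsP=> e e_cell -> /imsetP[k _ /esym/(lift_cell e_cell)].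
move=> [e' [e'_cell e'k pe']]; exists e'; rewrite //; split; last by exists k.
by apply: eq_imset => j; rewrite pe'.
Qed.

Lemma quotient_vertex u : [set u] \in X.
Proof.
have [x <-] := quotient_map_surj u; rewrite inE; apply/asboolP.
exists 0%N, (fun=> x); split; first exact: vertex_cell.
apply/setP => v; rewrite inE; apply/eqP/imsetP => [->|[k _ ->] //].
by exists ord0.
Qed.

Lemma quotient_edges_at x s : s \in cells X 1 /\ p x \in s <->
  exists2 y, linked x y & s = [set p x; p y].
Proof.
split=> [[s1 xs]|[y /linked_cell xy ->]]; last first.
  split; last by rewrite !inE eqxx.
  by apply/quotient_cellsP; exists (fun i : 'I_2 => if i == ord0 then x else y);
    rewrite ?imset_ord2.
have [e e_cell [-> [k <-]]] := quotient_cells_at s1 xs.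
have e01 : linked (e ord0) (e ord_max) by apply: cell_linked.
rewrite imset_ord2; case: k => -[|[|]] // lt_k2.
  by exists (e ord_max); rewrite (_ : Ordinal _ = ord0) //; apply/val_inj.
rewrite (_ : Ordinal _ = ord_max); last exact/val_inj.
by exists (e ord0); [apply: linked_sym|rewrite setUC].
Qed.

Lemma quotient_triangles_at x s : s \in cells X 2 /\ p x \in s <->
  exists y z, triangle x y z /\ s = [set p x; p y; p z].
Proof.
split=> [[s2 xs]|[y [z [/triangle_cell xyz ->]]]]; last first.
  split; last by rewrite !inE eqxx.
  apply/quotient_cellsP; eexists; first exact: xyz.
  by rewrite imset_ord3 /= -val_eqE /= -[_ == ord_max]val_eqE /= inordK.
have [e e_cell [-> [k <-]]] := quotient_cells_at s2 xs.
have e012 := cell_triangle e_cell; have e120 := triangle_rot e012.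
rewrite imset_ord3; case: k => -[|[|[|]]] // lt_k3.
- rewrite (_ : Ordinal _ = ord0); last exact/val_inj.
  by exists (e (inord 1)), (e ord_max).
- rewrite (_ : Ordinal _ = inord 1); last by apply/val_inj; rewrite /= inordK.
  by exists (e ord_max), (e ord0); rewrite [in LHS]set3_rot.
rewrite (_ : Ordinal _ = ord_max); last exact/val_inj.
exists (e ord0), (e (inord 1)); split; first exact: triangle_rot.
by rewrite [in RHS]set3_rot.
Qed.

(* Displacement more than 2 makes [p] injective on stars, so a star of the
   quotient is that of the building. *)
Lemma quotient_star_chart x : star_chart (residue_subspaces 1)
  (residue_subspaces 2) (fun W U => W \subset U) X (p x)
  (fun W => p (star_vertex x W)).
Proof.
have star_linked W : W \in proper_subspaces K -> linked x (star_vertex x W).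
  by move=> WS; apply/linkedP; exists W.
split=> [W W' WS W'S|W WS|s|s].
- move/(quotient_map_star_inj (star_linked W WS) (star_linked W' W'S)).
  exact: star_vertex_inj.
- by rewrite eq_sym; apply/eqP/quotient_map_linked_neq/star_linked.
- apply: iff_trans (quotient_edges_at x s) _.
  split=> [[y /linkedP[W WS ->] ->]|[W WS ->]]; first by exists W.
  by exists (star_vertex x W); first exact: star_linked.
apply: iff_trans (quotient_triangles_at x s) _.
split=> [[z [y [/triangleP[W [U [W1 U2 WU -> ->]]] ->]]]|[W [U [W1 U2 WU ->]]]].
  by exists W, U; rewrite setUAC.
exists (star_vertex x U), (star_vertex x W); rewrite setUAC; split=> //.
exact: star_triangle.
Qed.

Definition quotient_arc : rel V := fun u v => `[< quotient_edge p 1 u v >].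

Lemma quotient_edge_sym u v :
  quotient_edge p 1 u v <-> quotient_edge p 2%:R v u.
Proof.
by split=> -[x [y [xu yv xy]]]; exists y, x; split=> //; apply/colored_edge_sym.
Qed.

Lemma quotient_edge_star x d v : (0 < d < 3)%N ->
  quotient_edge p d%:R (p x) v <->
    exists2 W, W \in residue_subspaces d & v = p (star_vertex x W).
Proof.
move=> d3; split=> [[x' [y [/lift_colored_edge lift <- /lift]]]|[W Wd ->]].
  by case=> y' /(colored_edgeP _ _ d3)[W Wd ->] <-; exists W.
by exists x, (star_vertex x W); split=> //; apply/(colored_edgeP _ _ d3);
  exists W.
Qed.

Lemma quotient_arc_points x v : quotient_arc (p x) v <->
  exists2 W, W \in residue_subspaces 1 & v = p (star_vertex x W).
Proof.
apply: iff_trans (quotient_edge_star x v (d := 1) isT).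
by split=> /asboolP.
Qed.

Lemma quotient_arc_lines x v : quotient_arc v (p x) <->
  exists2 W, W \in residue_subspaces 2 & v = p (star_vertex x W).
Proof.
apply: iff_trans (quotient_edge_star x v (d := 2) isT).
by split=> [/asboolP/quotient_edge_sym|/quotient_edge_sym/asboolP].
Qed.

Definition diamond x w v v' := exists y y' z,
  [/\ p y = v, p y' = v' & p z = w] /\
  [/\ colored_edge 1 x y, colored_edge 2%:R y z, colored_edge 2%:R x y'
    & colored_edge 1 y' z].

Lemma diamond_ex x w v : quotient_arc (p x) v -> quotient_arc w v ->
  exists v', diamond x w v v'.
Proof.
move=> /asboolP[x0 [y0 [xE yE xy0]]] /asboolP/quotient_edge_sym.
move=> [y1 [z1 [y1E zE yz1]]].
have [y xy py] := lift_colored_edge xE xy0.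
have [|z yz pz] := lift_colored_edge (x' := y) _ yz1; first by rewrite y1E py.
have [y' xy' y'z] := colored_diamond_ex xy yz.
by exists (p y'), y, y', z; rewrite py pz.
Qed.

Lemma diamond_inj x w v1 v2 v' : p x != w ->
  diamond x w v1 v' -> diamond x w v2 v' -> v1 = v2.
Proof.
move=> xw [y1 [y1' [z1 [[<- <- z1E] [xy1 yz1 xy1' yz1']]]]].
move=> [y2 [y2' [z2 [[<- y2E z2E] [xy2 yz2 xy2' yz2']]]]].
have edge_linked y z (c : 'Z_3) : colored_edge c y z -> linked y z.
  by case=> /adjacentP.
have [/edge_linked xy1'_linked /edge_linked xy2'_linked] := conj xy1' xy2'.
have [/edge_linked yz1'_linked /edge_linked yz2'_linked] := conj yz1' yz2'.
have yy' : y2' = y1'.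
  exact: quotient_map_star_inj xy2'_linked xy1'_linked y2E.
rewrite yy' in yz2'_linked; have zz : z1 = z2.
  by apply: quotient_map_star_inj yz1'_linked yz2'_linked _; rewrite z1E.
rewrite -zz in yz2; congr p; apply: contrapT => yy.
by case/eqP: xw; rewrite (colored_diamond_uniq xy1 xy2 yz1 yz2 yy).
Qed.

Lemma quotient_outdegree u : #|[set v | quotient_arc u v]| = n.
Proof.
have [f fE] := choice quotient_map_surj.
apply: (card_out_arcs (residue_plane K)
  (f := fun u W => p (star_vertex (f u) W))).
  by move=> v; rewrite -{1}(fE v); apply: quotient_star_chart.
by move=> v w; rewrite -{1}(fE v); apply: quotient_arc_points.
Qed.

Lemma quotient_indegree u : #|[set v | quotient_arc v u]| = n.
Proof.
have [f fE] := choice quotient_map_surj.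
apply: (card_in_arcs (residue_plane K)
  (f := fun u W => p (star_vertex (f u) W))).
  by move=> v; rewrite -{1}(fE v); apply: quotient_star_chart.
by move=> v w; rewrite -{1}(fE v); apply: quotient_arc_lines.
Qed.

Lemma quotient_codegree u w :
  #|[set v | quotient_arc u v && quotient_arc w v]|
    = #|[set v | quotient_arc v u && quotient_arc v w]|.
Proof.
move: u w; apply: regular_codegree_eq quotient_outdegree quotient_indegree _.
move=> u w; have [x <-] := quotient_map_surj u => xw.
apply: (@leq_card_rel _ _ _ (diamond x w)) => [v|v1 v2 v'];
  last exact: diamond_inj.
rewrite inE => /andP[xv wv]; have [v' xwv] := diamond_ex xv wv.
exists v' => //; have [y [y' [z [[_ <- <-] [_ _ xy' y'z]]]]] := xwv.
rewrite inE; apply/andP; split; apply/asboolP; last by exists y', z.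
by apply/quotient_edge_sym; exists x, y'.
Qed.

Lemma hecke_fintype (R : realType) (E : V -> V -> Prop) (P : rel V)
    (f : V -> R[i]) u :
  (forall v w, E v w <-> P v w) -> hecke E f u = \sum_(v | P u v) f v.
Proof.
move=> EP; rewrite (hecke_seq (out_nbrs := fun v => enum (P v))) => [|v|v w].
- by rewrite big_enum.
- exact: enum_uniq.
- by apply: iff_trans (EP v w) _; rewrite mem_enum.
Qed.

Lemma quotient_spectral_gap (R : realType) (f : V -> R[i]) l1 l2 :
    is_ramanujan R p -> (exists u, f u != 0) -> \sum_u f u = 0 ->
    (forall u, \sum_(v | quotient_arc u v) f v = l1 * f u) ->
    (forall u, \sum_(v | quotient_arc v u) f v = l2 * f u) ->
  `|l1| <= (hecke_bound K R)%:C%C.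
Proof.
move=> ramanujan f_neq0 f_sum0 f_out f_in.
rewrite -[`|l1|]/((Normc.normc l1)%:C%C) lecR.
apply: (@joint_spectrum_bound K R l1 l2); apply: ramanujan; exists f.
split=> // u.
  rewrite -f_out; apply: (@hecke_fintype _ _ quotient_arc) => v w.
  by split=> /asboolP.
rewrite -f_in; apply: (@hecke_fintype _ _ (fun v w => quotient_arc w v)) => v w.
by split=> [/quotient_edge_sym/asboolP|/asboolP/quotient_edge_sym].
Qed.

Lemma quotient_mixing (R : realType) (S : {set V}) : is_ramanujan R p ->
  (\sum_(u in S) \sum_(v in S) quotient_arc u v)%:R
    <= n%:R * #|S|%:R ^+ 2 / #|V|%:R + hecke_bound K R * #|S|%:R :> R.
Proof.
move=> ramanujan; set E := (\sum_(u in S) _)%N.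
have bound_ge0 : 0 <= (hecke_bound K R)%:C%C by rewrite lecR hecke_bound_ge0.
have := expander_mixing quotient_outdegree quotient_indegree quotient_codegree
  bound_ge0 (fun f l1 l2 => quotient_spectral_gap ramanujan) S.
have -> : E%:R - n%:R * #|S|%:R ^+ 2 / #|V|%:R
    = (E%:R - n%:R * #|S|%:R ^+ 2 / #|V|%:R)%:C%C :> R[i].
  by rewrite rmorphB rmorphM fmorphV rmorphM rmorphXn !rmorph_nat.
rewrite -[X in _ <= _ * X](rmorph_nat (@real_complex R)) -rmorphM normc_def /=.
rewrite expr0n addr0 sqrtr_sqr lecR => /(le_trans (ler_norm _)).
by rewrite lerBlDl.
Qed.

End Quotient.

Lemma large_order_bounds (R : rcfType) (q : nat) (e0 : R) (mu := e0 / 16) :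
    0 < e0 <= 1 -> (4 / mu ^+ 2) ^+ 2 <= q%:R ->
  Num.sqrt q%:R <= q.+1%:R * mu ^+ 2 / 4 /\
    8 * (q%:R + (q%:R + 1) * Num.sqrt q%:R) <= e0 * (q ^ 2 + q + 1)%N%:R.
Proof.
case/andP=> e0_gt0 e0_le1; have mu_gt0 : 0 < mu by rewrite divr_gt0.
rewrite -[q.+1%:R]natr1 !natrD natrX; set s := Num.sqrt _.
have s_ge0 : 0 <= s by apply: sqrtr_ge0.
have <- : s ^+ 2 = q%:R by rewrite sqr_sqrtr.
rewrite ler_pXn2r ?nnegrE ?divr_ge0 ?sqr_ge0 //.
rewrite ler_pdivrMr ?exprn_gt0 // => s_mu2.
have s_e0 : 1024 <= s * e0.
  have : s * e0 ^+ 2 <= s * e0 by rewrite expr2 ler_wpM2l // ler_piMr // ltW.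
  by move: s_mu2; rewrite /mu expr_div_n; lra.
have s_ge1 : 1 <= s.
  have : s * e0 <= s * 1 by rewrite ler_wpM2l.
  lra.
split.
  have : s * 4 <= s * (s * mu ^+ 2) by rewrite ler_wpM2l.
  by have := sqr_ge0 mu; rewrite [s ^+ 2]expr2; lra.
have s_cube : s <= s ^+ 3 by rewrite -[X in X <= _]expr1; apply: ler_weXn2l.
have s2_cube : s ^+ 2 <= s ^+ 3 by apply: ler_weXn2l.
have cube_e0 : 1024 * s ^+ 3 <= s * e0 * s ^+ 3.
  by rewrite ler_wpM2r // exprn_ge0.
have s2_e0 : 0 <= e0 * s ^+ 2 by rewrite mulr_ge0 ?sqr_ge0 // ltW.
have -> : e0 * ((s ^+ 2) ^+ 2 + s ^+ 2 + 1)
    = s * e0 * s ^+ 3 + e0 * s ^+ 2 + e0 by ring.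
have -> : 8 * (s ^+ 2 + (s ^+ 2 + 1) * s)
    = 8 * s ^+ 2 + 8 * s ^+ 3 + 8 * s by ring.
lra.
Qed.

Theorem theorem1p9 (R : realType) (eps0 : R) (eps0_gt0 : 0 < eps0) :
  exists (q0 : nat) (eps : R), 0 < eps /\
    forall (K : finFieldType) (Gam : set 'M[laurent K]_3)
           (V : finType) (p : vertex K -> V),
      (q0 <= #|K|)%N ->
      pgl_subgroup Gam ->
      pgl_discrete Gam ->
      pgl_cocompact Gam ->
      large_displacement Gam ->
      non_partite Gam ->
      is_quotient_map Gam p ->
      is_ramanujan R p ->
      forall a : cochain V,
        locally_minimal R (quotient_complex p) a ->
        cnorm R 2 (quotient_complex p) 1 a < 1 / (4%:R * (1 + eps0)) ->
        eps * cnorm R 2 (quotient_complex p) 1 a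
          <= cnorm R 2 (quotient_complex p) 2
               (coboundary (quotient_complex p) 1 a).
Proof.
pose e0 := Num.min eps0 1; pose mu := e0 / 16.
have e0_bounds : 0 < e0 <= 1 by rewrite lt_min eps0_gt0 ltr01 ge_min lexx orbT.
exists (Num.bound ((4 / mu ^+ 2) ^+ 2)), (mu ^+ 2).
split; first by rewrite exprn_gt0 // divr_gt0 //; case/andP: e0_bounds.
move=> K Gam V p q_large Gam_sub _ _ Gam_disp _ p_quot ramanujan.
move=> a a_min a_small.
have [f fE] := choice (quotient_map_surj p_quot).
have [|sqrt_le error_le] := @large_order_bounds R #|K| e0 e0_bounds.
  by apply/ltW/(lt_le_trans (archi_boundP (sqr_ge0 _))); rewrite ler_nat.
apply: (planar_isoperimetry (residue_plane K)
  (f := fun u W => p (star_vertex (f u) W)) (e := quotient_arc p)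
  (h := hecke_bound K R)) => //.
- by move=> u; rewrite -{1}(fE u); apply: quotient_star_chart p_quot _.
- by move=> u v; rewrite -{1}(fE u); apply: quotient_arc_points p_quot _ _.
- by move=> u v; rewrite -{1}(fE u); apply: quotient_arc_lines p_quot _ _.
- by move=> S; apply: quotient_mixing p_quot _ _ _.
- exact: quotient_vertex p_quot.
apply: lt_le_trans a_small _.
rewrite ler_pM2l // lef_pV2 ?posrE ?mulr_gt0 ?addr_gt0 //;
  last by case/andP: e0_bounds.
by rewrite ler_pM2l // lerD2l ge_min lexx.
Qed.
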